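(* Let $\mu>0$ and $\lambda_n=n\mu$. Let $A$ and $S$ be independent rate-$1$ Poisson processes, and for each $n\ge1$ let $Q_n(0)$ be a nonnegative-integer-valued random variable independent of $(A,S)$ and $Q_n$ the process determined by $$Q_n(t)=Q_n(0)+A(\lambda_nt)-S\left(\mu\int_0^tQ_n(s)\,ds\right),\quad t\ge0.$$ Let $$M_{n,1}(t)=\frac{A(\lambda_n t)-\lambda_n t}{\sqrt n},\qquad M_{n,2}(t)=\frac{1}{\sqrt n}\left[S\left(\mu\int_0^tQ_n(s)\,ds\right)-\mu\int_0^tQ_n(s)\,ds\right],\quad t\ge0.$$ If $Q_n/n\Rightarrow\omega$ in $D$ as $n\to\infty$, where $\omega(t)=1$ for all $t\ge0$, then $$(M_{n,1},M_{n,2})\Rightarrow(\sqrt\mu\,B_1,\sqrt\mu\,B_2)\quad\text{in }D^2\text{ as }n\to\infty,$$ where $B_1$ and $B_2$ are independent standard Brownian motions.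
   Context: $D=D([0,\infty),\mathbb R)$ has the Skorohod $J_1$ topology and $D^2=D\times D$ the product topology; $\Rightarrow$ denotes convergence in distribution. The defining equation for $Q_n$ is solved recursively over successive jump times. *)

(* Defs.v *)
From HB Require Import structures.
From mathcomp Require Import all_boot all_order all_algebra.
From mathcomp Require Import all_classical all_reals all_analysis.
From mathcomp Require Import lra.

Set Implicit Arguments.
Unset Strict Implicit.
Unset Printing Implicit Defensive.

Import Order.TTheory GRing.Theory Num.Theory.
Import numFieldNormedType.Exports.

Local Open Scope classical_set_scope.
Local Open Scope ring_scope.

Definition cadlag (R : realType) (f : R -> R) : Prop :=
  forall t, 0 <= t ->
    f s @[s --> t^'+] --> f t /\ (0 < t -> cvg (f s @[s --> t^'-])).

(* The space D([0,oo), R).  A function on [0,oo) is represented by its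
   extension by 0 to the negative reals, so that Leibniz equality of paths is
   equality on [0,oo). *)
Record D (R : realType) := MkD {
  path_fun :> R -> R;
  path_cadlag : cadlag path_fun;
  path_neg : forall t, t < 0 -> path_fun t = 0 }.

HB.instance Definition _ (R : realType) := gen_eqMixin (D R).
HB.instance Definition _ (R : realType) := gen_choiceMixin (D R).

(* Strictly increasing bijections of [0,oo); these are automatically
   homeomorphisms, and fix 0. *)
Definition time_change (R : realType) (lam : R -> R) : Prop :=
  set_bij [set t | 0 <= t] [set t | 0 <= t] lam /\
  (forall s t, 0 <= s -> s < t -> lam s < lam t).

(* x_n --> x in J_1 iff there are time changes lam_n such that
   sup_(s >= 0) |lam_n s - s| --> 0 and, for every T,
   sup_(s <= T) |x_n (lam_n s) - x s| --> 0
   (Jacod and Shiryaev, Limit Theorems for Stochastic Processes, VI.1.14).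
   Accordingly the sets [set y | J1_close T eps x y], for T real and eps > 0,
   form a basis of neighbourhoods of x. *)
Definition J1_close (R : realType) (T eps : R) (x y : D R) : Prop :=
  exists lam : R -> R,
    [/\ time_change lam,
        forall s, 0 <= s -> `|lam s - s| <= eps &
        forall s, 0 <= s <= T -> `|y (lam s) - x s| <= eps].

Definition J1_entourage (R : realType) : set_system (D R * D R) :=
  filter_from [set p : R * R | 0 < p.2]
    (fun p => [set xy | J1_close p.1 p.2 xy.1 xy.2]).

Section J1_uniformity.
Context (R : realType).
Implicit Types (x y z : D R) (T e : R).

Lemma time_change_id : time_change (@id R).
Proof.
by split=> //; split; [move=> ?|move=> ? ? _ _|move=> u u0; exists u].
Qed.

Lemma time_change_comp (l1 l2 : R -> R) :
  time_change l1 -> time_change l2 -> time_change (l2 \o l1).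
Proof.
move=> [b1 i1] [b2 i2]; split; first exact: set_bij_comp b1 b2.
move=> s t s0 st; apply: i2; last exact: i1.
by case: b1 => f1 _ _; exact: (f1 s).
Qed.

Lemma time_change_inv (l : R -> R) : time_change l ->
  exists2 k : R -> R, time_change k &
    forall s, 0 <= s -> 0 <= k s /\ l (k s) = s.
Proof.
move=> [[lf li ls] lm].
have kP s : {u : R | 0 <= s -> 0 <= u /\ l u = s}.
  have [s0|s0] := boolP (0 <= s); last by exists 0.
  by apply: cid; have [u u0 lu] := ls s s0; exists u.
pose k s := sval (kP s).
have kE s : 0 <= s -> 0 <= k s /\ l (k s) = s by rewrite /k; case: (kP s).
exists k => //; split; first split.
- by move=> s /kE[].
- move=> s t; rewrite !inE => /kE[_ e1] /kE[_ e2] kst.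
  by rewrite -e1 -e2 kst.
- move=> t t0; have lt0 : 0 <= l t by exact: lf.
  exists (l t) => //; have [k0 e] := kE _ lt0.
  by apply: li; rewrite ?inE.
- move=> s t s0 st; have [ks0 es] := kE _ s0.
  have [kt0 et] := kE t (le_trans s0 (ltW st)).
  rewrite ltNge; apply/negP; rewrite le_eqVlt => /orP[/eqP kts|kts].
    by move: st; rewrite -es -et kts ltxx.
  by have := lm _ _ kt0 kts; rewrite es et ltNge (ltW st).
Qed.

Lemma J1_close_refl T e x : 0 <= e -> J1_close T e x x.
Proof.
by move=> e0; exists id; split=> [|s _|s _]; rewrite ?subrr ?normr0//;
  exact: time_change_id.
Qed.

Lemma J1_close_sub T T' e e' x y : T <= T' -> e' <= e ->
  J1_close T' e' x y -> J1_close T e x y.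
Proof.
move=> TT' ee' [l [tl l1 l2]]; exists l; split=> // s.
  by move=> s0; rewrite (le_trans (l1 s s0)).
by move=> /andP[s0 sT]; rewrite (le_trans (l2 s _))// s0 (le_trans sT).
Qed.

Lemma J1_close_sym T e x y : J1_close (T + e) e x y -> J1_close T e y x.
Proof.
move=> [l [tl l1 l2]]; have [k tk kE] := time_change_inv tl.
exists k; split=> // s.
  by move=> /kE[k0 lk]; have := l1 _ k0; rewrite lk distrC.
move=> /andP[/kE[k0 lk] sT]; have := l2 (k s).
rewrite lk distrC; apply; rewrite k0/=.
by have := l1 _ k0; rewrite lk ler_norml; lra.
Qed.

Lemma J1_close_trans T e x y z :
  J1_close (T + e) e x y -> J1_close (T + e) e y z -> J1_close T (e + e) x z.
Proof.
move=> [l [tl l1 l2]] [k [tk k1 k2]].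
have l0 s : 0 <= s -> 0 <= l s by move=> s0; case: tl => -[lf _ _] _; exact: lf.
exists (k \o l); split=> [|s s0|s /andP[s0 sT]] /=.
- exact: time_change_comp.
- rewrite -(subrKA (l s)); apply: (le_trans (ler_normD _ _)).
  by apply: lerD; [apply/k1/l0|exact: l1].
- have l1s := l1 _ s0.
  have e0 : 0 <= e := le_trans (normr_ge0 _) l1s.
  rewrite -(subrKA (y (l s))); apply: (le_trans (ler_normD _ _)).
  apply: lerD; [apply: k2|apply: l2].
    by rewrite l0//=; move: l1s; rewrite ler_norml; lra.
  by rewrite s0/=; lra.
Qed.

Let J1_filter : Filter (@J1_entourage R).
Proof.
apply: filter_from_filter; first by exists (0, 1) => /=.
move=> [T1 e1] [T2 e2] /= e10 e20.
exists (Num.max T1 T2, Num.min e1 e2) => /=; first by rewrite lt_min e10.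
move=> [x y] /= xy; split; apply: J1_close_sub xy;
  by rewrite ?le_max ?ge_min lexx ?orbT.
Qed.

Let J1_diagonal A : @J1_entourage R A -> diagonal `<=` A.
Proof.
move=> [[T e] /= e0 TA] [x y] xy; apply: TA => /=.
by have -> : x = y := xy; exact/J1_close_refl/ltW.
Qed.

Let J1_inv A : @J1_entourage R A -> J1_entourage A^-1%relation.
Proof.
move=> [[T e] /= e0 TA]; exists (T + e, e) => //= -[x y] /= xy.
by apply: TA => /=; exact: J1_close_sym.
Qed.

Let J1_split A : @J1_entourage R A ->
  exists2 B, J1_entourage B & (B \; B `<=` A)%relation.
Proof.
move=> [[T e] /= e0 TA].
exists [set xy | J1_close (T + e / 2) (e / 2) xy.1 xy.2].
  by exists (T + e / 2, e / 2) => //=; rewrite divr_gt0.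
move=> [x z] [y /= xy yz]; apply: TA => /=.
by rewrite (splitr e); exact: J1_close_trans xy yz.
Qed.

HB.instance Definition _ := isUniform.Build (D R)
  J1_filter J1_diagonal J1_inv J1_split.

End J1_uniformity.

Section D_operations.
Context (R : realType).

Lemma cadlagZ (c : R) (x : R -> R) : cadlag x -> cadlag (fun t => c * x t).
Proof.
move=> xc t t0; have [xr xl] := xc t t0; split=> [|/xl xl'].
  exact: cvgMl_tmp.
exact: is_cvgMl_tmp.
Qed.

Lemma scaleD_neg (c : R) (x : D R) t : t < 0 -> c * x t = 0.
Proof. by move=> /path_neg ->; rewrite mulr0. Qed.

Definition scaleD (c : R) (x : D R) : D R :=
  MkD (cadlagZ c (@path_cadlag _ x)) (@scaleD_neg c x).

Definition cst_fun (c : R) (t : R) : R := if 0 <= t then c else 0.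

Lemma cadlag_cst (c : R) : cadlag (cst_fun c).
Proof.
move=> t t0; split=> [|t_gt0].
  rewrite /cst_fun t0; apply: cvg_near_cst.
  by near=> s; rewrite ifT// (le_trans t0)// ltW.
apply/cvg_ex; exists c; apply: cvg_near_cst.
by near=> s; rewrite /cst_fun ifT// ltW//; near: s; exact: nbhs_left_gt.
Unshelve. all: by end_near. Qed.

Lemma cst_neg (c t : R) : t < 0 -> cst_fun c t = 0.
Proof. by rewrite /cst_fun leNgt => ->. Qed.

Definition cstD (c : R) : D R := MkD (cadlag_cst c) (@cst_neg c).

End D_operations.

Section convergence_in_law.
Context (R : realType).

Definition borel_measurable d (T : measurableType d) (E : topologicalType)
    (X : T -> E) : Prop :=
  forall U, <<s [set V : set E | open V] >> U -> measurable (X @^-1` U).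

(* The members of the sequence live on (T, P), the limit on (T', P').  Only
   the tail of the sequence is required to consist of random elements, as the
   sequences considered here are indexed by n >= 1. *)
Definition cvg_in_law d (T : measurableType d) (P : probability T R)
    d' (T' : measurableType d') (P' : probability T' R)
    (E : topologicalType) (X : nat -> T -> E) (Y : T' -> E) : Prop :=
  [/\ \forall n \near \oo, borel_measurable (X n),
      borel_measurable Y &
      forall f : E -> R, continuous f ->
        (exists M, forall x, `|f x| <= M) ->
        ('E_P[f \o X n] @[n --> \oo] --> 'E_P'[f \o Y])%E].

End convergence_in_law.

Section processes.
Context (R : realType) (d : measure_display) (T : measurableType d)
  (P : probability T R).

(* The sigma-algebra generated by the real random variables X i, i in J. *)
Definition sigma_rv (I : Type) (J : set I) (X : I -> T -> R) : set (set T) :=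
  <<s [set E | exists i, J i /\
         exists2 B, measurable B & E = X i @^-1` B] >>.

Definition independent_sigma (F G : set (set T)) : Prop :=
  forall A B, F A -> G B -> P (A `&` B) = (P A * P B)%E.

Definition process (X : T -> D R) : Prop :=
  forall t, measurable_fun setT (fun w => X w t).

Definition sigma_process (X : T -> D R) : set (set T) :=
  sigma_rv [set t | 0 <= t] (fun t w => X w t).

Definition sigma_process2 (X Y : T -> D R) : set (set T) :=
  sigma_rv [set bt : bool * R | 0 <= bt.2]
    (fun bt w => if bt.1 then X w bt.2 else Y w bt.2).

Definition independent_increments (X : T -> D R) : Prop :=
  forall (n : nat) (t : nat -> R) (B : nat -> set R),
    0 <= t 0%N -> (forall i, t i <= t i.+1) -> (forall i, measurable (B i)) ->
    fine (P (\bigcap_(i < n) [set w | B i (X w (t i.+1) - X w (t i))])) =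
    \prod_(i < n) fine (P [set w | B i (X w (t i.+1) - X w (t i))]).

Record poisson_process (rate : R) (N : T -> D R) : Prop := {
  poisson_meas : process N;
  poisson_0 : forall w, N w 0 = 0;
  poisson_nat : forall w t, 0 <= t -> exists k : nat, N w t = k%:R;
  poisson_nondecreasing : forall w s t, 0 <= s -> s <= t -> N w s <= N w t;
  poisson_indep : independent_increments N;
  poisson_law : forall s t (k : nat), 0 <= s -> s < t ->
    P [set w | N w t - N w s = k%:R] =
    (poisson_pmf (rate * (t - s)) k)%:E }.

(* The second parameter of normal_prob is the standard deviation. *)
Record brownian_motion (B : T -> D R) : Prop := {
  brownian_meas : process B;
  brownian_0 : forall w, B w 0 = 0;
  brownian_continuous : forall w,
    {within [set t | 0 <= t], continuous (B w)};
  brownian_indep : independent_increments B;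
  brownian_law : forall s t (U : set R), 0 <= s -> s < t -> measurable U ->
    P [set w | U (B w t - B w s)] = normal_prob 0 (Num.sqrt (t - s)) U }.

End processes.

(* Main.v *)
(* With a = n mu, the martingales are sqrt(mu) times the rescaled Poisson
   processes x |-> (N(a x) - a x) / sqrt(a), for N = A at x = t and for N = S at
   x = (1/n) int_0^t Q_n, and the fluid limit makes the latter uniformly close
   to t.  No tightness criterion is used: it suffices to show
   E f(Y) <= liminf E f(X_n) for continuous bounded f >= 0, as this can be
   applied to M + f and M - f.  Round the path of Y to a finite code, the
   increments over a dyadic grid measured in units of 1 / sqrt(a).  A ratio
   form of the local limit theorem shows that the Poisson increments take a
   given code with at least (1 - o(1)) times the probability that the Brownian
   increments round to it, so E g(Y) <= E g(X_n) + o(1) for g the infimum of f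
   over a uniform neighbourhood of the coded path.  That X_n stays in this
   neighbourhood follows by dyadic chaining from exponential Poisson tails.
   Finally the envelopes increase to f along continuous paths, and Fatou's lemma
   removes the discretization. *)

Require Import Defs.
From mathcomp Require Import all_boot all_order all_algebra.
From mathcomp Require Import all_classical all_reals all_analysis.
From mathcomp Require Import measurable_realfun.
From mathcomp Require Import ring lra.
Import Order.TTheory GRing.Theory Num.Theory.
Import numFieldNormedType.Exports.
Local Open Scope classical_set_scope.
Local Open Scope ring_scope.

Set Implicit Arguments.
Unset Strict Implicit.
Unset Printing Implicit Defensive.

(** * Approximation of cadlag paths by countably many step paths *)

(** The two laws are compared on the codes themselves: Poisson increments are integers and Brownian
    increments are rounded to the same integers, so both families of events have one index set and
    no coupling on a common probability space is built. The clock of $S$ depends on $S$, so it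
    cannot be treated as an independent time change. The oscillation bounds are therefore uniform in
    time, and only the closeness of the clock to the identity enters. The grid is fixed before $n$
    grows: the number of increments stays constant while each of them loses a factor tending to 1.
    The window of $K$ standard deviations must hold the increments of every path of a given size,
    hence the intermediate limit in the size parameter [p]. Envelopes are evaluated at finitely many
    codes only. The approximating functionals are thus simple functions, and measurability of infima
    over uncountable sets of paths never arises. *)

Section stretch.
Context (R : realType).
Implicit Types a b c s t : R.

(** Everything up to [a] is fixed, [[a, b]] goes affinely onto [[a, c]], and the rest is translated,
    so that further adjustments can be composed beyond [c]. Exchanging [b] and [c] gives the
    inverse. *)
Definition stretch a b c s : R :=
  if s <= a then s else if s <= b then a + (s - a) * ((c - a) / (b - a))
  else s + (c - b).

Lemma stretch_left a b c s : s <= a -> stretch a b c s = s.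
Proof. by rewrite /stretch => ->. Qed.

Lemma stretch_mid a b c s : a <= s <= b -> a < b ->
  stretch a b c s = a + (s - a) * ((c - a) / (b - a)).
Proof.
move=> /andP[] ; rewrite /stretch le_eqVlt => /orP[/eqP <- _ ab|as_ -> ab].
  by rewrite lexx subrr mul0r addr0.
by rewrite leNgt as_.
Qed.

Lemma stretch_right a b c s : a < b -> b <= s -> stretch a b c s = s + (c - b).
Proof.
move=> ab bs; rewrite /stretch leNgt (lt_le_trans ab bs)/=.
move: bs; rewrite le_eqVlt => /orP[/eqP <-|bs]; last by rewrite leNgt bs.
rewrite lexx mulrCA mulfV ?mulr1; first lra.
by rewrite subr_eq0 gt_eqF.
Qed.

Lemma stretch_mono a b c : a < b -> a < c -> {homo stretch a b c : s t / s < t}.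
Proof.
move=> ab ac s t st.
have r0 : 0 < (c - a) / (b - a) by rewrite divr_gt0 ?subr_gt0.
have E : (b - a) * ((c - a) / (b - a)) = c - a.
  by rewrite mulrCA mulfV ?mulr1// subr_eq0 gt_eqF.
have [sa|as_] := leP s a.
  rewrite (stretch_left _ _ sa); have [ta|at_] := leP t a.
    by rewrite stretch_left.
  have [tb|bt] := leP t b.
    rewrite stretch_mid ?tb ?ltW//.
    have : 0 < (t - a) * ((c - a) / (b - a)) by rewrite mulr_gt0// subr_gt0.
    lra.
  by rewrite (stretch_right _ ab (ltW bt)); lra.
have at_ : a < t := lt_trans as_ st.
have [sb|bs] := leP s b.
  rewrite (@stretch_mid _ _ _ s) ?sb ?ltW//; have [tb|bt] := leP t b.
    by rewrite stretch_mid ?tb ?ltW// ltrD2l ltr_pM2r// ltrD2r.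
  rewrite (stretch_right _ ab (ltW bt)).
  have : (s - a) * ((c - a) / (b - a)) <= c - a by rewrite -[leRHS]E ler_pM2r//; lra.
  lra.
by rewrite !stretch_right ?ltrD2r// ltW// (lt_trans bs).
Qed.

Lemma stretchK a b c : a < b -> a < c -> cancel (stretch a b c) (stretch a c b).
Proof.
move=> ab ac s.
have r0 : 0 < (c - a) / (b - a) by rewrite divr_gt0 ?subr_gt0.
have E : (b - a) * ((c - a) / (b - a)) = c - a.
  by rewrite mulrCA mulfV ?mulr1// subr_eq0 gt_eqF.
have [sa|as_] := leP s a; first by rewrite !stretch_left.
have [sb|bs] := leP s b.
  rewrite (@stretch_mid _ _ _ s) ?sb ?ltW//.
  have h1 : 0 < (s - a) * ((c - a) / (b - a)) by rewrite mulr_gt0// subr_gt0.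
  have h2 : (s - a) * ((c - a) / (b - a)) <= c - a by rewrite -[leRHS]E ler_pM2r//; lra.
  rewrite stretch_mid//; last by apply/andP; split; lra.
  field.
  by apply/andP; split; rewrite subr_eq0 gt_eqF.
by rewrite (stretch_right _ ab (ltW bs)) stretch_right//; lra.
Qed.

Lemma time_change_stretch a b c : 0 <= a -> a < b -> a < c ->
  time_change (stretch a b c).
Proof.
move=> a0 ab ac.
have pos s : forall b c, a < b -> a < c -> 0 <= s -> 0 <= stretch a b c s.
  move=> {ab ac} {}b {}c ab ac; rewrite le_eqVlt => /orP[/eqP <-|s0].
    by rewrite stretch_left.
  apply/ltW; rewrite -[ltLHS](@stretch_left a b c)//.
  exact: stretch_mono.
split; last by move=> s t _; exact: stretch_mono.
split.
- by move=> s /=; exact: pos.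
- by move=> s t _ _; exact: (can_inj (stretchK ab ac)).
- move=> s /= s0; exists (stretch a c b s); last exact: stretchK.
  exact: pos.
Qed.

End stretch.

Section cadlag_step.
Context (R : realType).
Implicit Types (x : R -> R) (M : nat) (s t e : R).

Definition grid_floor M s : R := (Num.floor (M%:R * s))%:~R / M%:R.
Definition grid_ceil M s : R := (Num.ceil (M%:R * s))%:~R / M%:R.

Lemma grid_ceilP M s : (0 < M)%N -> s <= grid_ceil M s < s + M%:R^-1.
Proof.
move=> M0; have M0' : 0 < M%:R :> R by rewrite ltr0n.
rewrite /grid_ceil ler_pdivlMr// ltr_pdivrMr// mulrDl mulVf ?gt_eqF//.
rewrite ![s * _]mulrC ceil_ge/=.
by have := ceilB1_lt (M%:R * s); lra.
Qed.

Lemma grid_floorP M s : (0 < M)%N -> grid_floor M s <= s < grid_floor M s + M%:R^-1.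
Proof.
move=> M0; have M0' : 0 < M%:R :> R by rewrite ltr0n.
rewrite /grid_floor ler_pdivrMr// -{2}[_^-1]mul1r -mulrDl ltr_pdivlMr//.
rewrite ![s * _]mulrC; have /andP[-> /=] := floor_itv (M%:R * s).
by rewrite intrD.
Qed.

(** The reason for moving endpoints to their grid ceilings: a sample taken at the grid floor then
    never leaves the half-open interval [[s, t[] on which the path oscillates little. *)
Lemma grid_floor_bounds M s t u : (0 < M)%N ->
  grid_ceil M s <= u < grid_ceil M t -> s <= grid_floor M u < t.
Proof.
move=> M0 /andP[su ut]; have M0' : 0 < M%:R :> R by rewrite ltr0n.
move: su ut; rewrite /grid_ceil /grid_floor ler_pdivrMr// ltr_pdivlMr//.
rewrite [u * _]mulrC => su ut.
rewrite ler_pdivlMr// ltr_pdivrMr// ![_ * M%:R]mulrC.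
apply/andP; split.
  apply: (le_trans (ceil_ge _)); rewrite ler_int.
  by rewrite floor_ge_int.
rewrite ltNge; apply/negP => tf.
have h : (Num.ceil (M%:R * t) <= Num.floor (M%:R * u))%R by rewrite ceil_le_int.
have : (Num.ceil (M%:R * t))%:~R <= M%:R * u by rewrite -floor_ge_int.
by rewrite leNgt ut.
Qed.

(* [lam] moves the endpoints of intervals on which [x] oscillates little up to
   grid points, so that sampling [x] on the grid follows [x] until time [t]. *)
Definition tracks x e M t (lam : R -> R) :=
  [/\ time_change lam,
      forall s, t <= s -> lam s = s - t + grid_ceil M t,
      forall s, 0 <= s -> `|lam s - s| <= M%:R^-1 &
      forall s, 0 <= s < t -> `|x (grid_floor M (lam s)) - x s| <= e].

Definition trackable x e t := exists M0 : nat, forall M, (M0 <= M)%N -> (0 < M)%N ->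
  exists lam, tracks x e M t lam.

Lemma trackable0 x e : trackable x e 0.
Proof.
exists 0%N => M _ M0; exists id; split.
- exact: time_change_id.
- by move=> s _; rewrite /grid_ceil mulr0 ceil0 mul0r subr0 addr0.
- by move=> s _; rewrite subrr normr0 invr_ge0.
- by move=> s; lra.
Qed.

(** The displacement of an affine map is a convex combination of the displacements [c - t] and
    [c' - t'] of the endpoints, both in [[0, h[]. *)
Lemma interpolate_close t t' c c' h s : t < t' -> t <= s <= t' ->
  t <= c < t + h -> t' <= c' < t' + h ->
  `|c + (s - t) * ((c' - c) / (t' - t)) - s| <= h.
Proof.
move=> tt' /andP[ts st'] /andP[h1 h2] /andP[h3 h4].
have t'0 : 0 < t' - t by rewrite subr_gt0.
have th1 : 0 <= (s - t) / (t' - t) by rewrite divr_ge0 ?subr_ge0// ltW.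
have th2 : (s - t) / (t' - t) <= 1 by rewrite ler_pdivrMr// mul1r lerB.
have sE : s - t = (s - t) / (t' - t) * (t' - t) by rewrite divfK// gt_eqF.
rewrite mulrCA [X in _ + X - _]mulrC.
move: sE th1 th2; set th := (s - t) / (t' - t).
clearbody th; clear ts st' tt' t'0 => sE th1 th2.
have -> : c + th * (c' - c) - s = (1 - th) * (c - t) + th * (c' - t').
  by have -> : s = t + th * (t' - t); [lra|ring].
clear sE; rewrite ler_norml; apply/andP; split; nra.
Qed.

(** One more interval of small oscillation is appended by composing [lam] with a [stretch] based at
    the grid ceiling of [t], which leaves [lam] unchanged before [t]. The mesh must not exceed
    [t' - t], so that [t] and [t'] get distinct grid points. *)
Lemma trackable_step x e t t' : 0 <= t -> t < t' ->
  (forall p q, t <= p < t' -> t <= q < t' -> `|x p - x q| <= e) ->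
  trackable x e t -> trackable x e t'.
Proof.
move=> t0 tt' osc [M0 H].
have := archi_boundP (ltW (_ : 0 < (t' - t)^-1)); rewrite invr_gt0 subr_gt0.
set M1 := Num.bound _ => /(_ tt') M1P.
exists (maxn M0 M1) => M; rewrite geq_max => /andP[M0M M1M] Mgt0.
have M0' : 0 < M%:R :> R by rewrite ltr0n.
have Mt : M%:R^-1 <= t' - t.
  rewrite -[leRHS]invrK lef_pV2 ?posrE ?invr_gt0 ?subr_gt0//.
  by apply: (le_trans (ltW M1P)); rewrite ler_nat.
have [lam [tc lamE lamid lamx]] := H M M0M Mgt0.
set c := grid_ceil M t; set c' := grid_ceil M t'.
have /andP[tc1 tc2] := grid_ceilP t Mgt0; rewrite -/c in tc1 tc2.
have /andP[tc1' tc2'] := grid_ceilP t' Mgt0; rewrite -/c' in tc1' tc2'.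
have cc' : c < c' by lra.
have c0 : 0 <= c by lra.
have cb : c < c + (t' - t) by lra.
have lamt : lam t = c by rewrite lamE ?subrr ?add0r.
have lamlt s : 0 <= s -> s < t -> lam s < c.
  by move=> s0 st; rewrite -lamt; apply tc.2.
have mid s : t <= s <= t' ->
    stretch c (c + (t' - t)) c' (lam s) = c + (s - t) * ((c' - c) / (t' - t)).
  move=> /andP[ts st']; rewrite lamE// -/c stretch_mid//; last by apply/andP; split; lra.
  by congr (_ + _ * (_ / _)); lra.
have E : (t' - t) * ((c' - c) / (t' - t)) = c' - c.
  by rewrite mulrCA mulfV ?mulr1// subr_eq0 gt_eqF.
have right s : t' <= s -> stretch c (c + (t' - t)) c' (lam s) = s - t' + c'.
  move=> t's; rewrite lamE -/c; last lra.
  by rewrite stretch_right//; lra.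
exists (stretch c (c + (t' - t)) c' \o lam); split.
- by apply: time_change_comp => //; exact: time_change_stretch.
- by move=> s t's /=; rewrite right.
- move=> s s0 /=; have [st|ts] := ltP s t.
    by rewrite stretch_left ?lamid ?(ltW (lamlt _ s0 st)).
  have [st'|t's] := leP s t'; last first.
    by rewrite (right _ (ltW t's)) ler_norml; apply/andP; split; lra.
  by rewrite mid ?ts//; apply: interpolate_close; rewrite ?ts//; apply/andP.
- move=> s /andP[s0 st'] /=; have [st|ts] := ltP s t.
    by rewrite stretch_left ?lamx ?s0//; exact/ltW/lamlt.
  apply: osc; last by rewrite ts.
  apply: grid_floor_bounds => //; rewrite -/c -/c' (mid s) ?ts ?(ltW st')//.
  have r0 : 0 < (c' - c) / (t' - t) by rewrite divr_gt0// subr_gt0.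
  apply/andP; split; first by rewrite lerDl mulr_ge0 ?(ltW r0)// subr_ge0.
  have : (s - t) * ((c' - c) / (t' - t)) < c' - c by rewrite -[ltRHS]E ltr_pM2r//; lra.
  lra.
Qed.

(** Continuation argument at the supremum [u] of the trackable times. The left limit at [u] yields
    an interval [[s, u[] of small oscillation, so [u] is trackable; right-continuity yields an
    interval starting at [u], so [u < t] is impossible. A jump at [u] is harmless because the
    intervals are half-open. *)
Lemma cadlag_trackable x e t : cadlag x -> 0 < e -> 0 <= t -> trackable x e t.
Proof.
move=> xc e0 t0.
pose S := [set s | 0 <= s <= t /\ trackable x e s].
have S0 : S 0 by split; [rewrite lexx|exact: trackable0].
have Sub : has_ubound S by exists t => s [/andP[]].
have supS : has_sup S by split => //; exists 0.
set u := sup S.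
have u0 : 0 <= u by exact: ub_le_sup.
have ut : u <= t by apply: ge_sup => [|s [/andP[]]//]; exists 0.
have e20 : 0 < e / 2 by rewrite divr_gt0.
have tru : trackable x e u.
  move: u0; rewrite le_eqVlt => /orP[/eqP <-|u_gt0]; first exact: trackable0.
  have [_ /(_ u_gt0)/cvg_ex[l xl]] := xc u (ltW u_gt0).
  have [d /= d0 dP] := (cvgrPdist_lt _ _).1 xl _ e20.
  have [s [/andP[s0 st] trs] us] := sup_adherent d0 supS.
  have su : s <= u by apply: ub_le_sup => //; split=> //; rewrite s0.
  move: su; rewrite le_eqVlt => /orP[/eqP <-//|su].
  apply: (trackable_step s0 su _ trs) => p q /andP[sp pu] /andP[sq qu].
  have hp : `|l - x p| < e / 2.
    by apply: dP => //=; rewrite ltr_distlC; rewrite -/u in us; apply/andP; split; lra.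
  have hq : `|l - x q| < e / 2.
    by apply: dP => //=; rewrite ltr_distlC; rewrite -/u in us; apply/andP; split; lra.
  move: hp hq; rewrite !ltr_distlC ler_distl; lra.
move: ut; rewrite le_eqVlt => /orP[/eqP <-//|ut].
have [xr _] := xc u u0.
have [d /= d0 dP] := (cvgrPdist_lt _ _).1 xr _ e20.
set v := Num.min (u + d / 2) t.
have uv : u < v by rewrite lt_min ut andbT; lra.
have vd : v <= u + d / 2 by rewrite ge_min lexx.
have vt : v <= t by rewrite ge_min lexx orbT.
have : S v.
  split; first by rewrite vt andbT; lra.
  have dP' p : u <= p < v -> `|x u - x p| < e / 2.
    move=> /andP[]; rewrite le_eqVlt => /orP[/eqP <- _|up pv].
      by rewrite subrr normr0.
    by apply: dP => //=; rewrite ltr_distlC; apply/andP; split; lra.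
  apply: (trackable_step u0 uv _ tru) => p q /dP' hp /dP' hq.
  by move: hp hq; rewrite !ltr_distlC ler_distl; lra.
by move=> /(ub_le_sup Sub); rewrite -/u leNgt uv.
Qed.

End cadlag_step.

Section step_path.
Context (R : realType).
Implicit Types (v : nat -> R) (M : nat) (s t : R).

Definition step_fun M v s : R := if 0 <= s then v (Num.truncn (M%:R * s)) else 0.

Lemma cadlag_step_fun M v : (0 < M)%N -> cadlag (step_fun M v).
Proof.
move=> M0 t t0; have M0' : 0 < M%:R :> R by rewrite ltr0n.
have /andP[k1 k2] := truncn_itv (mulr_ge0 (ltW M0') t0).
set k := Num.truncn (M%:R * t) in k1 k2.
split=> [|t_gt0].
  apply: cvg_near_cst.
  have tk : t < k.+1%:R / M%:R by rewrite ltr_pdivlMr// mulrC.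
  near=> s.
  have ts : t < s by near: s; exact: nbhs_right_gt.
  have sk : s < k.+1%:R / M%:R by near: s; exact: nbhs_right_lt.
  have s0 : 0 <= s by rewrite (le_trans t0)// ltW.
  rewrite /step_fun s0 t0 -/k; congr v; apply: truncn_def.
  rewrite mulrC -ltr_pdivlMr// sk andbT (le_trans k1)// [leRHS]mulrC.
  by rewrite ler_pM2l// ltW.
(* At a grid point the left limit is the value on the preceding cell. *)
set j := if M%:R * t == k%:R then k.-1 else k.
have /andP[j1 j2] : j%:R < M%:R * t <= j.+1%:R.
  rewrite /j; case: eqP => [kE|/eqP kN].
    have : 0 < M%:R * t by rewrite mulr_gt0.
    by rewrite kE ltr0n; case: k {k1 k2 j kE} => //= k _; rewrite ltr_nat ltnSn lexx.
  by rewrite (ltW k2) andbT lt_neqAle eq_sym kN.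
apply/cvg_ex; exists (v j); apply: cvg_near_cst.
have jt : j%:R / M%:R < t by rewrite ltr_pdivrMr// mulrC.
near=> s.
have st : s < t by near: s; exact: nbhs_left_lt.
have js : j%:R / M%:R < s by near: s; exact: nbhs_left_gt.
have s0 : 0 <= s by apply: le_trans (ltW js); rewrite divr_ge0.
rewrite /step_fun s0; congr v; apply: truncn_def.
rewrite mulrC -ler_pdivrMr// (ltW js)/= (lt_le_trans _ j2)// [ltLHS]mulrC.
by rewrite ltr_pM2l.
Unshelve. all: by end_near. Qed.

Lemma step_fun_neg M v t : t < 0 -> step_fun M v t = 0.
Proof. by rewrite /step_fun leNgt => ->. Qed.

Definition step_path M (v : nat -> R) : D R :=
  MkD (@cadlag_step_fun M.+1 v isT) (@step_fun_neg M.+1 v).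

(* Samples a path on the grid of mesh [1 / M] up to time [M], rounding its
   values to the same grid, so that only countably many codes occur. *)
Definition code M (x : R -> R) : {ffun 'I_(M * M).+1 -> int} :=
  [ffun i : 'I_(M * M).+1 => Num.floor (M%:R * x (i%:R / M%:R))].

(** Beyond the sampled range [inord] falls back on index 0; this is harmless, as closeness is only
    asserted up to a fixed time. *)
Definition decode M (q : {ffun 'I_(M.+1 * M.+1).+1 -> int}) : D R :=
  step_path M (fun i => (q (inord i))%:~R / M.+1%:R).

Lemma grid_floor_truncn M s : 0 <= s ->
  grid_floor M s = (Num.truncn (M%:R * s))%:R / M%:R :> R.
Proof.
move=> s0; have Ms : 0 <= M%:R * s by rewrite mulr_ge0.
rewrite /grid_floor truncn_floor Ms; congr (_ / _).
by rewrite natr_absz ger0_norm// floor_ge0.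
Qed.

(** Tracking costs [e / 2] and rounding the values another [e / 2]. Since there are countably many
    codes, every path is thus a $J_1$ limit of its images under maps of countable range, the source
    of Borel measurability below. *)
Lemma decode_code (x : D R) (T e : R) : 0 < e ->
  exists M0, forall M, (M0 <= M)%N -> J1_close T e x (decode (code M.+1 x)).
Proof.
(* Tracking holds on [[0, t[] only, so [t] has to exceed [T] strictly. *)
move=> e0; pose t := Num.max T 0 + 1.
have t0 : 0 <= t by rewrite addr_ge0// le_max lexx orbT.
have e20 : 0 < e / 2 by rewrite divr_gt0.
have [M0 H] := cadlag_trackable (@path_cadlag _ x) e20 t0.
have [M1 M1P] : exists M1 : nat, (t + 1) + (e / 2)^-1 + e^-1 < M1%:R.
  exists (Num.bound ((t + 1) + (e / 2)^-1 + e^-1)); apply: archi_boundP.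
  have : 0 < (e / 2)^-1 by rewrite invr_gt0.
  have : 0 < e^-1 by rewrite invr_gt0.
  lra.
exists (maxn M0 M1) => M; rewrite geq_max => /andP[M0M M1M].
have [lam [tc _ lamid lamx]] := H M.+1 (leqW M0M) isT.
have MM : (t + 1) + (e / 2)^-1 + e^-1 < M.+1%:R.
  by apply: (lt_le_trans M1P); rewrite ler_nat (leq_trans M1M).
have M0' : 0 < M.+1%:R :> R by rewrite ltr0n.
have ie0 : 0 < e^-1 by rewrite invr_gt0.
have ie20 : 0 < (e / 2)^-1 by rewrite invr_gt0.
have Me : M.+1%:R^-1 <= e / 2.
  by rewrite -[leRHS]invrK lef_pV2 ?posrE//; lra.
exists lam; split=> // [s s0|s /andP[s0 sT]].
  by apply: (le_trans (lamid _ s0)); apply: (le_trans Me); lra.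
have ls0 : 0 <= lam s by case: tc => -[lf _ _] _; exact: lf.
have st : s < t by rewrite /t (le_lt_trans sT)// ltr_pwDr// le_max lexx.
have lsM : lam s <= M.+1%:R.
  have := lamid s s0; rewrite ler_norml => /andP[_].
  have : M.+1%:R^-1 <= 1 :> R by rewrite invf_le1// ler1n.
  move: MM; clear -st ie0 ie20; clearbody t; set h := M.+1%:R^-1; set m := M.+1%:R.
  by clearbody h m; lra.
rewrite /decode /= /step_fun ls0.
set i := Num.truncn _.
have iM : (i < (M.+1 * M.+1).+1)%N.
  rewrite ltnS -(ler_nat R) natrM; apply: (@le_trans _ _ (M.+1%:R * lam s)).
    by rewrite /i truncn_le mulr_ge0.
  by rewrite ler_pM2l.
rewrite /code ffunE inordK// -(grid_floor_truncn _ ls0).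
have := lamx s; rewrite s0 st => /(_ isT).
have /andP[] := @grid_floorP R M.+1 (x (grid_floor M.+1 (lam s))) isT.
rewrite -/(grid_floor _ _).
move: Me; clear; set h := M.+1%:R^-1; clearbody h; rewrite !ler_distl; lra.
Qed.

End step_path.

(** * Borel measurability in the Skorohod topology *)

Section borel.
Context (R : realType) d (T : measurableType d).

Lemma measurable_preimage_count (C : countType) (q : T -> C) :
  (forall c, measurable [set w | q w = c]) -> forall U, measurable (q @^-1` U).
Proof.
move=> mq U.
have -> : q @^-1` U = \bigcup_n (if unpickle n is Some c then
    [set w | q w = c /\ U c] else set0).
  apply/seteqP; split=> [w Uqw|w [n _]].
    by exists (pickle (q w)) => //; rewrite pickleK.
  by case: unpickle => // c [<-].
apply: bigcup_measurable => n _; case: unpickle => // c.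
have [Uc|nUc] := pselect (U c).
  have -> : [set w | q w = c /\ U c] = [set w | q w = c]; last exact: mq.
  by apply/seteqP; split=> w //= [].
have -> : [set w | q w = c /\ U c] = set0; last exact: measurable0.
by apply/seteqP; split=> w //= [].
Qed.

(** The limit lies in an open [U] iff, for some [k], the approximations eventually lie in the set
    [W k] of points whose [V k]-neighbours are all in [U]. The sets [W k] are arbitrary, which is
    why preimages of all sets under [Xn] are assumed measurable. *)
Lemma borel_measurable_lim (E : uniformType) (V : nat -> set (E * E))
    (X : T -> E) (Xn : nat -> T -> E) :
  (forall k, entourage (V k)) ->
  (forall A, entourage A -> exists k, V k `<=` A) ->
  (forall n U, measurable (Xn n @^-1` U)) ->
  (forall w A, entourage A -> \forall n \near \oo, A (X w, Xn n w)) ->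
  borel_measurable X.
Proof.
move=> entV VA mXn XnX.
suff openX U : open U -> measurable (X @^-1` U).
  apply: (@smallest_sub _ _ _ [set A | measurable (X @^-1` A)]) => //=.
  split=> /= [|A mA|F mF].
  - by rewrite preimage_set0.
  - by rewrite setTD preimage_setC; exact: measurableC.
  - by rewrite preimage_bigcup; exact: bigcup_measurable.
move=> oU; pose W k := [set y | forall z, V k (z, y) -> U z].
have -> : X @^-1` U = \bigcup_k \bigcup_N \bigcap_(n >= N) (Xn n @^-1` (W k)).
  apply/seteqP; split=> [w Uw|w [k _ [N _ H]]].
    move: oU; rewrite openE => /(_ _ Uw); rewrite /interior -nbhs_entourageE.
    move=> [A entA AU]; have [B entB BA] := entourage_split_ex entA.
    have [k Vk] := VA _ (entourage_inv entB).
    have [N _ NB] := XnX w _ entB.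
    exists k => //; exists N => // n /= Nn z /Vk/= Bz.
    by apply: AU; apply/xsectionP; apply: BA; exists (Xn n w) => //; exact: NB.
  have [N' _ N'A] := XnX w _ (entV k).
  by apply: (H (maxn N N')); rewrite /= ?leq_maxl//; exact/N'A/leq_maxr.
apply: bigcup_measurable => k _; apply: bigcup_measurable => N _.
by apply: bigcap_measurable => [|n _]; [exists N => /=|exact: mXn].
Qed.

Lemma measurable_code (X : T -> D R) M c : process X ->
  measurable [set w | code M (X w) = c].
Proof.
move=> pX.
have -> : [set w | code M (X w) = c] = \bigcap_(i in [set: 'I_(M * M).+1])
    [set w | Num.floor (M%:R * X w (i%:R / M%:R)) = c i].
  apply/seteqP; split=> w /=; first by move=> <- i _ /=; rewrite ffunE.
  by move=> H; apply/ffunP => i; rewrite ffunE; exact: H.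
apply: fin_bigcap_measurable => // i _.
have -> : [set w | Num.floor (M%:R * X w (i%:R / M%:R)) = c i] =
    (fun w => M%:R * X w (i%:R / M%:R)) @^-1` `[(c i)%:~R, (c i + 1)%:~R[.
  apply/seteqP; split=> w /=; rewrite in_itv /=.
    by move=> <-; exact: floor_itv.
  by move=> /floor_def.
rewrite -[X in measurable X]setTI; apply: measurable_funM => //.
Qed.

Definition J1_basis (k : nat) : set ((D R * D R) * (D R * D R)) :=
  [set p | J1_close k%:R k.+1%:R^-1 p.1.1 p.2.1 /\ J1_close k%:R k.+1%:R^-1 p.1.2 p.2.2].

Lemma J1_basis_entourage k : entourage (J1_basis k).
Proof.
apply: (@prod_entP (D R) (D R) [set xy | J1_close k%:R k.+1%:R^-1 xy.1 xy.2]
  [set xy | J1_close k%:R k.+1%:R^-1 xy.1 xy.2]).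
all: by exists (k%:R, k.+1%:R^-1) => //=; rewrite invr_gt0.
Qed.

Lemma J1_basisP A : entourage A -> exists k, J1_basis k `<=` A.
Proof.
move=> [[B1 B2] /= [[[T1 e1] /= e10 H1] [[T2 e2] /= e20 H2]] BA].
have [k kP] : exists k : nat, `|T1| + `|T2| + e1^-1 + e2^-1 < k%:R.
  exists (Num.bound (`|T1| + `|T2| + e1^-1 + e2^-1)); apply: archi_boundP.
  by rewrite !addr_ge0 ?invr_ge0// ?ltW.
have n1 := ler_norm T1; have n2 := ler_norm T2.
have p1 := normr_ge0 T1; have p2 := normr_ge0 T2.
have i1 : 0 < e1^-1 by rewrite invr_gt0.
have i2 : 0 < e2^-1 by rewrite invr_gt0.
have kS : k%:R <= k.+1%:R :> R by rewrite ler_nat.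
exists k => -[[x1 x2] [y1 y2]] [/= c1 c2].
have /BA[[[p1' p2'] [q1 q2]] /= Ap [<- <- <- <-]//] :
  (B1 `*` B2) ((x1, y1), (x2, y2)).
split=> /=; [apply: H1 => /=|apply: H2 => /=].
  apply: J1_close_sub c1; first lra.
  by rewrite -[leRHS]invrK lef_pV2 ?posrE//; lra.
apply: J1_close_sub c2; first lra.
by rewrite -[leRHS]invrK lef_pV2 ?posrE//; lra.
Qed.

(** Treating the pair at once bypasses the question whether rectangles generate the Borel sets of
    $D^2$. A code involves finitely many coordinates, so measurability of the coordinates
    suffices. *)
Lemma process_pair_borel_measurable (X Y : T -> D R) : process X -> process Y ->
  borel_measurable (fun w => (X w, Y w)).
Proof.
move=> pX pY.
have H := @borel_measurable_lim (D R * D R)%type J1_basis (fun w => (X w, Y w))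
  (fun n w => (decode R (code n.+1 (X w)), decode R (code n.+1 (Y w)))).
apply: H.
- exact: J1_basis_entourage.
- exact: J1_basisP.
- move=> n U; pose q w := (code n.+1 (X w), code n.+1 (Y w)).
  apply: (@measurable_preimage_count _ q _ [set c | U (decode R c.1, decode R c.2)]).
  move=> [c1 c2].
  have -> : [set w | q w = (c1, c2)] =
      [set w | code n.+1 (X w) = c1] `&` [set w | code n.+1 (Y w) = c2].
    by apply/seteqP; split=> w /= [<- <-].
  by apply: measurableI; exact: measurable_code.
- move=> w A /J1_basisP[k kA].
  have k0 : 0 < k.+1%:R^-1 :> R by rewrite invr_gt0.
  have [M1 H1] := @decode_code R (X w) k%:R _ k0.
  have [M2 H2] := @decode_code R (Y w) k%:R _ k0.
  exists (maxn M1 M2) => // n /=; rewrite geq_max => /andP[n1 n2].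
  by apply: kA; split=> /=; [exact: H1|exact: H2].
Qed.

End borel.

(** * Poisson tails and a local limit estimate *)

Section poisson_tail.
Context (R : realType).

Lemma expR_le_quadratic (x : R) : `|x| <= 2^-1 -> expR x <= 1 + x + 2 * x ^+ 2.
Proof.
rewrite ler_norml => /andP[x1 x2].
have h0 : 0 < 1 - x by lra.
have : expR x <= (1 - x)^-1.
  rewrite -[expR x]invrK -expRN lef_pV2 ?posrE ?expR_gt0//.
  by apply: le_trans (expR_ge1Dx _); lra.
move=> /le_trans; apply.
rewrite -[leLHS]mul1r ler_pdivrMr//; nra.
Qed.

Lemma ln1D_ge (x : R) : - 2^-1 <= x -> x - 2 * x ^+ 2 <= ln (1 + x).
Proof.
move=> x1; have x0 : 0 < 1 + x by lra.
have : ln (1 + x)^-1 <= (1 + x)^-1 - 1.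
  have := @le_ln1Dx R ((1 + x)^-1 - 1); rewrite addrCA subrr addr0; apply.
  by have : 0 < (1 + x)^-1 by [rewrite invr_gt0]; lra.
rewrite lnV ?posrE// => h.
have : x - 2 * x ^+ 2 <= 1 - (1 + x)^-1.
  rewrite lerBrDr -lerBrDl -[leLHS]mul1r ler_pdivrMr//; nra.
lra.
Qed.

Lemma partial_expR_le (z : R) n : 0 <= z ->
  \sum_(0 <= k < n) z ^+ k / k`!%:R <= expR z.
Proof.
move=> z0; have -> : \sum_(0 <= k < n) z ^+ k / k`!%:R = series (exp_coeff z) n by [].
apply: nondecreasing_cvgn_le; last exact: is_cvg_series_exp_coeff.
by apply: nondecreasing_series => k _ _; exact: exp_coeff_ge0.
Qed.

Lemma nneseries_fin_le (u : nat -> R) (c : R) : (forall k, 0 <= u k) ->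
  (forall n, \sum_(0 <= k < n) u k <= c) -> (\sum_(k <oo) (u k)%:E <= c%:E)%E.
Proof.
move=> u0 uc; apply: lime_le.
  by apply: is_cvg_nneseries => n _ _; rewrite lee_fin.
by apply: nearW => n; rewrite sumEFin lee_fin.
Qed.

Context d (T : measurableType d) (P : probability T R).

Definition nat_rv_law (N : T -> R) (p : nat -> R) :=
  [/\ measurable_fun setT N, forall w, exists k : nat, N w = k%:R &
      forall k : nat, P [set w | N w = k%:R] = (p k)%:E].

Lemma measurable_eq_fun (N : T -> R) c : measurable_fun setT N ->
  measurable [set w | N w = c].
Proof.
move=> mN; rewrite -[X in measurable X]setTI.
by rewrite (_ : [set w | N w = c] = N @^-1` [set c])//; exact: mN.
Qed.

(** Markov's inequality with [g] dominating the indicator of [A] on the integers, written as a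
    series over the values of [N], so that subadditivity is enough. *)
Lemma nat_rv_prob_le (N : T -> R) p (g : nat -> R) (A : set R) :
  nat_rv_law N p -> (forall k : nat, A k%:R -> 1 <= g k) -> (forall k, 0 <= g k) ->
  measurable A ->
  (P [set w | A (N w)] <= \sum_(k <oo) (p k * g k)%:E)%E.
Proof.
move=> [mN Nnat pP] g1 g0 mA.
have p0 k : 0 <= p k by rewrite -lee_fin -pP.
have -> : [set w | A (N w)] =
    \bigcup_k (if `[< A k%:R >] then [set w | N w = k%:R] else set0).
  apply/seteqP; split=> [w /= Aw|w [k _]].
    by have [k Nk] := Nnat w; exists k => //; rewrite Nk in Aw; case: asboolP.
  by case: asboolP => // Ak /= ->.
apply: le_trans (measure_sigma_subadditive _ _ _ (@subset_refl _ _)) _.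
- by move=> k; case: asboolP => // _; exact: measurable_eq_fun.
- by apply: bigcup_measurable => k _; case: asboolP => // _; exact: measurable_eq_fun.
apply: lee_nneseries => // k _; case: asboolP => [Ak|_]; last first.
  by rewrite measure0 lee_fin mulr_ge0.
by rewrite [leLHS]pP lee_fin ler_peMr// g1.
Qed.

(** The exponential moment of [th * (N - lam)] is $e^{\lambda(e^{\theta}-1-\theta)}$. Allowing
    either sign of [th] covers both tails. *)
Lemma poisson_chernoff (N : T -> R) (lam x th : R) : 0 < lam ->
  nat_rv_law N (poisson_pmf lam) ->
  (P [set w | (x <= th * (N w - lam))%R] <=
     (expR (lam * (expR th - 1 - th) - x))%:E)%E.
Proof.
move=> lam0 Nlaw.
pose A := [set y : R | x <= th * (y - lam)].
have mA : measurable A.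
  rewrite (_ : A = (fun y => th * (y - lam)) @^-1` `[x, +oo[); last first.
    by apply/seteqP; split=> y /=; rewrite in_itv/= andbT.
  rewrite -[X in measurable X]setTI; apply: measurable_funM => //.
  exact: measurable_funB.
apply: le_trans (nat_rv_prob_le (g := fun k => expR (th * (k%:R - lam) - x))
  Nlaw _ _ mA) _.
- by move=> k /= Ak; rewrite -[leLHS]expR0 ler_expR subr_ge0.
- by move=> k; exact: expR_ge0.
apply: nneseries_fin_le => [k|n].
  by rewrite mulr_ge0 ?expR_ge0 ?poisson_pmf_ge0.
have -> : \sum_(0 <= k < n) poisson_pmf lam k * expR (th * (k%:R - lam) - x) =
    expR (- lam - th * lam - x) * \sum_(0 <= k < n) (lam * expR th) ^+ k / k`!%:R.
  rewrite big_distrr/=; apply: eq_bigr => k _.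
  rewrite /poisson_pmf lam0 exprMn.
  have -> : th * (k%:R - lam) - x = th * k%:R + (- th * lam - x) by ring.
  have -> : - lam - th * lam - x = - lam + (- th * lam - x) by ring.
  by rewrite !expRD [th * k%:R]mulrC expRM_natl; ring.
have -> : lam * (expR th - 1 - th) - x = (- lam - th * lam - x) + lam * expR th by ring.
rewrite [leRHS]expRD ler_pM2l ?expR_gt0//; apply: partial_expR_le.
by rewrite mulr_ge0 ?expR_ge0// ltW.
Qed.

(** Chernoff's bound at $\theta=\pm 1/\sqrt\lambda$. As [4 <= lam] gives $|\theta|\le 1/2$, the
    quadratic bound on the exponential applies and the exponent is at most $2\lambda\theta^2=2$. *)
Lemma poisson_tail (N : T -> R) (lam x : R) : 4 <= lam ->
  nat_rv_law N (poisson_pmf lam) ->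
  (P [set w | (x * Num.sqrt lam <= `|N w - lam|)%R] <=
     (2 * expR (2 - x))%:E)%E.
Proof.
move=> lam4 Nlaw; have lam0 : 0 < lam by lra.
have mN : measurable_fun setT N by case: Nlaw.
have s0 : 0 < Num.sqrt lam by rewrite sqrtr_gt0.
have s2 : Num.sqrt lam * Num.sqrt lam = lam by rewrite -expr2 sqr_sqrtr// ltW.
have s2' : 2 <= Num.sqrt lam by rewrite leNgt; apply/negP => h; nra.
have mB th : measurable [set w | (x <= th * (N w - lam))%R].
  rewrite (_ : [set w | _] = (fun w => th * (N w - lam)) @^-1` `[x, +oo[); last first.
    by apply/seteqP; split=> y /=; rewrite in_itv/= andbT.
  rewrite -[X in measurable X]setTI; apply: measurable_funM => //.
  exact: measurable_funB.
have bnd (th : R) : th ^+ 2 = (Num.sqrt lam)^-1 ^+ 2 -> `|th| <= 2^-1 ->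
    (P [set w | (x <= th * (N w - lam))%R] <= (expR (2 - x))%:E)%E.
  move=> thE th1; apply: le_trans (poisson_chernoff x th lam0 Nlaw) _.
  rewrite lee_fin ler_expR lerD2r.
  have h := expR_le_quadratic th1.
  have : lam * (expR th - 1 - th) <= lam * (2 * th ^+ 2) by rewrite ler_pM2l//; lra.
  move=> /le_trans; apply; rewrite thE exprVn expr2 s2 mulrCA mulfV ?mulr1//.
  by rewrite gt_eqF.
have is2 : (Num.sqrt lam)^-1 <= 2^-1 by rewrite lef_pV2// posrE.
have is0 : 0 < (Num.sqrt lam)^-1 by rewrite invr_gt0.
rewrite mulr_natl mulr2n EFinD.
apply: le_trans (leeD (bnd (Num.sqrt lam)^-1 _ _) (bnd (- (Num.sqrt lam)^-1) _ _)).
- apply: le_trans (measureU2 _ _ _) => //.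
  apply: le_measure; rewrite ?inE//.
  + rewrite (_ : [set w | _] = (fun w => `|N w - lam|) @^-1` `[x * Num.sqrt lam, +oo[); last first.
      by apply/seteqP; split=> y /=; rewrite in_itv/= andbT.
    rewrite -[X in measurable X]setTI; apply: measurableT_comp => //.
    exact: measurable_funB.
  + exact: measurableU.
  move=> w /=; move=> h; have [Nl|Nl] := leP 0 (N w - lam).
      by left; rewrite mulrC ler_pdivlMr//; move: h; rewrite ger0_norm.
  right; move: h; rewrite ltr0_norm// => h.
  by rewrite mulNr -mulrN mulrC ler_pdivlMr.
- by [].
- by rewrite gtr0_norm.
- by rewrite sqrrN.
- by rewrite normrN gtr0_norm.
Qed.

End poisson_tail.

(** * Poisson weights against Gaussian cell masses *)

Section local_limit.
Context (R : realType).
Implicit Types (a c s lam r K Dl : R) (k : nat).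

(* The [k]-th cell is the set of values [z] whose image [lam + c * z] rounds
   down to [k]. *)
Definition cell (c lam : R) k : set R := [set z | k%:R <= lam + c * z < k.+1%:R].

Lemma cellE c lam k : 0 < c ->
  cell c lam k = `[(k%:R - lam) / c, (k%:R - lam) / c + c^-1[%classic.
Proof.
move=> c0.
have -> : (k%:R - lam) / c + c^-1 = (k.+1%:R - lam) / c.
  by rewrite -[X in _ + X]mul1r -mulrDl -natr1; congr (_ / _); ring.
apply/seteqP; split=> z; rewrite /cell /= in_itv /= ler_pdivrMr// ltr_pdivlMr//
  [z * c]mulrC -natr1; move=> /andP[h1 h2]; apply/andP; split; lra.
Qed.

Lemma measurable_cell c lam k : 0 < c -> measurable (cell c lam k).
Proof. by move=> c0; rewrite cellE. Qed.

Lemma trivIset_cell c lam : trivIset setT (cell c lam).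
Proof.
move=> i j _ _ [z [/= /andP[i1 i2] /andP[j1 j2]]].
have ij : (i < j.+1)%N by rewrite -(ltr_nat R) (le_lt_trans i1).
have ji : (j < i.+1)%N by rewrite -(ltr_nat R) (le_lt_trans j1).
by apply/eqP; rewrite eqn_leq -ltnS ij -ltnS ji.
Qed.

Lemma normal_prob_itv (s l h b1 b2 : R) : 0 <= h ->
  (forall z, l <= z < l + h -> b1 <= normal_pdf 0 s z <= b2) ->
  h * b1 <= fine (normal_prob 0 s `[l, l + h[) <= h * b2.
Proof.
move=> h0 H.
have fin : normal_prob 0 s `[l, l + h[ \is a fin_num by apply: fin_num_measure.
have vol : lebesgue_measure (`[l, l + h[ : set R) = h%:E.
  rewrite lebesgue_measure_itv /= lte_fin.
  move: h0; rewrite le_eqVlt => /orP[/eqP <-|h0]; first by rewrite addr0 ltxx.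
  by rewrite ltrDl h0 -EFinD addrC addKr.
have E (b : R) : (\int[lebesgue_measure]_(x in `[l, (l + h)%R[) (cst b%:E) x)%E = (h * b)%:E.
  by rewrite integral_cst// [X in (_ * X)%E]vol -EFinM mulrC.
have intb (b : R) : lebesgue_measure.-integrable `[l, l + h[ (cst b%:E).
  apply/integrableP; split; first exact: measurable_cst.
  by rewrite /= integral_cst// [X in (_ * X)%E]vol -EFinM ltry.
have intp : lebesgue_measure.-integrable `[l, l + h[ (EFin \o normal_pdf 0 s).
  exact: integrableS (integrable_normal_pdf 0 s).
rewrite -!lee_fin fineK// -!E /normal_prob; apply/andP; split; apply: le_integral => //.
  by move=> z; rewrite inE /= in_itv /= lee_fin => /H/andP[].
by move=> z; rewrite inE /= in_itv /= lee_fin => /H/andP[].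
Qed.

Definition cell_mass a Dl k : R :=
  fine (normal_prob 0 (Num.sqrt Dl) (cell (Num.sqrt a) (a * Dl) k)).

(** The width of the cell times the normal density at its left end [(k - lam) / sqrt a]; for
    [lam = a * Dl] the exponent takes the displayed form, which is also the one used for Poisson
    weights. *)
Definition cell_approx a Dl lam k : R := (Num.sqrt a)^-1 *
  (normal_peak (Num.sqrt Dl) * expR (- ((k%:R - lam) ^+ 2 / (2 * lam)))).

(** Here [r] is the standard deviation of a Poisson increment and [K] the half-width of the window
    in units of [r]. Across one cell, $(k+\theta-r^2)^2/(2r^2)$ with $\theta\in[0,1]$ varies by at
    most $(2Kr+1)/(2r^2)\le (K+1/2)/r$. *)
Lemma cell_mass_bounds a Dl K r k : 0 < a -> 0 < Dl -> a * Dl = r * r ->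
  1 <= K -> 1 <= r -> `|k%:R - r * r| <= K * r ->
  cell_approx a Dl (r * r) k * expR (- ((K + 2^-1) / r)) <= cell_mass a Dl k <=
  cell_approx a Dl (r * r) k * expR ((K + 2^-1) / r).
Proof.
move=> a0 Dl0 aD K1 r1 kK; pose lam := r * r; pose eta := (K + 2^-1) / r.
have r0 : 0 < r by lra.
have lam0 : 0 < lam by exact: mulr_gt0.
have r2 : lam = r * r by [].
have sa : 0 < Num.sqrt a by rewrite sqrtr_gt0.
have sD : 0 < Num.sqrt Dl by rewrite sqrtr_gt0.
rewrite -/eta -r2 in kK *.
rewrite /cell_approx -!mulrA /cell_mass cellE// aD -r2; apply: normal_prob_itv.
  by rewrite invr_ge0 ltW.
move=> z zc.
have [th [th0 th1 zE]] : exists th, [/\ 0 <= th, th <= 1 &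
    z = (k%:R + th - lam) / Num.sqrt a].
  exists (Num.sqrt a * z - k%:R + lam); split.
  - move: zc => /andP[h _]; have : (k%:R - lam) / Num.sqrt a * Num.sqrt a <= z * Num.sqrt a by rewrite ler_pM2r.
    by rewrite divfK ?gt_eqF// mulrC; lra.
  - move: zc => /andP[_ h]; have : z * Num.sqrt a <= ((k%:R - lam) / Num.sqrt a + (Num.sqrt a)^-1) * Num.sqrt a by rewrite ler_pM2r// ltW.
    by rewrite mulrDl mulVf ?gt_eqF// divfK ?gt_eqF// mulrC; lra.
  - have -> : k%:R + (Num.sqrt a * z - k%:R + lam) - lam = z * Num.sqrt a by ring.
    by rewrite mulfK// gt_eqF.
have -> : normal_pdf 0 (Num.sqrt Dl) z = normal_peak (Num.sqrt Dl) *
    expR (- ((k%:R + th - lam) ^+ 2 / (2 * lam))).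
  rewrite normal_pdfE ?gt_eqF// /normal_fun subr0; congr (_ * expR _).
  rewrite sqr_sqrtr ?(ltW Dl0)// mulNr; congr (- _).
  rewrite zE expr_div_n sqr_sqrtr ?(ltW a0)// -mulrA -invfM; congr (_ / _).
  by rewrite r2 -aD -mulr_natr; ring.
rewrite -!expRD !ler_pM2l ?normal_peak_gt0 ?gt_eqF// !ler_expR.
have D : (k%:R + th - lam) ^+ 2 / (2 * lam) - (k%:R - lam) ^+ 2 / (2 * lam) =
    (2 * th * (k%:R - lam) + th ^+ 2) / (2 * lam).
  by rewrite -mulrBl; congr (_ / _); ring.
have etaE : eta = (2 * K * r + r) / (2 * lam).
  by rewrite r2 /eta; field; rewrite gt_eqF.
suff : - eta <= (2 * th * (k%:R - lam) + th ^+ 2) / (2 * lam) <= eta.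
  by rewrite -D => /andP[h1 h2]; apply/andP; split; lra.
rewrite etaE -mulNr !ler_pM2r ?invr_gt0 ?mulr_gt0//.
move: kK; rewrite ler_norml => /andP[k1 k2].
clear -k1 k2 th0 th1 r1 r0 K1.
set u := k%:R - lam in k1 k2 *; clearbody u.
have h1 : th * (K * r + u) <= 1 * (K * r + u) by rewrite ler_wpM2r//; lra.
have h2 : th * (K * r - u) <= 1 * (K * r - u) by rewrite ler_wpM2r//; lra.
have h3 : 0 <= th * (K * r + u) by rewrite mulr_ge0//; lra.
have h4 : 0 <= th * (K * r - u) by rewrite mulr_ge0//; lra.
have h5 : 0 <= th ^+ 2 by rewrite sqr_ge0.
have h6 : th ^+ 2 <= 1 by rewrite expr_le1.
have h7 : th * (K * r) <= K * r by rewrite ler_piMl// mulr_ge0//; lra.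
have E1 : th * (K * r + u) = th * (K * r) + th * u by ring.
have E2 : th * (K * r - u) = th * (K * r) - th * u by ring.
apply/andP; split; lra.
Qed.

(** The logarithm of the Poisson weight divided by the unnormalized Gaussian weight. Only its
    variation over the window matters. *)
Definition log_dev lam k : R := ln (poisson_pmf lam k) + (k%:R - lam) ^+ 2 / (2 * lam).

Lemma poisson_pmf_gt0 lam k : 0 < lam -> 0 < poisson_pmf lam k.
Proof.
move=> l0; rewrite /poisson_pmf l0 mulr_gt0 ?expR_gt0// mulr_gt0 ?exprn_gt0//.
Qed.

(** With [y = (k + 1 - lam) / lam], the Poisson weight is divided by [1 + y] and the quadratic term
    grows by $y-1/(2\lambda)$. First-order terms cancel, leaving $y-\ln(1+y)-1/(2\lambda)$, where
    $y^2\le K^2/\lambda$. *)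
Lemma log_dev_step K r k : 1 <= K -> 2 * K <= r ->
  `|k.+1%:R - r * r| <= K * r ->
  `|log_dev (r * r) k.+1 - log_dev (r * r) k| <= (2 * K ^+ 2 + 1) / (r * r).
Proof.
move=> K1 rK kK; set lam := r * r.
have r0 : 0 < r by lra.
have lam0 : 0 < lam by exact: mulr_gt0.
pose y := (k.+1%:R - lam) / lam.
have yE : k.+1%:R = lam * (1 + y).
  by rewrite /y mulrDr mulr1 [lam * _]mulrC divfK ?gt_eqF// addrC subrK.
have y1 : 0 < 1 + y by rewrite -(pmulr_rgt0 _ lam0) -yE ltr0n.
have ratio : ln (poisson_pmf lam k.+1) = ln (poisson_pmf lam k) - ln (1 + y).
  have -> : poisson_pmf lam k.+1 = poisson_pmf lam k * (1 + y)^-1.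
    rewrite /poisson_pmf lam0 exprS factS natrM yE.
    field; rewrite (gt_eqF lam0) (gt_eqF y1) pnatr_eq0 -lt0n fact_gt0//.
  by rewrite lnM ?posrE ?poisson_pmf_gt0 ?invr_gt0// lnV ?posrE.
have sq : (k.+1%:R - lam) ^+ 2 / (2 * lam) - (k%:R - lam) ^+ 2 / (2 * lam) =
    y - (2 * lam)^-1.
  by rewrite /y -natr1; field; rewrite gt_eqF.
have yb : `|y| <= K / r.
  rewrite /y normrM [`|lam^-1|]gtr0_norm ?invr_gt0// ler_pdivrMr//.
  apply: (le_trans kK); rewrite /lam mulrA divfK ?gt_eqF//.
have y2 : y ^+ 2 <= K ^+ 2 / lam.
  rewrite -real_normK ?num_real// /lam -expr2 -expr_div_n.
  by rewrite ler_pXn2r// ?nnegrE// divr_ge0; lra.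
have yh : - 2^-1 <= y.
  have : K / r <= 2^-1 by rewrite ler_pdivrMr//; lra.
  by move: yb; rewrite ler_norml; lra.
have L1 := ln1D_ge yh; have L2 : ln (1 + y) <= y by apply: le_ln1Dx; lra.
have -> : log_dev lam k.+1 - log_dev lam k = (y - ln (1 + y)) - (2 * lam)^-1.
  by rewrite /log_dev ratio; move: sq; lra.
have il : 0 < (2 * lam)^-1 by rewrite invr_gt0 mulr_gt0.
have il2 : (2 * lam)^-1 <= lam^-1 by rewrite lef_pV2 ?posrE ?mulr_gt0//; lra.
have -> : (2 * K ^+ 2 + 1) / lam = 2 * (K ^+ 2 / lam) + lam^-1 by ring.
by rewrite ler_norml; apply/andP; split; lra.
Qed.

(** At most $2Kr$ unit steps separate two points of the window, and each costs $O(r^{-2})$. *)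
Lemma log_dev_close K r k k' : 1 <= K -> 2 * K <= r ->
  `|k%:R - r * r| <= K * r -> `|k'%:R - r * r| <= K * r ->
  `|log_dev (r * r) k - log_dev (r * r) k'| <= 2 * K * (2 * K ^+ 2 + 1) / r.
Proof.
move=> K1 rK; wlog kk' : k k' / (k <= k')%N => [H|] kK k'K.
  case: (leqP k k') => [kk'|/ltnW k'k]; first exact: H.
  by rewrite distrC; exact: H.
have r0 : 0 < r by lra.
have -> : 2 * K * (2 * K ^+ 2 + 1) / r = (2 * K * r) * ((2 * K ^+ 2 + 1) / (r * r)).
  by field; rewrite gt_eqF.
apply: (@le_trans _ _ ((k' - k)%:R * ((2 * K ^+ 2 + 1) / (r * r)))).
  rewrite distrC -(subnKC kk') addKn.
  have : `|(k + (k' - k))%:R - r * r| <= K * r by rewrite subnKC.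
  elim: (k' - k)%N => [|j IH] jK; first by rewrite addn0 subrr normr0 mul0r.
  have jK' : `|(k + j)%:R - r * r| <= K * r.
    move: kK jK; rewrite !natrD -natr1 !ler_norml => /andP[h1 h2] /andP[h3 h4].
    have j0 : 0 <= j%:R :> R by exact: ler0n.
    by apply/andP; split; lra.
  rewrite addnS in jK *.
  rewrite -(subrKA (log_dev (r * r) (k + j))) -natr1 mulrDl mul1r addrC.
  apply: (le_trans (ler_normD _ _)); apply: lerD; last exact: log_dev_step.
  exact: IH.
rewrite ler_pM2r; last by rewrite divr_gt0 ?mulr_gt0//; nra.
rewrite natrB//; move: kK k'K; rewrite !ler_norml; lra.
Qed.

(** The bound of [log_dev_close] plus twice the exponent [(K + 1/2) / r] of [cell_mass_bounds], once
    for each of the two cells compared. *)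
Definition local_error K r : R := (2 * K * (2 * K ^+ 2 + 1) + 2 * K + 1) / r.

(* Comparing two values of [k] cancels the normalizing constants, so that no
   form of Stirling's formula is needed; [local_lower] recovers the constant by
   summing over [k']. *)
Lemma local_ratio a Dl K r k k' : 0 < a -> 0 < Dl -> a * Dl = r * r ->
  1 <= K -> 2 * K <= r ->
  `|k%:R - r * r| <= K * r -> `|k'%:R - r * r| <= K * r ->
  expR (- local_error K r) * (poisson_pmf (r * r) k' * cell_mass a Dl k) <=
  poisson_pmf (r * r) k * cell_mass a Dl k'.
Proof.
move=> a0 Dl0 aD K1 rK kK k'K; pose lam := r * r.
have r1 : 1 <= r by lra.
have r0 : 0 < r by lra.
have lam0 : 0 < lam by exact: mulr_gt0.
have r2 : r * r = lam by [].
have /andP[_ B] := cell_mass_bounds a0 Dl0 aD K1 r1 kK.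
have /andP[B' _] := cell_mass_bounds a0 Dl0 aD K1 r1 k'K.
rewrite r2 in kK k'K B B' *.
have dev j : poisson_pmf lam j =
    expR (log_dev lam j) * expR (- ((j%:R - lam) ^+ 2 / (2 * lam))).
  by rewrite -expRD /log_dev addrK lnK// posrE poisson_pmf_gt0.
have := @log_dev_close K r k k' K1 rK kK k'K; rewrite r2.
rewrite ler_norml => /andP[L _].
have p0 := ltW (@poisson_pmf_gt0 lam k' lam0).
apply: (@le_trans _ _ (expR (- local_error K r) * (poisson_pmf lam k' *
  (cell_approx a Dl lam k * expR ((K + 2^-1) / r))))).
  by rewrite ler_wpM2l ?expR_ge0// ler_wpM2l.
apply: (@le_trans _ _ (poisson_pmf lam k *
  (cell_approx a Dl lam k' * expR (- ((K + 2^-1) / r))))); last first.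
  by rewrite ler_wpM2l// ltW// poisson_pmf_gt0.
rewrite /cell_approx.
rewrite !dev; set e1 := expR (- ((k%:R - _) ^+ 2 / _)).
set e2 := expR (- ((k'%:R - _) ^+ 2 / _)).
set c1 := (Num.sqrt a)^-1; set c2 := normal_peak _.
have -> : expR (- local_error K r) * (expR (log_dev lam k') * e2 *
    (c1 * (c2 * e1) * expR ((K + 2^-1) / r))) =
    (expR (- local_error K r) * expR (log_dev lam k') * expR ((K + 2^-1) / r)) *
    (c1 * c2 * e1 * e2) by ring.
have -> : expR (log_dev lam k) * e1 *
    (c1 * (c2 * e2) * expR (- ((K + 2^-1) / r))) =
    (expR (log_dev lam k) * expR (- ((K + 2^-1) / r))) *
    (c1 * c2 * e1 * e2) by ring.
rewrite ler_wpM2r//.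
  rewrite mulr_ge0 ?expR_ge0// mulr_ge0 ?expR_ge0// mulr_ge0 ?normal_peak_ge0//.
  by rewrite invr_ge0 sqrtr_ge0.
rewrite -!expRD ler_expR.
have -> : local_error K r = 2 * K * (2 * K ^+ 2 + 1) / r + 2 * ((K + 2^-1) / r).
  by rewrite /local_error; field; rewrite gt_eqF.
by move: L; lra.
Qed.

End local_limit.

Section local_lower.
Context (R : realType) d (T : measurableType d) (P : probability T R).
Implicit Types (a s lam r K Dl : R) (k : nat).

Lemma cell_mass_ge0 a Dl k : 0 <= cell_mass a Dl k.
Proof. by rewrite fine_ge0. Qed.

Lemma sum_cell_mass_le1 a Dl n (W : pred nat) : 0 < a ->
  \sum_(k < n | W k) cell_mass a Dl k <= 1.
Proof.
move=> a0; have sa : 0 < Num.sqrt a by rewrite sqrtr_gt0.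
apply: (@le_trans _ _ (\sum_(k < n) cell_mass a Dl k)).
  rewrite [leRHS](bigID (fun k : 'I_n => W k))/= lerDl.
  by apply: sumr_ge0 => k _; exact: cell_mass_ge0.
have mc k : measurable (cell (Num.sqrt a) (a * Dl) k) by exact: measurable_cell.
have fin k : normal_prob 0 (Num.sqrt Dl) (cell (Num.sqrt a) (a * Dl) k) \is a fin_num.
  by apply: fin_num_measure; exact: mc.
rewrite -lee_fin -sumEFin.
under eq_bigr do rewrite /cell_mass fineK//.
rewrite -(@measure_bigsetU _ _ _ (normal_prob 0 (Num.sqrt Dl)) (cell (Num.sqrt a) (a * Dl)))//.
  by apply: probability_le1; apply: bigsetU_measurable => i _; exact: mc.
exact: trivIset_cell.
Qed.

(** Sum [local_ratio] over [k'] in the window: by the tail bound for [N] the Poisson weights add up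
    to at least $1-2e^{2-K}$, while the masses of disjoint cells add up to at most 1. *)
Lemma local_lower (N : T -> R) a Dl K r k :
  nat_rv_law P N (poisson_pmf (r * r)) ->
  0 < a -> 0 < Dl -> a * Dl = r * r ->
  1 <= K -> 2 * K <= r -> `|k%:R - r * r| <= K * r ->
  expR (- local_error K r) * (1 - 2 * expR (2 - K)) * cell_mass a Dl k <=
  poisson_pmf (r * r) k.
Proof.
move=> Nlaw a0 Dl0 aD K1 rK kK.
have r0 : 0 < r by lra.
have r2 : 4 <= r * r by nra.
pose b := (Num.truncn (r * r + K * r)).+1.
pose W (j : nat) := `|j%:R - r * r| <= K * r.
have Wb j : W j -> (j < b)%N.
  rewrite /W ler_norml => /andP[_ h]; rewrite ltnS.
  by rewrite truncn_ge_nat; [lra|rewrite addr_ge0// mulr_ge0//; lra].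
have sum1 : 1 - 2 * expR (2 - K) <= \sum_(j < b | W j) poisson_pmf (r * r) j.
  have tail := poisson_tail K r2 Nlaw.
  have mN : measurable_fun setT N by case: Nlaw.
  pose A := [set y : R | `|y - r * r| < K * r].
  have mA : measurable A.
    rewrite (_ : A = (fun y => `|y - r * r|) @^-1` `]-oo, K * r[); last first.
      by apply/seteqP; split=> y /=; rewrite in_itv.
    rewrite -[X in measurable X]setTI; apply: measurableT_comp => //.
    exact: measurable_funB.
  have mNA : measurable [set w | A (N w)].
    by rewrite -[X in measurable X]setTI; exact: mN.
  have up : (P [set w | A (N w)] <= (\sum_(j < b | W j) poisson_pmf (r * r) j)%:E)%E.
    apply: (le_trans (nat_rv_prob_le (g := fun j => (W j)%:R) Nlaw _ _ mA)) => //.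
    - by move=> j /=; rewrite /A/= => /ltW Wj; rewrite /W Wj.
    apply: nneseries_fin_le => [j|n].
      by rewrite mulr_ge0// poisson_pmf_ge0.
    have [nb|bn] := leqP n b.
      rewrite -(big_mkord W) (big_cat_nat (leq0n n) nb)//= [X in _ <= X + _]big_mkcond/=.
      rewrite -[leLHS]addr0; apply: lerD.
        apply: ler_sum => j _; case: (W j); first by rewrite mulr1.
        by rewrite mulr0.
      by apply: sumr_ge0 => j _; exact: poisson_pmf_ge0.
    rewrite (big_cat_nat (leq0n b) (ltnW bn))//= [X in _ + X <= _]big_nat_cond [X in _ + X <= _]big1.
      rewrite addr0 -(big_mkord W) [leRHS]big_mkcond/=; apply: ler_sum => j _.
      by case: (W j); rewrite ?mulr1 ?mulr0.
    move=> j /andP[/andP[bj _] _]; have [/Wb|_] := boolP (W j); last by rewrite mulr0.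
    by rewrite ltnNge bj.
  rewrite -lee_fin; apply: le_trans up.
  have -> : [set w | A (N w)] = ~` [set w | (K * Num.sqrt (r * r) <= `|N w - r * r|)%R].
    rewrite -expr2 sqrtr_sqr gtr0_norm//; apply/seteqP; split=> w; rewrite /A /=.
      by rewrite ltNge => /negP.
    by move=> /negP; rewrite -ltNge.
  rewrite probability_setC; last first.
    rewrite -[X in measurable X]setCK; apply: measurableC.
    rewrite (_ : ~` _ = [set w | A (N w)])//.
    rewrite -expr2 sqrtr_sqr gtr0_norm//; apply/seteqP; split=> w; rewrite /A /=.
      by move=> /negP; rewrite -ltNge.
    by rewrite ltNge => /negP.
  by rewrite EFinB leeB.
have p0 := poisson_pmf_ge0 (r * r) k.
have q0 := cell_mass_ge0 a Dl k.
apply: (@le_trans _ _ (poisson_pmf (r * r) k * \sum_(j < b | W j) cell_mass a Dl j)); last first.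
  by rewrite -[leRHS]mulr1 ler_wpM2l// sum_cell_mass_le1.
apply: (@le_trans _ _ (expR (- local_error K r) *
    (\sum_(j < b | W j) poisson_pmf (r * r) j) * cell_mass a Dl k)).
  by rewrite ler_wpM2r// ler_wpM2l// expR_ge0.
rewrite -mulrA mulr_suml !mulr_sumr; apply: ler_sum => j Wj.
exact: local_ratio.
Qed.

End local_lower.

(** * Probabilities of codes: Poisson against Brownian increments *)

Section increments.
Context (R : realType) d (T : measurableType d) (P : probability T R).

Lemma sigma_process_increments (X : T -> D R) n (t : nat -> R) (U : nat -> set R) :
  (forall i, 0 <= t i) -> (forall i, measurable (U i)) ->
  sigma_process X (\bigcap_(i < n) [set w | U i (X w (t i.+1) - X w (t i))]).
Proof.
move=> t0 mU; rewrite /sigma_process /sigma_rv.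
set G := [set E | _].
(* Equipping the sample space with the generated sigma-algebra turns membership in [sigma_process X]
   into ordinary measurability. *)
pose S := g_sigma_algebraType G.
have mX s : 0 <= s -> measurable_fun setT (fun w : S => X w s).
  move=> s0 _ B mB; rewrite setTI; apply: sub_sigma_algebra.
  by exists s; split => //; exists B.
change (@measurable _ S (\bigcap_(i < n) [set w : S | U i (X w (t i.+1) - X w (t i))])).
apply: fin_bigcap_measurable => // i _.
have : measurable_fun setT (fun w : S => X w (t i.+1) - X w (t i)).
  by apply: measurable_funB; exact: mX.
by move=> /(_ measurableT _ (mU i)); rewrite setTI.
Qed.

Lemma process_increments_measurable (X : T -> D R) n (t : nat -> R) (U : nat -> set R) :
  process X -> (forall i, measurable (U i)) ->
  measurable (\bigcap_(i < n) [set w | U i (X w (t i.+1) - X w (t i))]).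
Proof.
move=> pX mU; apply: fin_bigcap_measurable => // i _.
have : measurable_fun setT (fun w => X w (t i.+1) - X w (t i)).
  by apply: measurable_funB; exact: pX.
by move=> /(_ measurableT _ (mU i)); rewrite setTI.
Qed.

Lemma poisson_increment_law (X : T -> D R) s t : poisson_process P 1 X ->
  0 <= s -> s < t -> nat_rv_law P (fun w => X w t - X w s) (poisson_pmf (t - s)).
Proof.
move=> [pX X0 Xnat Xmon _ Xlaw] s0 st; split.
- by apply: measurable_funB; exact: pX.
- move=> w; have [k kE] := Xnat w s s0.
  have [l lE] := Xnat w t (le_trans s0 (ltW st)).
  have : X w s <= X w t by apply: Xmon => //; exact: ltW.
  by rewrite kE lE ler_nat => kl; exists (l - k)%N; rewrite natrB.
- by move=> k; rewrite Xlaw// mul1r.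
Qed.

(** The Poisson process runs [a] times faster than the Brownian motion of [brownian_event]. Its
    increments have mean [a * Dl], the number that recentres the Brownian increments in [cell], so
    the same code [kk] serves both. *)
Definition poisson_event (X : T -> D R) (a Dl : R) n (kk : nat -> nat) : set T :=
  \bigcap_(i < n) [set w | X w (a * (i.+1%:R * Dl)) - X w (a * (i%:R * Dl)) = (kk i)%:R].

Definition brownian_event (X : T -> D R) (a Dl : R) n (kk : nat -> nat) : set T :=
  \bigcap_(i < n) [set w | cell (Num.sqrt a) (a * Dl) (kk i)
                             (X w (i.+1%:R * Dl) - X w (i%:R * Dl))].

Lemma poisson_event_measurable X a Dl n kk : process X ->
  measurable (poisson_event X a Dl n kk).
Proof.
move=> pX; exact: (@process_increments_measurable X n
  (fun i => a * (i%:R * Dl)) (fun i => [set (kk i)%:R])).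
Qed.

Lemma brownian_event_measurable X a Dl n kk : 0 < a -> process X ->
  measurable (brownian_event X a Dl n kk).
Proof.
move=> a0 pX; apply: (@process_increments_measurable X n
  (fun i => i%:R * Dl) (fun i => cell (Num.sqrt a) (a * Dl) (kk i))) => //.
by move=> i; apply: measurable_cell; rewrite sqrtr_gt0.
Qed.

Lemma sigma_process_poisson_event X a Dl n kk : 0 < a -> 0 < Dl ->
  sigma_process X (poisson_event X a Dl n kk).
Proof.
move=> a0 D0; apply: (@sigma_process_increments X n
  (fun i => a * (i%:R * Dl)) (fun i => [set (kk i)%:R])) => // i.
by rewrite !mulr_ge0// ltW.
Qed.

Lemma sigma_process_brownian_event X a Dl n kk : 0 < a -> 0 < Dl ->
  sigma_process X (brownian_event X a Dl n kk).
Proof.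
move=> a0 D0; apply: (@sigma_process_increments X n
  (fun i => i%:R * Dl) (fun i => cell (Num.sqrt a) (a * Dl) (kk i))) => i.
  by rewrite mulr_ge0// ltW.
by apply: measurable_cell; rewrite sqrtr_gt0.
Qed.

Lemma poisson_eventE X a Dl n kk : poisson_process P 1 X -> 0 < a -> 0 < Dl ->
  fine (P (poisson_event X a Dl n kk)) = \prod_(i < n) poisson_pmf (a * Dl) (kk i).
Proof.
move=> pX a0 D0.
have [_ _ _ _ ind law] := pX.
rewrite /poisson_event (ind n (fun i => a * (i%:R * Dl)) (fun i => [set (kk i)%:R])).
- apply: eq_bigr => i _; rewrite law.
  + rewrite /= mul1r -natr1; congr (poisson_pmf _ _); ring.
  + by rewrite !mulr_ge0// ltW.
  + by rewrite ltr_pM2l// ltr_pM2r// ltr_nat.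
- by rewrite mul0r mulr0.
- by move=> i; rewrite ler_pM2l// ler_pM2r// ler_nat.
- by [].
Qed.

Lemma brownian_eventE X a Dl n kk : brownian_motion P X -> 0 < a -> 0 < Dl ->
  fine (P (brownian_event X a Dl n kk)) = \prod_(i < n) cell_mass a Dl (kk i).
Proof.
move=> pX a0 D0.
have [_ _ _ ind law] := pX.
rewrite /brownian_event (ind n (fun i => i%:R * Dl)
  (fun i => cell (Num.sqrt a) (a * Dl) (kk i))).
- apply: eq_bigr => i _; rewrite law.
  + by have -> : i.+1%:R * Dl - i%:R * Dl = Dl by rewrite -natr1; ring.
  + by rewrite mulr_ge0// ltW.
  + by rewrite ltr_pM2r// ltr_nat.
  + by apply: measurable_cell; rewrite sqrtr_gt0.
- by rewrite mul0r.
- by move=> i; rewrite ler_pM2r// ler_nat.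
- by move=> i; apply: measurable_cell; rewrite sqrtr_gt0.
Qed.

End increments.

Section pair_lower.
Context (R : realType).
Context d (T : measurableType d) (P : probability T R).
Context d' (T' : measurableType d') (P' : probability T' R).

Definition local_factor (K r : R) : R :=
  expR (- local_error K r) * (1 - 2 * expR (2 - K)).

(** Independence of increments makes both probabilities products, so the local factor is lost once
    per increment. *)
Lemma event_lower (X : T -> D R) (B : T' -> D R) (a Dl r K : R) n kk :
  poisson_process P 1 X -> brownian_motion P' B ->
  0 < a -> 0 < Dl -> a * Dl = r * r -> 1 <= K -> 2 * K <= r ->
  0 <= local_factor K r ->
  (forall i, (i < n)%N -> `|(kk i)%:R - r * r| <= K * r) ->
  local_factor K r ^+ n * fine (P' (brownian_event B a Dl n kk)) <=
  fine (P (poisson_event X a Dl n kk)).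
Proof.
move=> pX pB a0 D0 aD K1 rK f0 kkK.
rewrite (poisson_eventE _ _ pX)// (brownian_eventE _ _ pB)// aD.
have r0 : 0 < r by lra.
have law : nat_rv_law P (fun w => X w (r * r) - X w 0) (poisson_pmf (r * r)).
  have := @poisson_increment_law _ _ _ _ _ 0 (r * r) pX.
  by rewrite subr0; apply => //; exact: mulr_gt0.
have step i : (i < n)%N -> local_factor K r * cell_mass a Dl (kk i) <=
    poisson_pmf (r * r) (kk i).
  by move=> /kkK; exact: (local_lower law).
rewrite -[X in _ ^+ X]card_ord -prodr_const -big_split/=.
apply: ler_prod => i _; rewrite step//= mulr_ge0//; exact: cell_mass_ge0.
Qed.

Lemma pair_event_lower (X Y : T -> D R) (B C : T' -> D R) (a Dl r K : R) n kk ll :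
  poisson_process P 1 X -> poisson_process P 1 Y ->
  independent_sigma P (sigma_process X) (sigma_process Y) ->
  brownian_motion P' B -> brownian_motion P' C ->
  independent_sigma P' (sigma_process B) (sigma_process C) ->
  0 < a -> 0 < Dl -> a * Dl = r * r -> 1 <= K -> 2 * K <= r ->
  0 <= local_factor K r ->
  (forall i, (i < n)%N -> `|(kk i)%:R - r * r| <= K * r) ->
  (forall i, (i < n)%N -> `|(ll i)%:R - r * r| <= K * r) ->
  local_factor K r ^+ (n + n) *
    fine (P' (brownian_event B a Dl n kk `&` brownian_event C a Dl n ll)) <=
  fine (P (poisson_event X a Dl n kk `&` poisson_event Y a Dl n ll)).
Proof.
move=> pX pY XY pB pC BC a0 D0 aD K1 rK f0 kkK llK.
rewrite XY ?BC; try exact: sigma_process_poisson_event;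
  try exact: sigma_process_brownian_event.
have mX : process X by case: pX.
have mY : process Y by case: pY.
have mB : process B by case: pB.
have mC : process C by case: pC.
rewrite !fineM ?fin_num_measure//; do ?[exact: poisson_event_measurable|
  exact: brownian_event_measurable].
rewrite exprD mulrACA; apply: ler_pM.
- by rewrite mulr_ge0 ?exprn_ge0 ?fine_ge0.
- by rewrite mulr_ge0 ?exprn_ge0 ?fine_ge0.
- exact: event_lower.
- exact: event_lower.
Qed.

End pair_lower.

(** * Oscillations of rescaled Poisson processes *)

Section chaining.
Context (R : realType).
Implicit Types (g : R -> R) (rho c t : R) (m L Tn i l : nat).

Definition dyadic l i : R := i%:R / 2 ^+ l.

Lemma dyadicS l i : dyadic l.+1 i.*2 = dyadic l i.
Proof. by rewrite /dyadic -muln2 natrM exprS; field; rewrite expf_neq0. Qed.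

Lemma dyadic_trunc l t : 0 <= t ->
  dyadic l (Num.truncn (2 ^+ l * t)) <= t < dyadic l (Num.truncn (2 ^+ l * t)).+1.
Proof.
move=> t0; rewrite /dyadic ler_pdivrMr ?exprn_gt0// ltr_pdivlMr ?exprn_gt0//.
by rewrite ![t * _]mulrC; apply: truncn_itv; rewrite mulr_ge0// exprn_ge0.
Qed.

Lemma truncn_dyadic_div m j t : 0 <= t ->
  Num.truncn (2 ^+ m * t) = (Num.truncn (2 ^+ (m + j) * t) %/ 2 ^ j)%N.
Proof.
move=> t0; apply: truncn_def.
have p0 l : 0 < 2 ^+ l :> R by rewrite exprn_gt0.
have /truncn_itv : 0 <= 2 ^+ (m + j) * t by rewrite mulr_ge0// exprn_ge0.
set i := Num.truncn _ => /andP[h1 h2].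
have h3 : 2 ^+ (m + j) * t = (2 ^+ m * t) * 2 ^+ j by rewrite exprD; ring.
have := divn_eq i (2 ^ j); have := ltn_pmod i (_ : 0 < 2 ^ j)%N.
rewrite expn_gt0 => /(_ isT); set q := (i %/ _)%N; set s := (i %% _)%N => s2 iE.
rewrite -(ler_pM2r (p0 j)) -(ltr_pM2r (p0 j)) -h3.
rewrite -natrX -!natrM; apply/andP; split.
  by apply: le_trans h1; rewrite ler_nat iE leq_addr.
apply: (lt_le_trans h2); rewrite ler_nat iE mulSn addnC.
by rewrite ltn_add2r.
Qed.

(* Every dyadic point of level [L] is reached from its level-[m] truncation by
   adding at most one increment of each level in between. *)
Lemma chaining_grid g rho m j Tn :
  0 < rho < 1 ->
  (forall l i, (m < l <= m + j)%N -> (i.+1 <= Tn * 2 ^ l)%N ->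
    `|g (dyadic l i.+1) - g (dyadic l i)| <= rho ^+ l) ->
  forall i, (i <= Tn * 2 ^ (m + j))%N ->
    `|g (dyadic (m + j) i) - g (dyadic m (i %/ 2 ^ j))| <=
    rho / (1 - rho) * (rho ^+ m - rho ^+ (m + j)).
Proof.
move=> /andP[rho0 rho1]; elim: j => [_|j IH H] i iT.
  by rewrite addn0 divn1 !subrr normr0 mulr0.
pose h := i./2.
have hT : (h <= Tn * 2 ^ (m + j))%N.
  by rewrite /h leq_half_double -muln2 -mulnA -expnSr -addnS; exact: leqW.
have -> : (i %/ 2 ^ j.+1 = h %/ 2 ^ j)%N.
  by rewrite expnS divnMA divn2.
have IHh : `|g (dyadic (m + j) h) - g (dyadic m (h %/ 2 ^ j))| <=
    rho / (1 - rho) * (rho ^+ m - rho ^+ (m + j)).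
  apply: IH => // l i' /andP[ml lj]; apply: H.
  by rewrite ml addnS ltnW.
have step : `|g (dyadic (m + j.+1) i) - g (dyadic (m + j) h)| <= rho ^+ (m + j.+1).
  have iE : i = (odd i + h.*2)%N by rewrite odd_double_half.
  rewrite -(dyadicS (m + j) h) -addnS {1}iE.
  case: (boolP (odd i)) => [oi|ei]; last first.
    by rewrite add0n subrr normr0 exprn_ge0// ltW.
  rewrite add1n; apply: H; first by rewrite addnS ltnS leq_addr leqnn.
  by move: iT; rewrite {1}iE oi add1n.
rewrite -(subrKA (g (dyadic (m + j) h))).
apply: (le_trans (ler_normD _ _)); apply: (le_trans (lerD step IHh)).
rewrite addnS exprS le_eqVlt; apply/orP; left; apply/eqP.
by field; rewrite subr_eq0 gt_eqF.
Qed.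

(* Between consecutive points of the finest grid, [g] is controlled from above
   and from below by its slope being bounded below by [- c]. *)
Lemma chaining g rho c m j Tn : 0 < rho < 1 -> 0 <= c ->
  (forall s t, 0 <= s -> s <= t -> g s - g t <= c * (t - s)) ->
  (forall l i, (m <= l <= m + j)%N -> (i.+1 <= Tn * 2 ^ l)%N ->
    `|g (dyadic l i.+1) - g (dyadic l i)| <= rho ^+ l) ->
  forall t, 0 <= t < Tn%:R ->
    `|g t - g (dyadic m (Num.truncn (2 ^+ m * t)))| <=
    rho / (1 - rho) * rho ^+ m + rho ^+ m + c / 2 ^+ (m + j).
Proof.
move=> rho01 c0 gc H t /andP[t0 tT]; have /andP[rho0 rho1] := rho01.
set L := (m + j)%N in H *.
set i := Num.truncn (2 ^+ L * t).
have /andP[it ti] := dyadic_trunc L t0; rewrite -/i in it ti.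
have iT : (i < Tn * 2 ^ L)%N.
  rewrite /i truncn_lt_nat ?mulr_ge0 ?exprn_ge0//.
  by rewrite natrM natrX mulrC ltr_pM2r// exprn_gt0.
rewrite (truncn_dyadic_div m j t0) -/L -/i.
have G : `|g (dyadic L i) - g (dyadic m (i %/ 2 ^ j))| <=
    rho / (1 - rho) * (rho ^+ m - rho ^+ L).
  apply: chaining_grid (ltnW iT) => // l i' /andP[ml lj]; apply: H.
  by rewrite (ltnW ml).
have LL : (m <= L <= L)%N by rewrite leq_addr leqnn.
have I := H L i LL iT.
have d0 : 0 <= dyadic L i by rewrite /dyadic divr_ge0// exprn_ge0.
have dd : dyadic L i.+1 = dyadic L i + (2 ^+ L)^-1.
  by rewrite /dyadic -natr1 mulrDl mul1r.
have g1 := gc _ _ d0 it.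
have g2 := gc _ _ t0 (ltW ti).
have c1 : c * (t - dyadic L i) <= c / 2 ^+ L by rewrite ler_wpM2l//; lra.
have c2 : c * (dyadic L i.+1 - t) <= c / 2 ^+ L by rewrite ler_wpM2l//; lra.
have rL : rho ^+ L <= rho ^+ m.
  by rewrite ler_wiXn2l ?(ltW rho0) ?(ltW rho1)// leq_addr.
have r0 : 0 <= rho / (1 - rho) * rho ^+ L.
  by rewrite mulr_ge0 ?exprn_ge0 ?divr_ge0//; lra.
move: G; rewrite mulrBr => G.
have cL : 0 <= c / 2 ^+ L by rewrite divr_ge0// exprn_ge0.
move: G I; rewrite !ler_norml => /andP[G1 G2] /andP[I1 I2].
by apply/andP; split; lra.
Qed.

End chaining.

(** * Uniform oscillation bounds from dyadic chaining *)

Section oscillation.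
Context (R : realType) d (T : measurableType d) (P : probability T R).

Definition scaled (X : R -> R) (a t : R) : R := (X (a * t) - a * t) / Num.sqrt a.

(* An increment of level [l] has standard deviation [2^(- l / 2)] and exceeds
   [chain_ratio ^+ l] with probability of order [(5 / 4)^(- 4 l)].  As
   [2 < (5 / 4)^4] and [(5 / 4)^2 < 2], the union bound over the [2^l]
   increments and the chain of increments are both geometrically small. *)
Definition chain_ratio : R := 5 / 4 / Num.sqrt 2.

Lemma chain_ratio01 : 0 < chain_ratio < 1.
Proof.
have s2 : 0 < Num.sqrt 2 :> R by rewrite sqrtr_gt0.
rewrite /chain_ratio divr_gt0//= ltr_pdivrMr// mul1r.
rewrite -[ltLHS]gtr0_norm// -sqrtr_sqr ltr_sqrt//; lra.
Qed.

(** Measured in standard deviations [sqrt (a / 2^l)] of a Poisson increment of level [l], the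
    chaining threshold is [(5 / 4)^l]. *)
Lemma chain_ratioX a l : 0 < a ->
  chain_ratio ^+ l * Num.sqrt a = (5 / 4) ^+ l * Num.sqrt (a / 2 ^+ l).
Proof.
move=> a0; have s2 : 0 < Num.sqrt 2 :> R by rewrite sqrtr_gt0.
have -> : Num.sqrt (a / 2 ^+ l) = Num.sqrt a / Num.sqrt 2 ^+ l.
  have -> : 2 ^+ l = (Num.sqrt 2 ^+ l) ^+ 2 :> R.
    by rewrite -exprM mulnC exprM sqr_sqrtr.
  by rewrite -exprVn sqrtrM ?(ltW a0)// sqrtr_sqr ger0_norm.
by rewrite /chain_ratio expr_div_n; ring.
Qed.

(** Jumps only go up, so the scaled process decreases no faster than its compensator, of slope
    [a / sqrt a]. *)
Lemma scaled_slope (X : T -> D R) w a s t : poisson_process P 1 X -> 0 < a ->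
  0 <= s -> s <= t ->
  scaled (X w) a s - scaled (X w) a t <= Num.sqrt a * (t - s).
Proof.
move=> pX a0 s0 st; have sa : 0 < Num.sqrt a by rewrite sqrtr_gt0.
have aE : a = Num.sqrt a * Num.sqrt a by rewrite -expr2 sqr_sqrtr// ltW.
have mono : X w (a * s) <= X w (a * t).
  by apply: (poisson_nondecreasing pX); rewrite ?mulr_ge0 ?ler_pM2l// ltW.
rewrite /scaled -mulrBl ler_pdivrMr//.
have -> : Num.sqrt a * (t - s) * Num.sqrt a = a * t - a * s.
  by rewrite mulrAC -aE; ring.
lra.
Qed.

(** The mean [a / 2^l] is at least 4, as [poisson_tail] demands. At [x = (5 / 4)^l] the tail
    $2e^{2-x}$ becomes geometric in [l] through $e^{-x}\le 4!/x^4$; hence the constant $48=2\cdot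
    24$. *)
Lemma increment_tail (X : T -> D R) a l i : poisson_process P 1 X -> 0 < a ->
  4 * 2 ^+ l <= a ->
  (P [set w | (chain_ratio ^+ l <
       `|scaled (X w) a (dyadic R l i.+1) - scaled (X w) a (dyadic R l i)|)%R]
     <= (48 * expR 2 / ((5 / 4) ^+ 4) ^+ l)%:E)%E.
Proof.
move=> pX a0 al.
have sa : 0 < Num.sqrt a by rewrite sqrtr_gt0.
have p2 : 0 < 2 ^+ l :> R by rewrite exprn_gt0.
pose lam := a / 2 ^+ l.
have lam4 : 4 <= lam by rewrite /lam ler_pdivlMr.
have dd : a * dyadic R l i.+1 - a * dyadic R l i = lam.
  by rewrite /dyadic -natr1 /lam; ring.
have d0 : 0 <= a * dyadic R l i by rewrite mulr_ge0 ?(ltW a0)// divr_ge0// ltW.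
have law := @poisson_increment_law R d T P X (a * dyadic R l i) (a * dyadic R l i.+1) pX d0.
rewrite -subr_gt0 dd in law; have {}law := law (lt_le_trans (ltr0n _ 4) lam4).
have tail := poisson_tail ((5 / 4) ^+ l) lam4 law.
have mN : measurable_fun setT (fun w => X w (a * dyadic R l i.+1) - X w (a * dyadic R l i)).
  by case: law.
have mS s : measurable_fun setT (fun w => scaled (X w) a s).
  apply: measurable_funM => //; apply: measurable_funB => //.
  exact: (poisson_meas pX).
apply: le_trans (le_trans _ tail) _.
  apply: le_measure; rewrite ?inE.
  - rewrite (_ : [set w | _] = (fun w => `|scaled (X w) a (dyadic R l i.+1) -
      scaled (X w) a (dyadic R l i)|) @^-1` `]chain_ratio ^+ l, +oo[); last first.
      by apply/seteqP; split=> y /=; rewrite in_itv/= andbT.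
    rewrite -[X in measurable X]setTI; apply: measurableT_comp => //.
    exact: measurable_funB.
  - rewrite (_ : [set w | _] = (fun w => `|X w (a * dyadic R l i.+1) -
      X w (a * dyadic R l i) - lam|) @^-1` `[(5 / 4) ^+ l * Num.sqrt lam, +oo[); last first.
      by apply/seteqP; split=> y /=; rewrite in_itv/= andbT.
    rewrite -[X in measurable X]setTI; apply: measurableT_comp => //.
    exact: measurable_funB.
  - move=> w /=; rewrite -chain_ratioX// /scaled -mulrBl normrM.
    rewrite [`|_^-1|]gtr0_norm ?invr_gt0// ltr_pdivlMr// => /ltW/le_trans; apply.
    by rewrite -dd le_eqVlt; apply/orP; left; apply/eqP; congr `|_|; ring.
set x : R := (5 / 4) ^+ l.
have x0 : 0 < x by rewrite exprn_gt0//; lra.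
rewrite lee_fin expRD -exprM mulnC exprM -/x.
have := @expR_ge1Dxn R x 3 (ltW x0); rewrite (_ : 4`! = 24)//= => h.
have e24 : expR (- x) <= 24 / x ^+ 4.
  rewrite expRN -[24 / _]invrK lef_pV2 ?posrE ?expR_gt0//.
    by rewrite invfM invrK mulrC; lra.
  by rewrite invr_gt0 divr_gt0// exprn_gt0.
have -> : 48 * expR 2 / x ^+ 4 = 2 * (expR 2 * (24 / x ^+ 4)) by ring.
by rewrite ler_pM2l// ler_pM2l ?expR_gt0.
Qed.

Lemma prob_bigsetU_le n (F : nat -> set T) (c : nat -> R) :
  (forall i, measurable (F i)) -> (forall i, (i < n)%N -> (P (F i) <= (c i)%:E)%E) ->
  (P (\big[setU/set0]_(i < n) F i) <= (\sum_(i < n) c i)%:E)%E.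
Proof.
move=> mF; elim: n => [|n IH] H; first by rewrite !big_ord0 measure0.
rewrite !big_ord_recr/= EFinD; apply: (le_trans (measureU2 _ _ _)) => //.
  exact: bigsetU_measurable.
by apply: leeD; [apply: IH => i /ltnW/H|exact: H].
Qed.

Lemma geometric_small (c q e : R) : 0 <= q < 1 -> 0 < e ->
  exists m0, forall m, (m0 <= m)%N -> c * q ^+ m <= e.
Proof.
move=> /andP[q0 q1] e0.
have : c * q ^+ m @[m --> \oo] --> c * 0.
  by apply: cvgMl_tmp; apply: cvg_expr; rewrite ger0_norm.
rewrite mulr0 => /cvgrPdist_le /(_ _ e0)[m0 _ H]; exists m0 => m /H /=.
by rewrite sub0r normrN => /(le_trans (ler_norm _)).
Qed.

Lemma geometric_sum_le (q : R) m n : 0 <= q < 1 ->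
  \sum_(k < n) q ^+ (m + k) <= q ^+ m / (1 - q).
Proof.
move=> /andP[q0 q1]; have q1' : 0 < 1 - q by rewrite subr_gt0.
rewrite ler_pdivlMr//; under eq_bigr do rewrite exprD.
rewrite -mulr_sumr -mulrA ler_piMr ?exprn_ge0//.
elim: n => [|n IH]; first by rewrite big_ord0 mul0r.
have -> : (\sum_(k < n.+1) q ^+ k) * (1 - q) = 1 - q ^+ n.+1.
  elim: n {IH} => [|n IH]; first by rewrite big_ord_recr big_ord0/= expr0 add0r mul1r expr1.
  by rewrite big_ord_recr/= mulrDl IH [q ^+ n.+2]exprS; ring.
by rewrite gerBl exprn_ge0.
Qed.

(** Selects the finest level of the chain, where increments have mean between 4 and 8. The lower
    bound keeps [poisson_tail] available; the upper one reduces the slope term [sqrt a / 2^(m + j)]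
    to at most [8 / sqrt a]. *)
Lemma dyadic_scale (a : R) m : 4 * 2 ^+ m <= a ->
  exists j, 4 * 2 ^+ (m + j) <= a < 8 * 2 ^+ (m + j).
Proof.
move=> ma; have p2 : 0 < 2 ^+ m :> R by rewrite exprn_gt0.
pose x := a / 4 / 2 ^+ m.
have x1 : 1 <= x by rewrite /x ler_pdivlMr// ler_pdivlMr//; lra.
have aE : a = 4 * (x * 2 ^+ m) by rewrite /x divfK ?gt_eqF//; lra.
have /andP[n1 n2] := truncn_itv (le_trans ler01 x1).
set n := Num.truncn x in n1 n2.
have n0 : (0 < n)%N by rewrite truncn_gt0.
exists (trunc_log 2 n).
have /andP[l1 l2] := trunc_log_bounds (isT : 1 < 2)%N n0.
rewrite exprD aE; set l := trunc_log 2 n in l1 l2 *.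
have h1 : 2 ^+ l <= x by apply: le_trans n1; rewrite -natrX ler_nat.
have h2 : x < 2 * 2 ^+ l.
  by apply: (lt_le_trans n2); rewrite -exprS -natrX ler_nat.
have h1' : 2 ^+ m * 2 ^+ l <= 2 ^+ m * x by rewrite ler_pM2l.
have h2' : 2 ^+ m * x < 2 ^+ m * (2 * 2 ^+ l) by rewrite ltr_pM2l.
by apply/andP; split; lra.
Qed.

(** The threshold [m0] does not depend on [a], and one exceptional event serves all times, so that
    random times may be inserted later. The second conclusion, on neighbouring grid points, absorbs
    the displacement of such a time. *)
Lemma oscillation (X : T -> D R) Tn (del eta : R) : poisson_process P 1 X ->
  0 < del -> 0 < eta ->
  exists m0, forall m, (m0 <= m)%N -> exists a0, forall a, a0 <= a ->
  exists Bd, [/\ measurable Bd, (P Bd <= eta%:E)%E & forall w, ~ Bd w ->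
    (forall t, 0 <= t < Tn%:R -> `|scaled (X w) a t -
       scaled (X w) a (dyadic R m (Num.truncn (2 ^+ m * t)))| <= del) /\
    (forall i, (i < Tn * 2 ^ m)%N -> `|scaled (X w) a (dyadic R m i.+1) -
       scaled (X w) a (dyadic R m i)| <= del)].
Proof.
move=> pX del0 eta0; have rho01 := chain_ratio01; set rho := chain_ratio in rho01.
have /andP[rho0 rho1] := rho01.
pose C : R := 48 * expR 2 * Tn%:R.
pose q : R := 2 / (5 / 4) ^+ 4.
have q01 : 0 <= q < 1 by rewrite /q divr_ge0 ?exprn_ge0//=; lra.
have C0 : 0 <= C by rewrite !mulr_ge0// expR_ge0.
have [m1 M1] := geometric_small (C / (1 - q)) q01 eta0.
have rho01' : 0 <= rho < 1 by rewrite ltW.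
have del2 : 0 < del / 2 by rewrite divr_gt0.
have [m2 M2] := geometric_small (rho / (1 - rho) + 1) rho01' del2.
exists (maxn m1 m2) => m; rewrite geq_max => /andP[/M1 mC /M2 mrho].
(* The first term allows chaining from level [m]; the second gives [8 / sqrt a <= del / 2]. *)
exists (4 * 2 ^+ m + (16 / del) ^+ 2) => a aa.
have d16 : 0 < 16 / del by rewrite divr_gt0.
have am : 4 * 2 ^+ m <= a.
  by apply: le_trans aa; rewrite lerDl sqr_ge0.
have a0 : 0 < a by apply: lt_le_trans am; rewrite mulr_gt0// exprn_gt0.
have sa : 0 < Num.sqrt a by rewrite sqrtr_gt0.
have sad : 16 / del <= Num.sqrt a.
  rewrite -[leLHS]gtr0_norm// -sqrtr_sqr ler_sqrt// ?sqr_ge0 ?(ltW a0)//.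
  by apply: le_trans aa; rewrite lerDr mulr_ge0// exprn_ge0.
have [j /andP[j1 j2]] := dyadic_scale am.
have pL : 0 < 2 ^+ (m + j) :> R by rewrite exprn_gt0.
have slack : Num.sqrt a / 2 ^+ (m + j) <= del / 2.
  rewrite ler_pdivrMr//; apply: (@le_trans _ _ (a / (16 / del))).
    by rewrite ler_pdivlMr// -[X in _ <= X](@sqr_sqrtr _ a) ?(ltW a0)// expr2 ler_pM2l.
  rewrite invfM invrK mulrC; have : del * a <= del * (8 * 2 ^+ (m + j)) by rewrite ler_pM2l// ltW.
  lra.
pose E l i := [set w | chain_ratio ^+ l < `|scaled (X w) a (dyadic R l i.+1) -
  scaled (X w) a (dyadic R l i)|].
have mS s : measurable_fun setT (fun w => scaled (X w) a s).
  apply: measurable_funM => //; apply: measurable_funB => //.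
  exact: (poisson_meas pX).
have mE l i : measurable (E l i).
  rewrite (_ : E l i = (fun w => `|scaled (X w) a (dyadic R l i.+1) -
    scaled (X w) a (dyadic R l i)|) @^-1` `]chain_ratio ^+ l, +oo[); last first.
    by apply/seteqP; split=> y /=; rewrite in_itv/= andbT.
  rewrite -[X in measurable X]setTI; apply: measurableT_comp => //.
  exact: measurable_funB.
pose F l := \big[setU/set0]_(i < Tn * 2 ^ l) E l i.
have mF l : measurable (F l) by apply: bigsetU_measurable => i _.
have PF l : (l <= m + j)%N -> (P (F l) <= (C * q ^+ l)%:E)%E.
  move=> lL; have la : 4 * 2 ^+ l <= a.
    by apply: le_trans j1; rewrite ler_pM2l// ler_eXn2l// ltr1n.
  apply: (le_trans (prob_bigsetU_le (mE l) (fun i _ => increment_tail i pX a0 la))).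
  rewrite lee_fin sumr_const card_ord -[X in X <= _]mulr_natr natrM natrX /q [(2 / _) ^+ l]expr_div_n.
  by rewrite le_eqVlt; apply/orP; left; apply/eqP; rewrite /C; ring.
exists (\big[setU/set0]_(k < j.+1) F (m + k)%N); split.
- exact: bigsetU_measurable.
- have PB := @prob_bigsetU_le j.+1 (fun k => F (m + k)%N)
    (fun k => C * q ^+ (m + k)) (fun k => mF _).
  apply: le_trans (PB _) _; first by move=> k kj; apply: PF; rewrite leq_add2l.
  rewrite lee_fin -mulr_sumr; apply: le_trans mC.
  by rewrite -mulrA [_^-1 * _]mulrC ler_wpM2l// geometric_sum_le.
- move=> w nB.
  have H l i : (m <= l <= m + j)%N -> (i.+1 <= Tn * 2 ^ l)%N ->
      `|scaled (X w) a (dyadic R l i.+1) - scaled (X w) a (dyadic R l i)| <= rho ^+ l.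
    move=> /andP[ml lj] iT; rewrite leNgt; apply/negP => Ew; apply: nB.
    have kj : (l - m < j.+1)%N by rewrite ltnS leq_subLR.
    rewrite (bigD1 (Ordinal kj))//=; left; rewrite subnKC//.
    by rewrite /F (bigD1 (Ordinal iT))//=; left.
  split.
    move=> t tT; apply: (le_trans (chaining rho01 (ltW sa) _ H tT)).
      by move=> s u s0 su; exact: (scaled_slope w pX a0 s0 su).
    by move: mrho slack; rewrite mulrDl mul1r; lra.
  move=> i iT; apply: (le_trans (H m i _ iT)); first by rewrite leqnn leq_addr.
  have : 0 <= rho / (1 - rho) * rho ^+ m.
    by rewrite mulr_ge0 ?exprn_ge0 ?divr_ge0 ?(ltW rho0)//; lra.
  by move: mrho; rewrite mulrDl mul1r; lra.
Qed.

End oscillation.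

(** * Paths and integrals of processes *)

Section cadlag_paths.
Context (R : realType).
Implicit Types (x y : R -> R) (t : R).

Lemma cadlagD x y : cadlag x -> cadlag y -> cadlag (fun t => x t + y t).
Proof.
move=> cx cy t t0; have [xr xl] := cx t t0; have [yr yl] := cy t t0; split.
  exact: cvgD.
by move=> t_gt0; apply: is_cvgD; [exact: xl|exact: yl].
Qed.

Lemma cadlag_ext x y : (forall t, 0 <= t -> x t = y t) -> cadlag x -> cadlag y.
Proof.
move=> xy cx t t0; have [xr xl] := cx t t0; split=> [|t_gt0].
  rewrite -(xy _ t0); apply: cvg_trans xr; apply: near_eq_cvg.
  near=> s; apply: xy; apply: (le_trans t0); apply: ltW.
  by near: s; exact: nbhs_right_gt.
have /cvg_ex[l xl'] := xl t_gt0; apply/cvg_ex; exists l.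
apply: cvg_trans xl'; apply: near_eq_cvg.
near=> s; apply: xy; apply: ltW.
by near: s; exact: nbhs_left_gt.
Unshelve. all: by end_near. Qed.

Lemma cadlag_time_scale x c : 0 < c -> cadlag x -> cadlag (fun t => x (c * t)).
Proof.
move=> c0 cx t t0; have [xr xl] := cx _ (mulr_ge0 (ltW c0) t0); split=> [|t_gt0].
  apply/cvgrPdist_lt => e e0.
  have [d /= d0 dP] := (cvgrPdist_lt _ _).1 xr _ e0.
  near=> s; apply: dP => /=.
    rewrite -mulrBr normrM gtr0_norm// mulrC -ltr_pdivlMr// distrC gtr0_norm.
      by near: s; apply: nbhs_right_ltDr; rewrite divr_gt0.
    by rewrite subr_gt0; near: s; exact: nbhs_right_gt.
  by rewrite ltr_pM2l//; near: s; exact: nbhs_right_gt.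
have /cvg_ex[l xl'] := xl (mulr_gt0 c0 t_gt0); apply/cvg_ex; exists l.
apply/cvgrPdist_lt => e e0.
have [d /= d0 dP] := (cvgrPdist_lt _ _).1 xl' _ e0.
near=> s; apply: dP => /=.
  rewrite -mulrBr normrM gtr0_norm// mulrC -ltr_pdivlMr// gtr0_norm.
    by near: s; apply: nbhs_left_ltBl; rewrite divr_gt0.
  by rewrite subr_gt0; near: s; exact: nbhs_left_lt.
by rewrite ltr_pM2l//; near: s; exact: nbhs_left_lt.
Unshelve. all: by end_near. Qed.

Lemma continuous_cadlag x : continuous x -> cadlag x.
Proof.
move=> cx t _; split; first by apply: cvg_at_right_filter; exact: cx.
by move=> _; apply/cvg_ex; exists (x t); apply: cvg_at_left_filter; exact: cx.
Qed.

Definition trunc_fun x t : R := if 0 <= t then x t else 0.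

Lemma cadlag_trunc_fun x : cadlag x -> cadlag (trunc_fun x).
Proof. by apply: cadlag_ext => t t0; rewrite /trunc_fun t0. Qed.

Lemma trunc_fun_neg x t : t < 0 -> trunc_fun x t = 0.
Proof. by rewrite /trunc_fun leNgt => ->. Qed.

Definition path_of x (cx : cadlag x) : D R := MkD (cadlag_trunc_fun cx) (@trunc_fun_neg x).

Lemma path_ofE x (cx : cadlag x) t : 0 <= t -> path_of cx t = x t.
Proof. by rewrite /= /trunc_fun => ->. Qed.

(** Tracking keeps the path within 1 of finitely many of its own samples; the sum of their moduli
    stands in for the maximum. *)
Lemma cadlag_bounded x t : cadlag x -> 0 <= t ->
  exists C, forall s, 0 <= s <= t -> `|x s| <= C.
Proof.
move=> cx t0; have t10 : 0 <= t + 1 by lra.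
have [M0 H] := cadlag_trackable cx ltr01 t10.
have [lam [tc _ lamid lamx]] := H M0.+1 (leqnSn _) isT.
pose b := (Num.truncn (M0.+1%:R * (t + 1))).+1.
exists (1 + \sum_(k < b) `|x (k%:R / M0.+1%:R)|) => s /andP[s0 st].
have ls0 : 0 <= lam s by case: tc => -[lf _ _] _; exact: lf.
have lst : lam s <= t + 1.
  have := lamid s s0; rewrite ler_norml => /andP[_].
  have : M0.+1%:R^-1 <= 1 :> R by rewrite invf_le1// ler1n.
  by set h := M0.+1%:R^-1; clearbody h; lra.
have := lamx s; rewrite s0 /= => /(_ _)/[!grid_floor_truncn]//; move=> /(_ ltac:(lra)).
set k := Num.truncn _ => xk.
have kb : (k < b)%N.
  by rewrite /b ltnS; apply: le_truncn; rewrite ler_pM2l// ltr0n.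
have xs : `|x (k%:R / M0.+1%:R)| <= \sum_(k < b) `|x (k%:R / M0.+1%:R)|.
  by rewrite (bigD1 (Ordinal kb))//= lerDl sumr_ge0.
rewrite -[x s](subrK (x (k%:R / M0.+1%:R))) (le_trans (ler_normD _ _))//.
by apply: lerD xs; rewrite distrC.
Qed.

End cadlag_paths.

(** * Joint measurability and time integrals *)

Section joint_measurability.
Context (R : realType) d (T : measurableType d).

(* Sampling just to the right of [s] makes right-continuity enough for
   convergence. *)
Lemma process_jointly_measurable (X : T -> D R) : process X ->
  measurable_fun [set: T * R] (fun p => X p.1 p.2).
Proof.
move=> pX.
pose h (M : nat) (p : T * R) : R := if 0 <= p.2 then
  X p.1 ((Num.truncn (M.+1%:R * p.2)).+1%:R / M.+1%:R) else 0.
apply: (@measurable_fun_cvg _ _ _ _ h).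
  move=> M _ B mB; rewrite setTI.
  pose I k : set R := `[k%:R / M.+1%:R, k.+1%:R / M.+1%:R[%classic.
  have -> : h M @^-1` B =
      \bigcup_k (((fun w => X w (k.+1%:R / M.+1%:R)) @^-1` B) `*` I k) `|`
      ([set: T] `*` (if `[< B 0 >] then `]-oo, 0[%classic else set0)).
    apply/seteqP; split=> [[w s]|[w s] [[k _] [/= Bk]|[_ /=]]]; rewrite /h /=.
    - have [s0 Bs|s0 B0] := leP 0 s; last first.
        by right; split=> //=; case: asboolP => //= _; rewrite in_itv.
      left; exists (Num.truncn (M.+1%:R * s)) => //; split=> //=.
      rewrite /I /= in_itv /= ler_pdivrMr ?ltr0n// ltr_pdivlMr ?ltr0n//.
      by rewrite ![s * _]mulrC; apply: truncn_itv; rewrite mulr_ge0.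
    - rewrite /I /= in_itv /= ler_pdivrMr ?ltr0n// ltr_pdivlMr ?ltr0n// => ks.
      have s0 : 0 <= s.
        move: ks => /andP[ks _]; rewrite -(pmulr_lge0 _ (_ : 0 < M.+1%:R))//.
        exact: le_trans ks.
      by rewrite s0 (@truncn_def _ _ k)// mulrC.
    - by case: asboolP => //= B0; rewrite in_itv /= ltNge => /negbTE ->.
  apply: measurableU.
    apply: bigcup_measurable => k _; apply: measurableX.
      by rewrite -[X in measurable X]setTI; exact: pX.
    exact: measurable_itv.
  by apply: measurableX => //; case: asboolP => _.
move=> [w s] _; rewrite /h /=; have [s0|s0] := leP 0 s; last first.
  by rewrite path_neg//; exact: cvg_cst.
have [xr _] := @path_cadlag _ (X w) s s0.
apply/cvgrPdist_lt => e e0.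
have [dl /= dl0 dP] := (cvgrPdist_lt _ _).1 xr _ e0.
near=> M.
have M0 : 0 < M.+1%:R :> R by rewrite ltr0n.
have /truncn_itv : 0 <= M.+1%:R * s by rewrite mulr_ge0.
set k := Num.truncn _ => /andP[k1 k2].
have Md : M.+1%:R^-1 < dl by near: M; exact: near_infty_natSinv_lt (PosNum dl0).
have u1 : s < k.+1%:R / M.+1%:R by rewrite ltr_pdivlMr// mulrC.
have u2 : k.+1%:R / M.+1%:R <= s + M.+1%:R^-1.
  rewrite -natr1 mulrDl mul1r lerD2r ler_pdivrMr// mulrC//.
apply: dP => //=; rewrite distrC gtr0_norm ?subr_gt0// ltrBlDl.
by apply: (le_lt_trans u2); rewrite ltrD2l.
Unshelve. all: by end_near. Qed.

Lemma path_measurable (X : T -> D R) w : process X -> measurable_fun setT (X w).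
Proof.
move=> pX; exact: (measurableT_comp (process_jointly_measurable pX) (pair1_measurable w)).
Qed.

Definition time_integral (x : R -> R) (t : R) : R :=
  \int[lebesgue_measure]_(s in `[0, t]) x s.

(** Tonelli is applied to the positive and negative parts separately, since no integrability in [w]
    is available. *)
Lemma time_integral_measurable (X : T -> D R) t : process X ->
  measurable_fun setT (fun w => time_integral (X w) t).
Proof.
move=> pX; rewrite /time_integral /Rintegral.
apply: (measurableT_comp (f := fine)) => //.
pose f (p : T * R) : \bar R := (if p.2 \in `[0, t] then X p.1 p.2 else 0)%:E.
have mf : measurable_fun setT f.
  apply/measurable_EFinP; apply: measurable_fun_ifT => //.
    apply: (measurableT_comp (f := fun s : R => s \in `[0, t])) => //.
    apply: (@measurable_fun_bool _ _ _ _ true).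
    rewrite setTI (_ : _ @^-1` _ = `[0, t]%classic)//.
  exact: process_jointly_measurable.
have -> : (fun w => \int[lebesgue_measure]_(s in `[0%R, t]) (X w s)%:E)%E =
    (fun w => \int[lebesgue_measure]_s (f^\+)%E (w, s) -
              \int[lebesgue_measure]_s (f^\-)%E (w, s))%E.
  apply/funext => w; transitivity (\int[lebesgue_measure]_s f (w, s))%E; last first.
    by rewrite [LHS]integralE; congr (_ - _)%E; apply: eq_integral => s _; rewrite !unlock.
  rewrite integral_mkcond; apply: eq_integral => s _; rewrite patchE /f /=.
  by rewrite mem_setE; case: (s \in `[0, t]).
apply: emeasurable_funB.
  apply: (@measurable_fun_fubini_tonelli_F _ _ _ _ _ lebesgue_measure (f^\+)%E) => //.
  exact: measurable_funepos.
apply: (@measurable_fun_fubini_tonelli_F _ _ _ _ _ lebesgue_measure (f^\-)%E) => //.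
exact: measurable_funeneg.
Qed.

Lemma path_integrable (X : T -> D R) w t : process X -> 0 <= t ->
  lebesgue_measure.-integrable `[0, t] (EFin \o X w).
Proof.
move=> pX t0; apply: measurable_bounded_integrable => //.
- by rewrite /= lebesgue_measure_itv /=; case: ifP => _; rewrite ?ltry// -EFinB ltry.
- by apply: measurable_funTS; exact: path_measurable.
- have [C HC] := cadlag_bounded (@path_cadlag _ (X w)) t0.
  exists C; split; first by rewrite num_real.
  by move=> C' CC' s /=; rewrite in_itv /= => /HC/le_trans; apply; exact: ltW.
Qed.

Lemma cadlag_time_integral (X : T -> D R) w : process X ->
  cadlag (time_integral (X w)).
Proof.
move=> pX t t0; have t1 : 0 < t + 1 by lra.
have t10 : 0 <= t + 1 by lra.
have := parameterized_integral_continuous t10 (path_integrable w pX t10).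
rewrite -/(time_integral (X w)) => /(continuous_within_itvP _ t1)[cin c0 _].
have cont : 0 < t -> {for t, continuous (time_integral (X w))}.
  by move=> t_gt0; apply: cin; rewrite in_itv /= t_gt0; lra.
split.
  move: t0; rewrite le_eqVlt => /orP[/eqP <-//|/cont].
  exact: cvg_at_right_filter.
move=> /cont ct; apply/cvg_ex; exists (time_integral (X w) t).
exact: cvg_at_left_filter.
Qed.

Lemma time_integral_close (X : T -> D R) w (t e : R) n : process X -> (0 < n)%N ->
  0 <= t -> (forall s, 0 <= s <= t -> `|n%:R^-1 * X w s - 1| <= e) ->
  `|n%:R^-1 * time_integral (X w) t - t| <= e * t.
Proof.
move=> pX n0 t0 H; have n0' : 0 < n%:R :> R by rewrite ltr0n.
have vol : fine (lebesgue_measure (`[0, t] : set R)) = t.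
  rewrite lebesgue_measure_itv /= lte_fin; move: t0; rewrite le_eqVlt => /orP[/eqP <-|->].
    by rewrite ltxx.
  by rewrite sube0.
have icst (c : R) : lebesgue_measure.-integrable `[0, t] (EFin \o (fun _ : R => c)).
  apply: measurable_bounded_integrable => //.
    by rewrite /= lebesgue_measure_itv /=; case: ifP => _; rewrite ?ltry// -EFinB ltry.
  exists `|c|; split; first by rewrite num_real.
  by move=> C' CC' s _; exact: ltW.
have b s : s \in `[0, t] -> n%:R * (1 - e) <= X w s <= n%:R * (1 + e).
  rewrite in_itv /= => /H; rewrite ler_distl => /andP[h1 h2].
  by apply/andP; split; [rewrite -ler_pdivlMl|rewrite -ler_pdivrMl].
have up : time_integral (X w) t <= n%:R * (1 + e) * t.
  rewrite -[leRHS](_ : \int[lebesgue_measure]_(s in `[0, t]) (n%:R * (1 + e)) = _); last first.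
    by rewrite Rintegral_cst// vol.
  apply: le_Rintegral => //; first exact: path_integrable.
  by move=> s /b/andP[].
have lo : n%:R * (1 - e) * t <= time_integral (X w) t.
  rewrite -[leLHS](_ : \int[lebesgue_measure]_(s in `[0, t]) (n%:R * (1 - e)) = _); last first.
    by rewrite Rintegral_cst// vol.
  apply: le_Rintegral => //; first exact: path_integrable.
  by move=> s /b/andP[].
rewrite ler_distl; apply/andP; split.
  by rewrite ler_pdivlMl//; move: lo; lra.
by rewrite ler_pdivrMl//; move: up; lra.
Qed.

End joint_measurability.

(** * The fluid limit and the two martingales *)

Section weak_convergence.
Context (R : realType) d (T : measurableType d) (P : probability T R).

Lemma borel_comp_measurable (E : topologicalType) (X : T -> E) (f : E -> R) :
  borel_measurable X -> continuous f -> measurable_fun setT (f \o X).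
Proof.
move=> bX cf; apply: (measurability _ (RGenOpens.measurableE R)).
move=> _ [_ [a [b ->]] <-]; rewrite setTI comp_preimage.
apply: bX; apply: sub_sigma_algebra => /=.
by apply: open_comp => //; exact: interval_open.
Qed.

Lemma J1_close_nbhs (x : D R) (t e : R) : 0 < e -> nbhs x [set y | J1_close t e x y].
Proof.
move=> e0; rewrite -nbhs_entourageE.
exists [set xy | J1_close t e xy.1 xy.2]; first by exists (t, e).
by move=> y /= /xsectionP.
Qed.

(** A continuous function that is 0 at the constant path and 1 off a $J_1$ neighbourhood has
    expectation tending to 0, and Markov's inequality applies. The limit path being constant, a time
    change does not affect it, so $J_1$ closeness is already uniform closeness. *)
Lemma fluid_close (X : nat -> T -> D R) (t e eta : R) :
  cvg_in_law P P X (fun=> cstD 1) -> 0 < e -> 0 < eta ->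
  \forall n \near \oo, exists Bd, [/\ measurable Bd, (P Bd <= eta%:E)%E &
    forall w, ~ Bd w -> forall s, 0 <= s <= t -> `|X n w s - 1| <= e].
Proof.
(* The horizon [t + e] leaves room for the time change, whose preimage of [s <= t] may be as late as
   [t + e]. *)
move=> [mX _ cX] e0 eta0.
pose V := [set y | J1_close (t + e) e (cstD 1) y].
have nV : nbhs (cstD 1) V by exact: J1_close_nbhs.
have cB : closed (~` V°) by apply: open_closedC; exact: open_interior.
have naB : ~ (~` V°) (cstD 1) by move=> /(_ nV).
have [f [cf f01 fa fB]] :=
  (@uniform_separatorP _ R _ _).1 (@point_uniform_separator R _ _ _ cB naB).
have fb x : 0 <= f x <= 1.
  by have := f01 (f x) (ex_intro2 _ _ x I erefl); rewrite /= in_itv.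
have fa0 : f (cstD 1) = 0 by apply: fa; exists (cstD 1).
have := cX f cf (ex_intro _ 1 (fun x => _)).
have fn x : `|f x| <= 1 by have /andP[f0 f1] := fb x; rewrite ger0_norm.
move=> /(_ fn).
have -> : ('E_P[f \o (fun=> cstD 1)] = 0)%E.
  rewrite unlock; rewrite integral0_eq// => w _ /=; by rewrite fa0.
move=> /(_ [set x : \bar R | (x < eta%:E)%E]) Hnear.
have : \forall n \near \oo, ('E_P[f \o X n] < eta%:E)%E.
  apply: Hnear; apply: open_nbhs_nbhs; split; last by rewrite /= lte_fin.
  exact: open_ereal_lt_ereal.
apply: filter_app; near=> n => En.
have bX : borel_measurable (X n) by near: n.
have mf := borel_comp_measurable bX cf.
exists [set w | 1 <= f (X n w)].
have mB : measurable [set w | 1 <= f (X n w)].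
  rewrite (_ : [set w | _] = (f \o X n) @^-1` `[1, +oo[); last first.
    by apply/seteqP; split=> y /=; rewrite in_itv/= andbT.
  by rewrite -[X in measurable X]setTI; exact: mf.
split=> //.
  apply/ltW; apply: le_lt_trans En; rewrite unlock.
  rewrite -[leLHS]mul1e -(integral_cst P mB 1).
  have mfB (B : set T) : measurable B -> measurable_fun B (fun w => (f (X n w))%:E).
    by move=> mB'; apply/measurable_EFinP; exact: measurable_funTS.
  apply: (@le_trans _ _ (\int[P]_(w in [set w | (1 <= f (X n w))%R]) (f (X n w))%:E)%E).
    apply: ge0_le_integral => //=; first exact: mfB.
  apply: ge0_subset_integral => //=; first exact: mfB.
  by move=> w _; rewrite lee_fin; have /andP[] := fb (X n w).
move=> w nB s /andP[s0 st].
have : V (X n w).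
  apply: interior_subset; apply: contrapT => nV'; apply: nB => /=.
  by rewrite (fB (f (X n w)))//; exists (X n w).
move=> [lam [[[_ _ lsurj] lmono] lid lclose]].
have [u /= u0 us] := lsurj s s0.
have := lclose u; rewrite us /= /cst_fun u0; apply.
have := lid u u0; rewrite us ler_norml; lra.
Unshelve. all: by end_near. Qed.

End weak_convergence.

Section stay_close.
Context (R : realType).

(* A time shift of at most [2^-m] moves the level-[m] truncation by at most
   one grid point. *)
Lemma stay_close (g : R -> R) (m Tn : nat) (del t tau : R) :
  (forall s, 0 <= s < Tn%:R ->
    `|g s - g (dyadic R m (Num.truncn (2 ^+ m * s)))| <= del) ->
  (forall i, (i < Tn * 2 ^ m)%N ->
    `|g (dyadic R m i.+1) - g (dyadic R m i)| <= del) ->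
  0 <= t < Tn%:R -> 0 <= tau < Tn%:R -> `|tau - t| <= (2 ^+ m)^-1 ->
  `|g tau - g (dyadic R m (Num.truncn (2 ^+ m * t)))| <= 2 * del.
Proof.
move=> osc inc /andP[t0 tT] tauT tt; have /andP[tau0 tau1] := tauT.
have := osc _ tauT; have p2 : 0 < 2 ^+ m :> R by rewrite exprn_gt0.
have idx (s : R) : 0 <= s -> s < Tn%:R -> (Num.truncn (2 ^+ m * s) < Tn * 2 ^ m)%N.
  move=> s0 sT; rewrite truncn_lt_nat ?mulr_ge0 ?(ltW p2)//.
  by rewrite natrM natrX mulrC ltr_pM2r.
have i1 := idx _ t0 tT; have i2 := idx _ tau0 tau1.
have /truncn_itv : 0 <= 2 ^+ m * t by rewrite mulr_ge0// ltW.
have /truncn_itv : 0 <= 2 ^+ m * tau by rewrite mulr_ge0// ltW.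
move: i1 i2; set i := Num.truncn (2 ^+ m * t); set j := Num.truncn _.
move=> i1 i2 /andP[j1 j2] /andP[k1 k2] gj.
have d : `|2 ^+ m * tau - 2 ^+ m * t| <= 1.
  rewrite -mulrBr normrM gtr0_norm// -[leRHS](mulfV (lt0r_neq0 p2)).
  by rewrite ler_pM2l.
move: d; rewrite ler_norml => /andP[d1 d2].
have ij : (i <= j.+1)%N.
  by rewrite -ltnS -(ltr_nat R) -[j.+2%:R]natr1; lra.
have ji : (j <= i.+1)%N.
  by rewrite -ltnS -(ltr_nat R) -[i.+2%:R]natr1; lra.
have del0 : 0 <= del := le_trans (normr_ge0 _) gj.
rewrite -(subrKA (g (dyadic R m j))) mulr_natl mulr2n.
apply: (le_trans (ler_normD _ _)); apply: lerD => //.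
move: ij ji; rewrite leq_eqVlt => /orP[/eqP ij _|].
  by rewrite distrC ij; apply: inc.
rewrite ltnS leq_eqVlt => /orP[/eqP -> _|ij ji]; first by rewrite subrr normr0.
have -> : j = i.+1 by apply/eqP; rewrite eqn_leq ji.
exact: inc.
Qed.

End stay_close.

(** * The two martingales as rescaled Poisson processes *)

Section queue.
Context (R : realType) d (T : measurableType d) (P : probability T R).
Implicit Types (A S Q M : T -> D R) (mu : R) (n : nat).

Definition arrival_mart A mu n w (t : R) : R :=
  (A w (n%:R * mu * t) - n%:R * mu * t) / Num.sqrt n%:R.

Definition service_mart S Q mu n w (t : R) : R := (Num.sqrt n%:R)^-1 *
  (S w (mu * time_integral (Q w) t) - mu * time_integral (Q w) t).

Definition queue_equation A S Q mu n := forall w t, 0 <= t ->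
  Q w t = Q w 0 + A w (n%:R * mu * t) - S w (mu * time_integral (Q w) t).

(* Free of the random time change, hence evidently cadlag and measurable. *)
Lemma service_martE A S Q mu n w t : queue_equation A S Q mu n -> 0 <= t ->
  service_mart S Q mu n w t = (Num.sqrt n%:R)^-1 *
    (Q w 0 + A w (n%:R * mu * t) + -1 * Q w t + - mu * time_integral (Q w) t).
Proof. by move=> HQ t0; rewrite /service_mart [Q w t]HQ//; ring. Qed.

Lemma arrival_mart_path A mu n w : 0 < mu -> (0 < n)%N ->
  exists m : D R, forall t, 0 <= t -> m t = arrival_mart A mu n w t.
Proof.
move=> mu0 n0; have c0 : 0 < n%:R * mu by rewrite mulr_gt0// ltr0n.
have clin : cadlag (fun t : R => - (n%:R * mu) * t).
  by apply: continuous_cadlag => t; exact: mulrl_continuous.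
have cA := cadlag_time_scale c0 (@path_cadlag _ (A w)).
exists (path_of (cadlagZ (Num.sqrt n%:R)^-1 (cadlagD cA clin))) => t t0.
by rewrite path_ofE// /arrival_mart mulrC mulNr.
Qed.

Lemma service_mart_path A S Q mu n w : 0 < mu -> (0 < n)%N -> process Q ->
  queue_equation A S Q mu n ->
  exists m : D R, forall t, 0 <= t -> m t = service_mart S Q mu n w t.
Proof.
move=> mu0 n0 pQ HQ; have c0 : 0 < n%:R * mu by rewrite mulr_gt0// ltr0n.
have cA := cadlag_time_scale c0 (@path_cadlag _ (A w)).
have cc : cadlag (fun _ : R => Q w 0).
  by apply: continuous_cadlag => t; exact: cvg_cst.
have cQ := cadlagZ (-1) (@path_cadlag _ (Q w)).
have cI := cadlagZ (- mu) (cadlag_time_integral w pQ).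
exists (path_of (cadlagZ (Num.sqrt n%:R)^-1 (cadlagD (cadlagD (cadlagD cc cA) cQ) cI))).
by move=> t t0; rewrite path_ofE// (service_martE _ HQ).
Qed.

Lemma arrival_mart_process A M mu n : process A ->
  (forall w t, 0 <= t -> M w t = arrival_mart A mu n w t) -> process M.
Proof.
move=> pA ME t; have [t0|t0] := leP 0 t; last first.
  rewrite (_ : (fun w => M w t) = cst 0); last by apply/funext => w; rewrite path_neg.
  exact: measurable_cst.
rewrite (_ : (fun w => M w t) = arrival_mart A mu n ^~ t); last first.
  by apply/funext => w; rewrite ME.
by apply: measurable_funM => //; apply: measurable_funB.
Qed.

Lemma service_mart_process A S Q M mu n : process A -> process Q ->
  queue_equation A S Q mu n ->
  (forall w t, 0 <= t -> M w t = service_mart S Q mu n w t) -> process M.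
Proof.
move=> pA pQ HQ ME t; have [t0|t0] := leP 0 t; last first.
  rewrite (_ : (fun w => M w t) = cst 0); last by apply/funext => w; rewrite path_neg.
  exact: measurable_cst.
rewrite (_ : (fun w => M w t) = fun w => (Num.sqrt n%:R)^-1 *
    (Q w 0 + A w (n%:R * mu * t) + -1 * Q w t + - mu * time_integral (Q w) t)); last first.
  by apply/funext => w; rewrite ME// (service_martE _ HQ).
apply: measurable_funM => //; apply: measurable_funD.
  apply: measurable_funD; first by apply: measurable_funD.
  exact: measurable_funM.
by apply: measurable_funM => //; exact: time_integral_measurable.
Qed.

Lemma sqrt_scale (mu : R) n : 0 < mu -> (0 < n)%N ->
  Num.sqrt (n%:R * mu) = Num.sqrt n%:R * Num.sqrt mu.
Proof. by move=> mu0 n0; rewrite sqrtrM. Qed.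

Lemma arrival_mart_scaled A mu n w t : 0 < mu -> (0 < n)%N ->
  arrival_mart A mu n w t = Num.sqrt mu * scaled (A w) (n%:R * mu) t.
Proof.
move=> mu0 n0; rewrite /arrival_mart /scaled sqrt_scale//.
have sn : Num.sqrt n%:R != 0 :> R by rewrite gt_eqF// sqrtr_gt0 ltr0n.
have sm : Num.sqrt mu != 0 by rewrite gt_eqF// sqrtr_gt0.
by field; rewrite sn sm.
Qed.

Lemma service_mart_scaled S Q mu n w t : 0 < mu -> (0 < n)%N ->
  service_mart S Q mu n w t = Num.sqrt mu *
    scaled (S w) (n%:R * mu) (n%:R^-1 * time_integral (Q w) t).
Proof.
move=> mu0 n0; rewrite /service_mart /scaled sqrt_scale//.
have sn : Num.sqrt n%:R != 0 :> R by rewrite gt_eqF// sqrtr_gt0 ltr0n.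
have sm : Num.sqrt mu != 0 by rewrite gt_eqF// sqrtr_gt0.
have n0' : n%:R != 0 :> R by rewrite pnatr_eq0 -lt0n.
have -> : n%:R * mu * (n%:R^-1 * time_integral (Q w) t) = mu * time_integral (Q w) t.
  by field.
by field; rewrite sn sm.
Qed.

(** The random clock [n^-1 * time_integral (Q n w) t] enters only through its distance to [t]: off
    the event of [fluid_close] it is at most [2^-m], and [stay_close] then applies path by path. *)
Lemma close_pair A S (Q : nat -> T -> D R) mu (Tn : nat) (del eta : R) :
  0 < mu -> poisson_process P 1 A -> poisson_process P 1 S ->
  (forall n, (0 < n)%N -> process (Q n)) ->
  cvg_in_law P P (fun n w => scaleD n%:R^-1 (Q n w)) (fun=> cstD 1) ->
  0 < del -> 0 < eta ->
  exists m0, forall m, (m0 <= m)%N -> exists n0, forall n, (n0 <= n)%N ->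
  exists Bd, [/\ measurable Bd, (P Bd <= eta%:E)%E & forall w, ~ Bd w ->
    forall t, 0 <= t <= Tn%:R ->
    `|arrival_mart A mu n w t - Num.sqrt mu * scaled (A w) (n%:R * mu)
        (dyadic R m (Num.truncn (2 ^+ m * t)))| <= del /\
    `|service_mart S (Q n) mu n w t - Num.sqrt mu * scaled (S w) (n%:R * mu)
        (dyadic R m (Num.truncn (2 ^+ m * t)))| <= del].
Proof.
move=> mu0 pA pS pQ cQ del0 eta0.
have sm : 0 < Num.sqrt mu by rewrite sqrtr_gt0.
(* The martingales carry a factor [sqrt mu], and [stay_close] loses a factor 2. *)
pose dl := del / Num.sqrt mu / 2.
have dl0 : 0 < dl by rewrite !divr_gt0.
have dlE : Num.sqrt mu * (2 * dl) = del by rewrite /dl; field; rewrite gt_eqF.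
have eta30 : 0 < eta / 3 by rewrite divr_gt0.
(* The clock may exceed [Tn] by up to 1, and oscillation is controlled strictly before the horizon;
   hence [Tn.+2]. *)
have [mA HA] := oscillation Tn.+2 pA dl0 eta30.
have [mS HS] := oscillation Tn.+2 pS dl0 eta30.
exists (maxn mA mS) => m; rewrite geq_max => /andP[/HA[aA {}HA] /HS[aS {}HS]].
have p2 : 0 < 2 ^+ m :> R by rewrite exprn_gt0.
(* Integrating an error [e] up to time [Tn] moves the clock by at most one mesh; [e <= 1] keeps it
   nonnegative. *)
pose e : R := (2 ^+ m)^-1 / (Tn%:R + 1).
have T1 : 0 < Tn%:R + 1 :> R by rewrite ltr_wpDl.
have e0 : 0 < e by rewrite divr_gt0// invr_gt0.
have p1 : (2 ^+ m)^-1 <= 1 :> R by rewrite invf_le1// exprn_ege1// ler1n.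
have eT (t : R) : 0 <= t -> t <= Tn%:R -> e * t <= (2 ^+ m)^-1.
  move=> t0 tT; rewrite /e mulrAC ler_pdivrMr// ler_wpM2l ?invr_ge0 ?(ltW p2)//.
  by rewrite (le_trans tT)// lerDl.
have e1 : e <= 1.
  rewrite /e ler_pdivrMr// mul1r (le_trans p1)// lerDr//.
have [n1 _ HQ] := fluid_close Tn%:R cQ e0 eta30.
exists (maxn (maxn n1 1) (Num.truncn ((`|aA| + `|aS|) / mu)).+1) => n.
rewrite !geq_max => /andP[/andP[/HQ[B3 [mB3 PB3 H3]] n0] nn].
have nmu : `|aA| + `|aS| <= n%:R * mu.
  rewrite -ler_pdivrMr//; apply: ltW; rewrite -truncn_lt_nat//.
  by rewrite divr_ge0 ?addr_ge0// ltW.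
have [|B1 [mB1 PB1 H1]] := HA (n%:R * mu).
  by apply: le_trans nmu; rewrite (le_trans (ler_norm _))// lerDl.
have [|B2 [mB2 PB2 H2]] := HS (n%:R * mu).
  by apply: le_trans nmu; rewrite (le_trans (ler_norm _))// lerDr.
exists (B1 `|` B2 `|` B3); split.
- by apply: measurableU => //; exact: measurableU.
- apply: (le_trans (measureU2 _ _ _)) => //; first exact: measurableU.
  have -> : eta = eta / 3 + eta / 3 + eta / 3 by field.
  rewrite 2!EFinD; apply: leeD PB3; apply: (le_trans (measureU2 _ _ _)) => //.
  exact: leeD.
move=> w nB t /andP[t0 tT].
have nB1 : ~ B1 w by move=> b; apply: nB; left; left.
have nB2 : ~ B2 w by move=> b; apply: nB; left; right.
have nB3 : ~ B3 w by move=> b; apply: nB; right.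
have [oscA incA] := H1 _ nB1.
have [oscS incS] := H2 _ nB2.
have fluid := H3 _ nB3.
have T2 : Tn.+2%:R = Tn%:R + 2 :> R by rewrite -addn2 natrD.
have tT2 : 0 <= t < Tn.+2%:R by rewrite t0 T2; lra.
rewrite arrival_mart_scaled// service_mart_scaled//.
rewrite -!mulrBr !normrM (gtr0_norm sm) -dlE !ler_pM2l//; split.
  by apply: (le_trans (oscA _ tT2)); lra.
have tau : `|n%:R^-1 * time_integral (Q n w) t - t| <= e * t.
  apply: time_integral_close => //; first exact: pQ.
  by move=> s /andP[s0 st]; apply: fluid; rewrite s0 (le_trans st).
have et := eT t t0 tT.
have et1 : e * t <= t by rewrite ler_piMl.
apply: stay_close oscS incS tT2 _ _; last exact: le_trans tau et.
by rewrite T2; move: tau; rewrite ler_distl => /andP[h1 h2]; apply/andP; split; lra.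
Qed.

End queue.

(** * Codes of increments and lower envelopes *)

Section finite_mixtures.
Context (R : realType) d (T : measurableType d) (P : probability T R).

Lemma sum_indic_le (I : finType) (W : pred I) (c : I -> R) (E : I -> set T) C w :
  0 <= C -> (forall q q', E q w -> E q' w -> q = q') ->
  (forall q, W q -> E q w -> c q <= C) ->
  \sum_(q | W q) c q * \1_(E q) w <= C.
Proof.
move=> C0 uniq cC; have [[q [Wq Eq]]|none] := pselect (exists q, W q /\ E q w).
  rewrite (bigD1 q)//= big1 ?addr0 => [|q' /andP[_ qq']].
    by rewrite indicE mem_set// mulr1; exact: cC.
  rewrite indicE memNset ?mulr0// => Eq'.
  by move: qq'; rewrite (uniq q' q Eq' Eq) eqxx.
rewrite big1// => q Wq; rewrite indicE memNset ?mulr0// => Eq.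
by apply: none; exists q.
Qed.

Lemma sum_indic_ge (I : finType) (W : pred I) (c : I -> R) (E : I -> set T) w q :
  (forall q, 0 <= c q) -> W q -> E q w -> c q <= \sum_(q | W q) c q * \1_(E q) w.
Proof.
move=> c0 Wq Eq; rewrite (bigD1 q)//= indicE mem_set// mulr1 lerDl.
by apply: sumr_ge0 => q' _; rewrite mulr_ge0.
Qed.

Lemma sum_indic_measurable (I : finType) (W : pred I) (c : I -> R) (E : I -> set T) :
  (forall q, measurable (E q)) ->
  measurable_fun setT (fun w => \sum_(q | W q) c q * \1_(E q) w).
Proof.
move=> mE; under eq_fun do rewrite big_mkcond.
apply: measurable_sum => q; case: (W q) => //.
by apply: measurable_funM => //; exact: measurable_indic.
Qed.

Lemma integral_sum_indic (I : finType) (W : pred I) (c : I -> R) (E : I -> set T) :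
  (forall q, measurable (E q)) -> (forall q, 0 <= c q) ->
  (\int[P]_w (\sum_(q | W q) c q * \1_(E q) w)%:E =
   (\sum_(q | W q) c q * fine (P (E q)))%:E)%E.
Proof.
move=> mE c0; under eq_integral do rewrite big_mkcond/= -sumEFin.
have mF q : measurable_fun setT (fun w => (c q * \1_(E q) w)%:E).
  have mI : measurable_fun setT (fun w => c q * \1_(E q) w).
    by apply: measurable_funM => //; exact: measurable_indic.
  exact/measurable_EFinP.
rewrite ge0_integral_sum//=.
- rewrite [in RHS]big_mkcond/= -sumEFin; apply: eq_bigr => q _.
  case: (W q) => //; last by rewrite integral0.
  under eq_integral do rewrite EFinM.
  rewrite ge0_integralZl//; last by rewrite lee_fin.
  + by rewrite integral_indic// setIT EFinM fineK// fin_num_measure.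
  + by apply/measurable_EFinP; exact: measurable_indic.
- by move=> q; case: (W q).
- by move=> q w _; case: (W q); rewrite // lee_fin mulr_ge0.
Qed.

End finite_mixtures.

Section local_factor_limit.
Context (R : realType).

Lemma bernoulli_ineq (x : R) n : 0 <= x <= 1 -> 1 - n%:R * x <= (1 - x) ^+ n.
Proof.
move=> /andP[x0 x1]; elim: n => [|n IH]; first by rewrite mul0r subr0 expr0.
rewrite exprS; apply: (@le_trans _ _ ((1 - x) * (1 - n%:R * x))).
  rewrite -natr1; have : 0 <= n%:R * x * x by rewrite !mulr_ge0.
  by set y : R := n%:R; clearbody y; lra.
by rewrite ler_wpM2l// subr_ge0.
Qed.

(** [K] is fixed first, to make the Poisson tail small, and only then [r], to make the local error
    small. Each costs at most [e1] per factor, and Bernoulli's inequality bounds the loss over [n]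
    factors by [2 * n * e1]. [K0] lets the caller widen the window. *)
Lemma local_factor_close (n : nat) (e K0 : R) : 0 < e ->
  exists K, [/\ 1 <= K, K0 <= K & exists r0, forall r, r0 <= r ->
    [/\ 2 * K <= r, 0 <= local_factor K r & 1 - e <= local_factor K r ^+ n]].
Proof.
move=> e0; pose e1 := Num.min e 1 / (2 * n.+1%:R).
have n1 : 1 <= n.+1%:R :> R by rewrite ler1n.
have min0 : 0 < Num.min e 1 by rewrite lt_min e0 ltr01.
have min1 : Num.min e 1 <= 1 by rewrite ge_min lexx orbT.
have mine : Num.min e 1 <= e by rewrite ge_min lexx.
have e10 : 0 < e1 by rewrite divr_gt0// mulr_gt0// ltr0n.
have ne1 : 2 * (n.+1%:R * e1) = Num.min e 1.
  have yn : n.+1%:R != 0 :> R by rewrite pnatr_eq0.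
  by rewrite /e1; move: yn; set y : R := n.+1%:R; clearbody y => yn; field.
pose K := 2 + 2 / e1 + `|K0|.
have ie1 : 0 < 2 / e1 by rewrite divr_gt0.
have nK := normr_ge0 K0.
have K1 : 1 <= K by rewrite /K; lra.
have K0K : K0 <= K by rewrite /K; have := ler_norm K0; lra.
exists K; split => //.
pose c := 2 * K * (2 * K ^+ 2 + 1) + 2 * K + 1.
have c0 : 0 < c.
  have : 0 <= 2 * K * (2 * K ^+ 2 + 1) by rewrite !mulr_ge0// ?addr_ge0// ?mulr_ge0// ?sqr_ge0//; lra.
  by rewrite /c; lra.
have ce1 : 0 < c / e1 by rewrite divr_gt0.
exists (2 * K + c / e1) => r rr.
have r0 : 0 < r by lra.
have h1 : local_error K r <= e1.
  by rewrite /local_error -/c ler_pdivrMr// mulrC -ler_pdivrMr//; lra.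
have h2 : 2 * expR (2 - K) <= e1.
  have : expR (2 - K) <= (2 / e1)^-1.
    rewrite -[leLHS]invrK -expRN lef_pV2 ?posrE ?expR_gt0//.
    have := expR_ge1Dx (- (2 - K)); apply: le_trans; rewrite /K; lra.
  by rewrite invf_div; lra.
have h0 : 0 <= local_error K r by rewrite /local_error -/c divr_ge0// ltW.
have h3 : 1 - local_error K r <= expR (- local_error K r).
  by apply: expR_ge1Dx.
have e2 : 2 * e1 <= 1.
  apply: le_trans min1; rewrite -ne1 ler_pM2l//.
  by rewrite ler_peMl// ltW.
have ex0 := expR_ge0 (2 - K).
have lf : 1 - 2 * e1 <= local_factor K r.
  apply: (@le_trans _ _ ((1 - e1) * (1 - e1))).
    have := sqr_ge0 e1; rewrite expr2; lra.
  by apply: ler_pM; lra.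
split; [lra|lra|].
apply: (@le_trans _ _ ((1 - 2 * e1) ^+ n)); last first.
  by rewrite lerXn2r// ?nnegrE; lra.
have x01 : 0 <= 2 * e1 <= 1 by rewrite e2 mulr_ge0// ltW.
apply: le_trans (bernoulli_ineq n x01).
have : n%:R * (2 * e1) <= Num.min e 1.
  rewrite -ne1 mulrCA ler_pM2l// ler_wpM2r ?(ltW e10)//.
  by rewrite ler_nat.
by lra.
Qed.

End local_factor_limit.

Section codes.
Context (R : realType).

Definition code_fun N b (k : {ffun 'I_N -> 'I_b}) (i : nat) : nat :=
  if insub i is Some j then k j : nat else 0%N.

Lemma code_funE N b (k : {ffun 'I_N -> 'I_b}) (j : 'I_N) : code_fun k j = k j.
Proof. by rewrite /code_fun valK. Qed.

Definition code_path a m (kk : nat -> nat) (t : R) : R :=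
  \sum_(j < Num.truncn (2 ^+ m * t)) ((kk j)%:R - a * (2 ^+ m)^-1) / Num.sqrt a.

Context d (T : measurableType d).
Implicit Types (X : T -> D R) (w : T) (a : R) (m N b : nat).

Lemma poisson_event_path X w a m N kk t : X w 0 = 0 ->
  poisson_event X a (2 ^+ m)^-1 N kk w -> (Num.truncn (2 ^+ m * t) <= N)%N ->
  scaled (X w) a (dyadic R m (Num.truncn (2 ^+ m * t))) = code_path a m kk t.
Proof.
move=> X0 Xk; rewrite /code_path; elim: (Num.truncn _) => [|i IH] iN.
  by rewrite big_ord0 /dyadic mul0r /scaled mulr0 X0 subr0 mul0r.
rewrite big_ord_recr/= -IH ?(ltnW iN)// /scaled /dyadic.
have := Xk i iN => /= H; rewrite -H -natr1; ring.
Qed.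

(** Each rounded increment is off by at most [1 / sqrt a], and the errors add up. This is negligible
    since [N] is fixed while [a] grows. *)
Lemma brownian_event_path X w a m N kk t : 0 < a -> X w 0 = 0 ->
  brownian_event X a (2 ^+ m)^-1 N kk w -> (Num.truncn (2 ^+ m * t) <= N)%N ->
  `|code_path a m kk t - X w (dyadic R m (Num.truncn (2 ^+ m * t)))| <=
  N%:R / Num.sqrt a.
Proof.
move=> a0 X0 Xk; have sa : 0 < Num.sqrt a by rewrite sqrtr_gt0.
rewrite /code_path => iN; set i := Num.truncn _ in iN *.
apply: (@le_trans _ _ (i%:R / Num.sqrt a)); last first.
  by rewrite ler_pM2r ?invr_gt0// ler_nat.
elim: i iN => [|i IH] iN.
  by rewrite big_ord0 /dyadic mul0r X0 subrr normr0 mul0r.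
have := Xk i iN; rewrite /= /cell /=.
rewrite -/(dyadic R m i.+1) -/(dyadic R m i) => /andP[h1 h2].
have -> : i.+1%:R / Num.sqrt a = i%:R / Num.sqrt a + (Num.sqrt a)^-1.
  by rewrite -natr1 mulrDl mul1r.
rewrite big_ord_recr/=.
have := IH (ltnW iN); rewrite !ler_norml => /andP[g1 g2].
have c1 : ((kk i)%:R - a * (2 ^+ m)^-1) / Num.sqrt a <=
    X w (dyadic R m i.+1) - X w (dyadic R m i).
  by rewrite ler_pdivrMr// [leRHS]mulrC; lra.
have c2 : X w (dyadic R m i.+1) - X w (dyadic R m i) <=
    ((kk i)%:R - a * (2 ^+ m)^-1) / Num.sqrt a + (Num.sqrt a)^-1.
  have -> : ((kk i)%:R - a * (2 ^+ m)^-1) / Num.sqrt a + (Num.sqrt a)^-1 =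
      ((kk i)%:R - a * (2 ^+ m)^-1 + 1) / Num.sqrt a by rewrite [RHS]mulrDl mul1r.
  rewrite ler_pdivlMr// [leLHS]mulrC.
  by move: h2; rewrite -natr1; lra.
by apply/andP; split; lra.
Qed.

Lemma poisson_event_inj X w a Dl N b (k l : {ffun 'I_N -> 'I_b}) :
  poisson_event X a Dl N (code_fun k) w -> poisson_event X a Dl N (code_fun l) w ->
  k = l.
Proof.
move=> Hk Hl; apply/ffunP => j; apply/val_inj.
have := Hk j (ltn_ord j); have := Hl j (ltn_ord j); rewrite /= !code_funE => -> /eqP.
by rewrite eqr_nat => /eqP.
Qed.

Lemma brownian_event_inj X w a Dl N b (k l : {ffun 'I_N -> 'I_b}) :
  brownian_event X a Dl N (code_fun k) w -> brownian_event X a Dl N (code_fun l) w ->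
  k = l.
Proof.
move=> Hk Hl; apply/ffunP => j; apply/val_inj.
have := Hk j (ltn_ord j); have := Hl j (ltn_ord j); rewrite !code_funE => H1 H2.
apply: (@trivIset_cell R (Num.sqrt a) (a * Dl)) => //.
by exists (X w (j.+1%:R * Dl) - X w (j%:R * Dl)).
Qed.

Definition in_window N b (K r : R) (k : {ffun 'I_N -> 'I_b}) : bool :=
  [forall j, `|(k j)%:R - r * r| <= K * r].

(** Increments of a path bounded by [C] are at most [2 * C]; the additional 1 pays for rounding.
    [2 * K <= r] keeps the recentred increments nonnegative, so that they round to natural
    numbers. *)
Lemma brownian_event_exists X w a m Tn (K r C : R) b : 0 < a -> 0 < r ->
  a * (2 ^+ m)^-1 = r * r -> 2 * K <= r -> 2 * C * Num.sqrt a + 1 <= K * r ->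
  b = (Num.truncn (r * r + K * r)).+1 ->
  (forall t, 0 <= t <= Tn%:R -> `|X w t| <= C) ->
  exists2 k : {ffun 'I_(Tn * 2 ^ m) -> 'I_b}, in_window K r k &
    brownian_event X a (2 ^+ m)^-1 (Tn * 2 ^ m) (code_fun k) w.
Proof.
move=> a0 r0 aD rK KC bE XC; have sa : 0 < Num.sqrt a by rewrite sqrtr_gt0.
have p2 : 0 < 2 ^+ m :> R by rewrite exprn_gt0.
pose z (j : nat) := X w (dyadic R m j.+1) - X w (dyadic R m j).
have XC' j : (j <= Tn * 2 ^ m)%N -> `|X w (dyadic R m j)| <= C.
  move=> jT; apply: XC; rewrite /dyadic divr_ge0 ?(ltW p2)//= ler_pdivrMr//.
  by rewrite -natrX -natrM ler_nat.
have zC j : (j < Tn * 2 ^ m)%N -> `|Num.sqrt a * z j| <= K * r - 1.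
  move=> jT; rewrite normrM gtr0_norm// /z.
  have h : `|X w (dyadic R m j.+1) - X w (dyadic R m j)| <= 2 * C.
    apply: (le_trans (ler_normB _ _)); rewrite mulr_natl mulr2n.
    by apply: lerD; apply: XC' => //; exact: ltnW.
  have : Num.sqrt a * `|X w (dyadic R m j.+1) - X w (dyadic R m j)| <= Num.sqrt a * (2 * C).
    by rewrite ler_pM2l.
  by move: KC; rewrite [_ * Num.sqrt a]mulrC; lra.
have Kr2 : K * r <= r * r.
  have : K <= r by have := le_trans (ltW r0) (le_refl r); lra.
  by rewrite ler_pM2r.
pose v j := r * r + Num.sqrt a * z j.
have v0 j : (j < Tn * 2 ^ m)%N -> 0 <= v j.
  by move=> /zC; rewrite ler_norml /v => /andP[h _]; lra.
have vb (j : 'I_(Tn * 2 ^ m)) : (Num.truncn (v j) < b)%N.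
  rewrite bE ltnS; apply: le_truncn; rewrite /v lerD2l.
  by have := zC j (ltn_ord j); rewrite ler_norml => /andP[_ h]; lra.
exists [ffun j => Ordinal (vb j)].
  apply/forallP => j; rewrite ffunE /=.
  have := zC j (ltn_ord j); have /andP[] := truncn_itv (v0 j (ltn_ord j)).
  rewrite -natr1 /v !ler_norml => h1 h2 /andP[h3 h4]; apply/andP; split; lra.
move=> i iN /=; rewrite (code_funE _ (Ordinal iN)) ffunE /= /cell /= aD.
exact: truncn_itv (v0 i iN).
Qed.

Lemma continuous_dyadic (x : R -> R) (b : R) (e : R) : 0 < e ->
  {within [set t | 0 <= t], continuous x} ->
  \forall m \near \oo, forall t, 0 <= t <= b ->
    `|x t - x (dyadic R m (Num.truncn (2 ^+ m * t)))| <= e.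
Proof.
move=> e0 /subspace_continuousP cx.
have e20 : 0 < e / 2 by rewrite divr_gt0.
(* A neighbourhood of 0 contains negative times, about which nothing is known; hence the premise. *)
pose Q m t := 0 <= t -> `|x t - x (dyadic R m (Num.truncn (2 ^+ m * t)))| <= e.
have /compact_near_coveringP/(_ nat \oo Q _) cov := @segment_compact R 0 b.
have : \forall m \near \oo, `[0, b]%classic `<=` Q m.
  apply: cov => t; rewrite /= in_itv /= => /andP[t0 tb].
  have [dl /= dl0 dP] := (cvgrPdist_lt _ _).1 (cx t t0) _ e20.
  have dl2 : 0 < dl / 2 by rewrite divr_gt0.
  have [m0 M0] := geometric_small (q := 2^-1) 1 ltac:(lra) dl2.
  exists ([set s | `|t - s| < dl / 2], [set m | (m0 <= m)%N]) => /=.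
    split; last by exists m0.
    by exists (dl / 2).
  move=> [s m] [/= ts mm] s0.
  have /andP[h1 h2] := dyadic_trunc m s0.
  set u := dyadic R m _ in h1 h2 *.
  have u0 : 0 <= u by rewrite /u /dyadic divr_ge0// exprn_ge0.
  have us : s < u + (2 ^+ m)^-1.
    by move: h2; rewrite /u /dyadic -natr1 mulrDl mul1r.
  have := M0 m mm; rewrite mul1r exprVn => hm.
  have x1 : `|x t - x s| < e / 2.
    by apply: dP => //=; move: ts; rewrite !ltr_norml => /andP[h3 h4]; apply/andP; split; lra.
  have x2 : `|x t - x u| < e / 2.
    by apply: dP => //=; move: ts; rewrite !ltr_norml => /andP[h3 h4]; apply/andP; split; lra.
  by move: x1 x2; rewrite !ltr_norml ler_norml => /andP[h3 h4] /andP[h5 h6]; apply/andP; split; lra.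
apply: filterS => m H t /andP[t0 tb]; apply: H => //=.
by rewrite in_itv /= t0.
Qed.

End codes.

(** * Lower envelopes over uniform neighbourhoods *)

Section lower_envelope.
Context (R : realType).
Implicit Types (f : D R * D R -> R) (u v : R -> R) (t del h : R).

(** Uniform closeness suffices because it implies $J_1$ closeness with the identity as time change.
    The centres are plain functions, so coded paths need not be packaged as elements of [D]. *)
Definition close2 t del u v (y : D R * D R) := forall s, 0 <= s <= t ->
  `|y.1 s - u s| <= del /\ `|y.2 s - v s| <= del.

Definition lower_env f t del u v : R := inf [set f y | y in close2 t del u v].

Lemma lower_env_lbound f t del u v : (forall y, 0 <= f y) ->
  has_lbound [set f y | y in close2 t del u v].
Proof. by move=> f0; exists 0 => _ [y _ <-]. Qed.

(* [inf set0 = 0]. *)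
Lemma lower_env_none f t del u v : ~ (exists y, close2 t del u v y) ->
  lower_env f t del u v = 0.
Proof.
move=> none; rewrite /lower_env (_ : [set f y | y in _] = set0) ?inf0//.
by apply/seteqP; split=> [z [y cy _]|//]; apply: none; exists y.
Qed.

Lemma lower_env_ge0 f t del u v : (forall y, 0 <= f y) -> 0 <= lower_env f t del u v.
Proof.
move=> f0; have [[y cy]|none] := pselect (exists y, close2 t del u v y).
  by apply: lb_le_inf; [exists (f y), y|move=> _ [z _ <-]].
by rewrite lower_env_none.
Qed.

Lemma lower_env_le f t del u v y : (forall y, 0 <= f y) -> close2 t del u v y ->
  lower_env f t del u v <= f y.
Proof.
by move=> f0 cy; apply: ge_inf; [exact: lower_env_lbound|exists y].
Qed.

Lemma lower_env_leM f t del u v M : (forall y, 0 <= f y) -> (forall y, f y <= M) ->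
  lower_env f t del u v <= M.
Proof.
move=> f0 fM; have [[y cy]|none] := pselect (exists y, close2 t del u v y).
  exact: le_trans (lower_env_le f0 cy) _.
rewrite lower_env_none//; exact: le_trans (f0 (cstD 0, cstD 0)) (fM _).
Qed.

(** The point [y0] excludes the empty neighbourhood, whose infimum would be 0. *)
Lemma lower_env_ge f t del u v y0 h : close2 t del u v y0 ->
  (forall y, close2 t del u v y -> h <= f y) -> h <= lower_env f t del u v.
Proof.
move=> c0 H; apply: lb_le_inf; first by exists (f y0), y0.
by move=> _ [y cy <-]; exact: H.
Qed.

Lemma close2_widen t del u v (u' v' : R -> R) y :
  (forall s, 0 <= s <= t -> `|u s - u' s| <= del /\ `|v s - v' s| <= del) ->
  close2 t del u v y -> close2 t (2 * del) u' v' y.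
Proof.
move=> H cy s st; have [h1 h2] := H s st; have [c1 c2] := cy s st.
rewrite mulr_natl mulr2n; split.
  by rewrite -(subrKA (u s)); apply: (le_trans (ler_normD _ _)); exact: lerD.
by rewrite -(subrKA (v s)); apply: (le_trans (ler_normD _ _)); exact: lerD.
Qed.

End lower_envelope.

Section liminf.
Context (R : realType).

Lemma limn_einf_ge (u : nat -> \bar R) (x : \bar R) N :
  (forall n, (N <= n)%N -> (x <= u n)%E) -> (x <= limn_einf u)%E.
Proof.
move=> H; rewrite limn_einf_lim (cvg_lim _ (@cvg_einfs_sup _ u))//.
apply: (@le_trans _ _ (einfs u N)).
  by apply: le_ereal_inf_tmp => _ [n /= Nn <-]; exact: H.
by apply: ereal_sup_ubound; exists N.
Qed.

Lemma limn_einf_le (u : nat -> \bar R) (c C : R) :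
  (forall n, (u n <= (c + C * n.+1%:R^-1)%:E)%E) -> 0 <= C ->
  (limn_einf u <= c%:E)%E.
Proof.
move=> H C0; rewrite limn_einf_lim (cvg_lim _ (@cvg_einfs_sup _ u))//.
apply: ge_ereal_sup => _ [N _ <-]; apply/lee_addgt0Pr => e e0.
have [k kP] : exists k : nat, C / e < k%:R.
  by exists (Num.bound (C / e)); apply: archi_boundP; rewrite divr_ge0// ltW.
apply: (@le_trans _ _ (u (maxn N k))).
  by apply: ereal_inf_lbound; exists (maxn N k) => //=; exact: leq_maxl.
apply: (le_trans (H _)); rewrite -EFinD lee_fin lerD2l ler_pdivrMr ?ltr0n//.
rewrite mulrC -ler_pdivrMr//; apply: (le_trans (ltW kP)).
by rewrite ler_nat (leq_trans (leq_maxr N k)).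
Qed.

(** The radius is left in the form [2 * del], since passing from the coded path to the path itself
    doubles it. *)
Lemma continuous_close2 (f : D R * D R -> R) (y : D R * D R) (e : R) :
  continuous f -> 0 < e -> exists j0, forall j, (j0 <= j)%N ->
    forall z, close2 j%:R (2 * (j.+1%:R^-1 / 2)) y.1 y.2 z -> f y - e <= f z.
Proof.
move=> cf e0; have /cvgrPdist_lt/(_ _ e0) ny := cf y.
have [U entU UV] : nbhs_ entourage y (fun z => `|f y - f z| < e).
  by rewrite nbhs_entourageE.
have [k kU] := J1_basisP entU.
exists k => j kj z cz; have {}cz : close2 j%:R j.+1%:R^-1 y.1 y.2 z.
  by move: cz; rewrite mulrC divfK.
suff : `|f y - f z| < e by rewrite ltr_norml; lra.
apply: UV; apply/xsectionP; apply: kU.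
have kj' : k%:R <= j%:R :> R by rewrite ler_nat.
have jk : j.+1%:R^-1 <= k.+1%:R^-1 :> R by rewrite lef_pV2 ?posrE ?ltr0n// ler_nat.
split=> /=; apply: (J1_close_sub kj' jk).
  exists id; split; first exact: time_change_id.
    by move=> s _; rewrite subrr normr0 invr_ge0.
  by move=> s sj; have [] := cz s sj.
exists id; split; first exact: time_change_id.
  by move=> s _; rewrite subrr normr0 invr_ge0.
by move=> s sj; have [] := cz s sj.
Qed.

Lemma limn_einf_measurable d (T : measurableType d) (u : nat -> T -> \bar R) :
  (forall n, measurable_fun setT (u n)) ->
  measurable_fun setT (fun w => limn_einf (u ^~ w)).
Proof.
move=> mu_; rewrite /limn_einf; apply: measurableT_comp => //.
apply: (measurable_fun_limn_esup (f := fun n w => - u n w)%E) => n.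
exact: measurableT_comp.
Qed.

End liminf.

(** * The lower bound on the limit inferior of expectations *)

Section approximation.
Context (R : realType).
Context d (T : measurableType d) (P : probability T R).
Context d' (T' : measurableType d') (P' : probability T' R).
Context (mu : R) (A S : T -> D R) (Q : nat -> T -> D R) (B1 B2 : T' -> D R).
Context (M1 M2 : nat -> T -> D R).
Context (mu0 : 0 < mu) (pA : poisson_process P 1 A) (pS : poisson_process P 1 S).
Context (indAS : independent_sigma P (sigma_process A) (sigma_process S)).
Context (pQ : forall n, (0 < n)%N -> process (Q n)).
Context (cQ : cvg_in_law P P (fun n w => scaleD n%:R^-1 (Q n w)) (fun=> cstD 1)).
Context (pB1 : brownian_motion P' B1) (pB2 : brownian_motion P' B2).
Context (indB : independent_sigma P' (sigma_process B1) (sigma_process B2)).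
Context (M1E : forall n w t, (0 < n)%N -> 0 <= t -> M1 n w t = arrival_mart A mu n w t).
Context (M2E : forall n w t, (0 < n)%N -> 0 <= t ->
  M2 n w t = service_mart S (Q n) mu n w t).
Context (pM1 : forall n, (0 < n)%N -> process (M1 n)).
Context (pM2 : forall n, (0 < n)%N -> process (M2 n)).
Context (f : D R * D R -> R) (Mb : R).
Context (cf : continuous f) (f0 : forall y, 0 <= f y) (fM : forall y, f y <= Mb).

Let X n w := (M1 n w, M2 n w).
Let Y w := (scaleD (Num.sqrt mu) (B1 w), scaleD (Num.sqrt mu) (B2 w)).

Lemma mart_comp_measurable n : (0 < n)%N -> measurable_fun setT (f \o X n).
Proof.
move=> n0; apply: borel_comp_measurable => //.
by apply: process_pair_borel_measurable; [exact: pM1|exact: pM2].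
Qed.

Lemma bound_ge0 : 0 <= Mb.
Proof. exact: le_trans (f0 (cstD 0, cstD 0)) (fM _). Qed.

Lemma scaled_close (B : T' -> D R) w a m N kk (t del : R) :
  0 < a -> B w 0 = 0 -> brownian_event B a (2 ^+ m)^-1 N kk w ->
  (Num.truncn (2 ^+ m * t) <= N)%N ->
  Num.sqrt mu * (N%:R / Num.sqrt a) <= del / 2 ->
  Num.sqrt mu * `|B w t - B w (dyadic R m (Num.truncn (2 ^+ m * t)))| <= del / 2 ->
  `|scaleD (Num.sqrt mu) (B w) t - Num.sqrt mu * code_path a m kk t| <= del.
Proof.
move=> a0 B0 ev tN h1 h2; have sm : 0 < Num.sqrt mu by rewrite sqrtr_gt0.
have := brownian_event_path a0 B0 ev tN; set x := B w (dyadic _ _ _) in h2 *.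
rewrite -(ler_pM2l sm) distrC => h3.
rewrite /= -mulrBr normrM gtr0_norm//.
have : Num.sqrt mu * `|B w t - code_path a m kk t| <=
    Num.sqrt mu * (`|B w t - x| + `|x - code_path a m kk t|).
  by rewrite ler_pM2l// -{1}(subrKA x) ler_normD.
rewrite mulrDr; lra.
Qed.

(* [V] is the lower envelope of [f] around the path coded
   by the rounded increments of [B1] and [B2].  Poisson increments have the same
   codes, with at least almost the same probabilities, and the path coded by
   them is close to [X n]. *)
Lemma approx_functional (c del : R) (Tn p : nat) : 0 < del ->
  (forall N, exists2 n, (N <= n)%N & ('E_P[f \o X n] <= c%:E)%E) ->
  exists V : T' -> R,
    [/\ measurable_fun setT V, forall w, 0 <= V w,
        (\int[P']_w (V w)%:E <= (c + 2 * Mb * p.+1%:R^-1)%:E)%E &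
        forall w (C h : R), (forall t : R, 0 <= t <= Tn%:R -> `|B1 w t| <= C /\ `|B2 w t| <= C) ->
          2 * C + 1 <= p.+1%:R ->
          (forall m, (p <= m)%N -> forall t : R, 0 <= t <= Tn%:R ->
            Num.sqrt mu * `|B1 w t - B1 w (dyadic R m (Num.truncn (2 ^+ m * t)))| <= del / 2 /\
            Num.sqrt mu * `|B2 w t - B2 w (dyadic R m (Num.truncn (2 ^+ m * t)))| <= del / 2) ->
          (forall y, close2 Tn%:R (2 * del) (Y w).1 (Y w).2 y -> h <= f y) ->
          h <= V w].
Proof.
move=> del0 freq; have sm : 0 < Num.sqrt mu by rewrite sqrtr_gt0.
have Mb0 := bound_ge0.
pose eta : R := p.+1%:R^-1.
have eta0 : 0 < eta by rewrite invr_gt0 ltr0n.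
have [m0 Hm] := close_pair Tn mu0 pA pS pQ cQ del0 eta0.
pose m := maxn m0 p; have [n0 Hn] := Hm m (leq_maxl _ _).
pose N := (Tn * 2 ^ m)%N.
have p2 : 0 < 2 ^+ m :> R by rewrite exprn_gt0.
(* There are [N] increments for each of the two components. The lower bound on [K] puts paths with
   [2 * C + 1 <= p.+1] inside the window, through the crude estimate [sqrt a <= 2^m * r]. *)
have [K [K1 Kp [r0 Hr]]] := local_factor_close (N + N) (p.+1%:R * 2 ^+ m) eta0.
(* The three terms ensure [1 <= a], [r0 <= r], and an accumulated rounding error of at most
   [del / 2]. *)
pose a1 : R := 1 + r0 ^+ 2 * 2 ^+ m + (2 * Num.sqrt mu * N%:R / del) ^+ 2.
have [n nN En] := freq (maxn (maxn n0 1) (Num.truncn (a1 / mu)).+1).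
move: nN; rewrite !geq_max => /andP[/andP[nn0 n_gt0] na1].
pose a := n%:R * mu.
have aa1 : a1 <= a.
  rewrite -ler_pdivrMr//; apply: ltW; rewrite -truncn_lt_nat//.
  by rewrite divr_ge0 ?(ltW mu0)// /a1 addr_ge0 ?sqr_ge0// addr_ge0// mulr_ge0 ?sqr_ge0 ?(ltW p2).
have sq1 : 0 <= r0 ^+ 2 * 2 ^+ m by rewrite mulr_ge0 ?sqr_ge0// ltW.
have sq2 := sqr_ge0 (2 * Num.sqrt mu * N%:R / del).
have a1' : 1 <= a by move: aa1; rewrite /a1; lra.
have a0 : 0 < a by lra.
have sa : 0 < Num.sqrt a by rewrite sqrtr_gt0.
pose r := Num.sqrt (a / 2 ^+ m).
have aD : a * (2 ^+ m)^-1 = r * r.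
  by rewrite -expr2 sqr_sqrtr// divr_ge0// ltW.
have r_gt0 : 0 < r by rewrite sqrtr_gt0 divr_gt0.
have rr0 : r0 <= r.
  rewrite (le_trans (ler_norm _))// -sqrtr_sqr ler_sqrt ?divr_ge0 ?(ltW a0) ?(ltW p2)//.
  by rewrite ler_pdivlMr//; move: aa1; rewrite /a1; lra.
have [rK lf0 lf1] := Hr r rr0.
have round : Num.sqrt mu * (N%:R / Num.sqrt a) <= del / 2.
  rewrite mulrA ler_pdivrMr//.
  have : 2 * Num.sqrt mu * N%:R / del <= Num.sqrt a.
    rewrite -[leLHS]ger0_norm ?divr_ge0 ?mulr_ge0 ?(ltW sm) ?(ltW del0)//.
    by rewrite -sqrtr_sqr ler_sqrt ?(ltW a0)//; move: aa1; rewrite /a1; lra.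
  by rewrite ler_pdivrMr//; lra.
have [Bd [mBd PBd HBd]] := Hn n nn0.
pose b := (Num.truncn (r * r + K * r)).+1.
pose I := ({ffun 'I_N -> 'I_b} * {ffun 'I_N -> 'I_b})%type.
pose W (q : I) := in_window K r q.1 && in_window K r q.2.
pose phi (k : {ffun 'I_N -> 'I_b}) t := Num.sqrt mu * code_path a m (code_fun k) t.
pose G (q : I) := lower_env f Tn%:R del (phi q.1) (phi q.2).
pose EB (q : I) := brownian_event B1 a (2 ^+ m)^-1 N (code_fun q.1) `&`
  brownian_event B2 a (2 ^+ m)^-1 N (code_fun q.2).
pose EA (q : I) := poisson_event A a (2 ^+ m)^-1 N (code_fun q.1) `&`
  poisson_event S a (2 ^+ m)^-1 N (code_fun q.2).
have D0 : 0 < (2 ^+ m)^-1 :> R by rewrite invr_gt0.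
have mA : process A by case: pA.
have mS : process S by case: pS.
have mB1 : process B1 by case: pB1.
have mB2 : process B2 by case: pB2.
have mEB q : measurable (EB q).
  by apply: measurableI; exact: brownian_event_measurable.
have mEA q : measurable (EA q).
  by apply: measurableI; exact: poisson_event_measurable.
have injB w q q' : EB q w -> EB q' w -> q = q'.
  case: q q' => [q1 q2] [q1' q2'] [/= h1 h2] [/= h1' h2'].
  by rewrite (brownian_event_inj h1 h1') (brownian_event_inj h2 h2').
have injA w q q' : EA q w -> EA q' w -> q = q'.
  case: q q' => [q1 q2] [q1' q2'] [/= h1 h2] [/= h1' h2'].
  by rewrite (poisson_event_inj h1 h1') (poisson_event_inj h2 h2').
have G0 q : 0 <= G q by exact: lower_env_ge0.
have GM q : G q <= Mb by exact: lower_env_leM.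
have tN (t : R) : t <= Tn%:R -> (Num.truncn (2 ^+ m * t) <= N)%N.
  move=> tT; rewrite -[N](@natrK R) /N natrM natrX mulrC; apply: le_truncn.
  by rewrite ler_pM2r.
pose V w := \sum_(q | W q) G q * \1_(EB q) w.
exists V; split.
- exact: sum_indic_measurable.
- by move=> w; apply: sumr_ge0 => q _; rewrite mulr_ge0.
- pose eA := \sum_(q | W q) G q * fine (P (EA q)).
  pose eB := \sum_(q | W q) G q * fine (P' (EB q)).
  have intV : (\int[P']_w (V w)%:E = eB%:E)%E by exact: integral_sum_indic.
  rewrite intV lee_fin.
  have eB0 : 0 <= eB by apply: sumr_ge0 => q _; rewrite mulr_ge0 ?fine_ge0.
  have eBM : eB <= Mb.
    rewrite -lee_fin -intV.
    apply: (@le_trans _ _ (\int[P']_w (cst Mb%:E) w)%E); last first.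
      by rewrite integral_cst//= probability_setT mule1.
    apply: ge0_le_integral => //.
    - by move=> w _; rewrite lee_fin; apply: sumr_ge0 => q _; rewrite mulr_ge0.
    - by apply/measurable_EFinP; exact: sum_indic_measurable.
    - by move=> w _; rewrite lee_fin; apply: sum_indic_le => // q q'; exact: injB.
  have eBA : local_factor K r ^+ (N + N) * eB <= eA.
    rewrite mulr_sumr; apply: ler_sum => q /andP[/forallP W1 /forallP W2].
    rewrite mulrCA ler_wpM2l//; apply: pair_event_lower => //.
      by move=> i iN; rewrite (code_funE _ (Ordinal iN)).
    by move=> i iN; rewrite (code_funE _ (Ordinal iN)).
  have mInd : measurable_fun setT (fun w => Mb * \1_Bd w).
    by apply: measurable_funM => //; exact: measurable_indic.
  (* Off [Bd], [X n] stays within [del] of the path coded by its own Poisson increments, so the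
     envelope is at most [f (X n)]; on [Bd] it is at most [Mb]. *)
  have eAc : eA <= c + Mb * eta.
    rewrite -lee_fin -(integral_sum_indic P W mEA G0).
    apply: (@le_trans _ _ (\int[P]_w ((f (X n w))%:E + (Mb * \1_Bd w)%:E))%E).
      apply: ge0_le_integral => //.
      - by move=> w _; rewrite lee_fin; apply: sumr_ge0 => q _; rewrite mulr_ge0.
      - by apply/measurable_EFinP; exact: sum_indic_measurable.
      - apply: emeasurable_funD; apply/measurable_EFinP => //.
        exact: mart_comp_measurable.
      - move=> w _; rewrite -EFinD lee_fin; have [Bw|nBw] := pselect (Bd w).
          rewrite indicE mem_set// mulr1; apply: (@le_trans _ _ Mb); last first.
            by rewrite lerDr.
          by apply: sum_indic_le => // q q'; exact: injA.
        rewrite indicE memNset// mulr0 addr0.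
        apply: sum_indic_le => // [q q'|q _ [EA1 EA2]]; first exact: injA.
        apply: lower_env_le => // s /andP[s0 sT].
        have sT' : 0 <= s <= Tn%:R by rewrite s0.
        have [c1 c2] := HBd w nBw s sT'.
        rewrite /= M1E// M2E// /phi -(poisson_event_path _ EA1) ?tN//; last first.
          by case: pA.
        by rewrite -(poisson_event_path _ EA2) ?tN//; case: pS.
    rewrite ge0_integralD//=; last 4 first.
    - by move=> w _; rewrite lee_fin.
    - by apply/measurable_EFinP; exact: mart_comp_measurable.
    - by move=> w _; rewrite lee_fin mulr_ge0.
    - exact/measurable_EFinP.
    rewrite EFinD; apply: leeD; first by move: En; rewrite unlock.
    under eq_integral do rewrite EFinM.
    have mI : measurable_fun setT (fun w => (\1_Bd w : R)%:E).
      by apply/measurable_EFinP; exact: measurable_indic.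
    by rewrite ge0_integralZl// integral_indic// setIT EFinM lee_wpmul2l.
  (* One [Mb * eta] pays for the local factor, the other for the exceptional event. *)
  have : (1 - eta) * eB <= local_factor K r ^+ (N + N) * eB by rewrite ler_wpM2r.
  have : eta * eB <= eta * Mb by rewrite ler_wpM2l// ltW.
  move: eBA eAc; rewrite -/eta; lra.
- move=> w C h BC Cp dy H.
  have C0 : 0 <= C.
    have := (BC 0 _).1; rewrite lexx ler0n => /(_ isT); exact: le_trans.
  have KC : 2 * C * Num.sqrt a + 1 <= K * r.
    have s1 : 1 <= Num.sqrt a by rewrite -[leLHS]sqrtr1 ler_sqrt// ltW.
    have h1 : 2 * C * Num.sqrt a + 1 <= p.+1%:R * Num.sqrt a.
      have : (2 * C + 1) * Num.sqrt a <= p.+1%:R * Num.sqrt a by rewrite ler_pM2r.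
      lra.
    have h2 : Num.sqrt a <= 2 ^+ m * r.
      rewrite -(@ler_pXn2r _ 2)// ?nnegrE ?(ltW sa)// ?mulr_ge0 ?(ltW p2) ?(ltW r_gt0)//.
      rewrite exprMn [r ^+ 2]expr2 -aD sqr_sqrtr ?(ltW a0)//.
      have -> : (2 ^+ m) ^+ 2 * (a / 2 ^+ m) = 2 ^+ m * a by field; rewrite gt_eqF.
      by rewrite ler_peMl ?(ltW a0)// exprn_ege1// ler1n.
    apply: (le_trans h1); apply: (@le_trans _ _ (p.+1%:R * (2 ^+ m * r))).
      by rewrite ler_pM2l// ltr0n.
    by rewrite mulrA ler_pM2r.
  have [k1 W1 E1] := @brownian_event_exists R _ T' B1 w a m Tn K r C b a0 r_gt0 aD rK KC
    erefl (fun t tT => (BC t tT).1).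
  have [k2 W2 E2] := @brownian_event_exists R _ T' B2 w a m Tn K r C b a0 r_gt0 aD rK KC
    erefl (fun t tT => (BC t tT).2).
  have pm : (p <= m)%N by exact: leq_maxr.
  have close (t : R) : 0 <= t <= Tn%:R ->
      `|(Y w).1 t - phi k1 t| <= del /\ `|(Y w).2 t - phi k2 t| <= del.
    move=> tT; have [d1 d2] := dy m pm t tT; have /andP[t0 tT'] := tT.
    split.
      apply: (@scaled_close B1 w a m N (code_fun k1) t del a0 _ E1 (tN t tT') round d1).
      by case: pB1.
    apply: (@scaled_close B2 w a m N (code_fun k2) t del a0 _ E2 (tN t tT') round d2).
    by case: pB2.
  apply: (@le_trans _ _ (G (k1, k2))); last first.
    by apply: (@sum_indic_ge R _ T' _ W G EB w (k1, k2)) => //; rewrite /W /= W1.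
  apply: (@lower_env_ge _ _ _ _ _ _ (Y w)); first exact: close.
  move=> y cy; apply: H; apply: close2_widen cy => s sT.
  by have [c1 c2] := close s sT; rewrite ![`|phi _ s - _|]distrC.
Qed.

(** Each Brownian path is bounded and uniformly continuous up to time [j], so it meets the
    requirements of [approx_functional] once [p] is large, with a threshold depending on the path.
    The limit inferior over [p] therefore dominates [h], and Fatou's lemma removes the error of
    order [1 / p]. *)
Lemma envelope_functional (c : R) j :
  (forall N, exists2 n, (N <= n)%N & ('E_P[f \o X n] <= c%:E)%E) ->
  exists Psi : T' -> \bar R,
    [/\ measurable_fun setT Psi, forall w, (0 <= Psi w)%E,
        (\int[P']_w Psi w <= c%:E)%E &
        forall w h, (forall y, close2 j%:R (2 * (j.+1%:R^-1 / 2)) (Y w).1 (Y w).2 y ->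
          h <= f y) -> (h%:E <= Psi w)%E].
Proof.
move=> freq; have del0 : 0 < j.+1%:R^-1 / 2 :> R by rewrite divr_gt0// invr_gt0 ltr0n.
set del := _ / 2 in del0 *.
have Mb0 := bound_ge0.
have /choice[V HV] := fun p => approx_functional j p del0 freq.
exists (fun w => limn_einf (fun p => (V p w)%:E)); split.
- by apply: limn_einf_measurable => p; apply/measurable_EFinP; case: (HV p).
- by move=> w; apply: (@limn_einf_ge _ _ _ 0) => p _; rewrite lee_fin; case: (HV p).
- apply: (le_trans (fatou P' measurableT _ _)).
  + by move=> p; apply/measurable_EFinP; case: (HV p).
  + by move=> p w _; rewrite lee_fin; case: (HV p).
  + by apply: (@limn_einf_le _ _ _ (2 * Mb)) => [p|]; [case: (HV p)|rewrite mulr_ge0].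
move=> w h H; have sm : 0 < Num.sqrt mu by rewrite sqrtr_gt0.
have j0 : 0 <= j%:R :> R by [].
have [C1 HC1] := cadlag_bounded (@path_cadlag _ (B1 w)) j0.
have [C2 HC2] := cadlag_bounded (@path_cadlag _ (B2 w)) j0.
pose C : R := Num.max C1 C2.
have e0 : 0 < del / 2 / Num.sqrt mu by rewrite !divr_gt0.
have [N1 _ HN1] := continuous_dyadic j%:R e0 (@brownian_continuous _ _ _ _ _ pB1 w).
have [N2 _ HN2] := continuous_dyadic j%:R e0 (@brownian_continuous _ _ _ _ _ pB2 w).
pose N3 := Num.bound `|2 * C + 1|.
apply: (@limn_einf_ge _ _ _ (maxn (maxn N1 N2) N3)) => p.
rewrite !geq_max => /andP[/andP[p1 p2] p3]; rewrite lee_fin.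
have [_ _ _ HVp] := HV p; apply: (HVp w C) => //.
- move=> t tj; split; rewrite /C le_max; apply/orP; [left|right].
    exact: HC1.
  exact: HC2.
- apply: (le_trans (ler_norm _)); apply: (@le_trans _ _ N3%:R).
    by apply: ltW; apply: archi_boundP.
  by rewrite ler_nat (leq_trans p3).
- move=> m pm t tj; rewrite -!ler_pdivlMl// ![_^-1 * _]mulrC; split.
    by apply: HN1 => //=; exact: leq_trans pm.
  by apply: HN2 => //=; exact: leq_trans pm.
Qed.

(** The inequality with the limit inferior, stated for any [c] that bounds the expectations
    infinitely often. A second use of Fatou's lemma shrinks the neighbourhoods as [j] grows. *)
Lemma liminf_expectation (c : R) :
  (forall N, exists2 n, (N <= n)%N & ('E_P[f \o X n] <= c%:E)%E) ->
  ('E_P'[f \o Y] <= c%:E)%E.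
Proof.
move=> freq; have /choice[Psi HPsi] := fun j => envelope_functional j freq.
rewrite unlock; apply: (@le_trans _ _ (\int[P']_w limn_einf (Psi ^~ w))%E).
  apply: ge0_le_integral => //.
  - by move=> w _; rewrite lee_fin; exact: f0.
  - apply/measurable_EFinP; apply: borel_comp_measurable => //.
    have pB (B : T' -> D R) : brownian_motion P' B ->
        process (fun w => scaleD (Num.sqrt mu) (B w)).
      by move=> [pB _ _ _ _] t; apply: measurable_funM => //; exact: pB.
    by apply: process_pair_borel_measurable; exact: pB.
  - by apply: limn_einf_measurable => j; case: (HPsi j).
  - move=> w _; apply/lee_addgt0Pr => e e0.
    have [j0 Hj] := continuous_close2 (Y w) cf e0.
    rewrite -leeBlDr// -EFinB; apply: (@limn_einf_ge _ _ _ j0) => j j0j.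
    by case: (HPsi j) => _ _ _; apply; exact: Hj.
apply: (le_trans (fatou P' measurableT _ _)).
- by move=> j; case: (HPsi j).
- by move=> j w _; case: (HPsi j).
- by apply: (@limn_einf_le _ _ _ 0) => // j; rewrite mul0r addr0; case: (HPsi j).
Qed.

End approximation.

(** * From one-sided bounds to convergence in law *)

Section law_of_bounded.
Context (R : realType) d (T : measurableType d) (P : probability T R).

Lemma bounded_expectation_shift (g : T -> R) (M s : R) :
  measurable_fun setT g -> (forall w, `|g w| <= M) ->
  'E_P[fun w => (M + s * g w)%R]%E = (M + s * fine 'E_P[g]%E)%:E /\ 'E_P[g]%E \is a fin_num.
Proof.
move=> mg gM.
have ig : P.-integrable setT (EFin \o g).
  apply: (@measurable_bounded_integrable _ _ _ P) => //.
    exact: le_lt_trans (probability_le1 P measurableT) (ltry 1).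
  by exists M; split=> [|x Mx w _]; [exact: num_real|exact: le_trans (gM w) (ltW Mx)].
have fg : 'E_P[g]%E \is a fin_num by rewrite unlock; exact: integrable_fin_num.
split=> //; rewrite unlock; under eq_integral do rewrite EFinD EFinM.
rewrite integralD//=; first last.
- exact: (integrableZl measurableT s ig).
- exact: finite_measure_integrable_cst.
have := expectation_cst P M; rewrite unlock => ->; rewrite integralZl//.
by rewrite EFinD EFinM fineK//; move: fg; rewrite unlock.
Qed.

End law_of_bounded.

Unset Implicit Arguments.

Theorem lemma4p4 (R : realType)
    (d : measure_display) (T : measurableType d) (P : probability T R)
    (d' : measure_display) (T' : measurableType d') (P' : probability T' R)
    (mu : R) (A S : T -> D R) (Q : nat -> T -> D R) (B1 B2 : T' -> D R) :
  0 < mu ->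
  poisson_process P 1 A ->
  poisson_process P 1 S ->
  independent_sigma P (sigma_process A) (sigma_process S) ->
  (forall n, (0 < n)%N ->
    [/\ process (Q n),
        forall w, exists k : nat, Q n w 0 = k%:R,
        independent_sigma P (sigma_rv [set: unit] (fun _ w => Q n w 0))
          (sigma_process2 A S) &
        forall w t, 0 <= t ->
          Q n w t = Q n w 0 + A w (n%:R * mu * t)
            - S w (mu * \int[lebesgue_measure]_(s in `[0, t]) Q n w s)]) ->
  cvg_in_law P P (fun n w => scaleD (n%:R^-1) (Q n w)) (fun=> cstD 1) ->
  brownian_motion P' B1 ->
  brownian_motion P' B2 ->
  independent_sigma P' (sigma_process B1) (sigma_process B2) ->
  exists M1 M2 : nat -> T -> D R,
    [/\ forall n w t, (0 < n)%N -> 0 <= t ->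
          M1 n w t = (A w (n%:R * mu * t) - n%:R * mu * t)
                       / Num.sqrt n%:R,
        forall n w t, (0 < n)%N -> 0 <= t ->
          M2 n w t = (Num.sqrt n%:R)^-1 *
            (S w (mu * \int[lebesgue_measure]_(s in `[0, t]) Q n w s)
             - mu * \int[lebesgue_measure]_(s in `[0, t]) Q n w s) &
        cvg_in_law P P' (fun n w => (M1 n w, M2 n w))
          (fun w => (scaleD (Num.sqrt mu) (B1 w), scaleD (Num.sqrt mu) (B2 w)))].
Proof.
move=> mu0 pA pS indAS HQ cQ pB1 pB2 indB.
have pQ n : (0 < n)%N -> process (Q n) by move=> /HQ[].
have qQ n : (0 < n)%N -> queue_equation A S (Q n) mu n by move=> /HQ[].
(* Paths are chosen separately for each sample point; measurability is recovered afterwards from the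
   formulas that determine them. *)
have /choice[M1 M1P] (n : nat) : exists m : T -> D R, (0 < n)%N ->
    forall w t, 0 <= t -> m w t = arrival_mart A mu n w t.
  (* A filler for index 0, where nothing is prescribed. *)
  case: n => [|n]; first by exists (fun=> cstD 0).
  have /choice[m mP] w := @arrival_mart_path _ _ _ A mu n.+1 w mu0 (ltn0Sn n).
  by exists m.
have /choice[M2 M2P] (n : nat) : exists m : T -> D R, (0 < n)%N ->
    forall w t, 0 <= t -> m w t = service_mart S (Q n) mu n w t.
  case: n => [|n]; first by exists (fun=> cstD 0).
  have /choice[m mP] w := service_mart_path w mu0 (ltn0Sn n) (pQ n.+1 isT) (qQ n.+1 isT).
  by exists m.
have M1E n w t : (0 < n)%N -> 0 <= t -> M1 n w t = arrival_mart A mu n w t.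
  by move=> n0; exact: M1P.
have M2E n w t : (0 < n)%N -> 0 <= t -> M2 n w t = service_mart S (Q n) mu n w t.
  by move=> n0; exact: M2P.
have pM1 n : (0 < n)%N -> process (M1 n).
  move=> n0; apply: arrival_mart_process (M1P _ n0); exact: poisson_meas pA.
have pM2 n : (0 < n)%N -> process (M2 n).
  move=> n0; apply: service_mart_process (pQ _ n0) (qQ _ n0) (M2P _ n0).
  exact: poisson_meas pA.
have pB (B : T' -> D R) : brownian_motion P' B ->
    process (fun w => scaleD (Num.sqrt mu) (B w)).
  by move=> [pB _ _ _ _] t; apply: measurable_funM => //; exact: pB.
pose X n w := (M1 n w, M2 n w).
pose Y w := (scaleD (Num.sqrt mu) (B1 w), scaleD (Num.sqrt mu) (B2 w)).
have bX n : (0 < n)%N -> borel_measurable (X n).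
  by move=> n0; apply: process_pair_borel_measurable; [exact: pM1|exact: pM2].
have bY : borel_measurable Y.
  by apply: process_pair_borel_measurable; exact: pB.
exists M1, M2; split=> //; split=> //.
  by exists 1%N => // n /= n0; exact: bX.
(* The lower bound for both [M + f] and [M - f] gives convergence. *)
move=> f cf [M fM].
have lb (s : R) : s = 1 \/ s = -1 -> forall e, 0 < e ->
    \forall n \near \oo, s * fine 'E_P'[f \o Y]%E - e < s * fine 'E_P[f \o X n]%E.
  move=> s1 e e0; apply: contrapT => H.
  have := @liminf_expectation R d T P d' T' P' mu A S Q B1 B2 M1 M2 mu0 pA pS indAS
    pQ cQ pB1 pB2 indB M1E M2E pM1 pM2 (fun y => M + s * f y) (2 * M) _ _ _
    (M + (s * fine 'E_P'[f \o Y]%E - e)).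
  have [-> _] := bounded_expectation_shift P' s
    (borel_comp_measurable bY cf) (fun w => fM (Y w)).
  rewrite lee_fin => lb; suff : M + s * fine 'E_P'[f \o Y]%E <=
    M + (s * fine 'E_P'[f \o Y]%E - e) by lra.
  apply: lb.
  - by move=> y; apply: cvgD; [exact: cvg_cst|apply: cvgMl_tmp; exact: cf].
  - by move=> y; have := fM y; rewrite ler_norml; case: s1 => ->; lra.
  - by move=> y; have := fM y; rewrite ler_norml; case: s1 => ->; lra.
  move=> N; apply: contrapT => nN; apply: H.
  exists (maxn N 1) => // n /=; rewrite geq_max => /andP[Nn n0].
  rewrite ltNge; apply/negP => le; apply: nN; exists n => //.
  have [-> _] := bounded_expectation_shift P s
    (borel_comp_measurable (bX n n0) cf) (fun w => fM (X n w)).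
  by rewrite lee_fin lerD2l.
have [_ fY] := bounded_expectation_shift P' 1
  (borel_comp_measurable bY cf) (fun w => fM (Y w)).
rewrite -[X in _ --> X]/('E_P'[f \o Y])%E -(fineK fY); apply/fine_cvgP; split.
  exists 1%N => // n /= n0.
  by have [] := bounded_expectation_shift P 1
    (borel_comp_measurable (bX n n0) cf) (fun w => fM (X n w)).
apply/cvgrPdist_lt => e e0.
near=> n.
have h1 : 1 * fine 'E_P'[f \o Y]%E - e < 1 * fine 'E_P[f \o X n]%E.
  by near: n; apply: lb => //; left.
have h2 : -1 * fine 'E_P'[f \o Y]%E - e < -1 * fine 'E_P[f \o X n]%E.
  by near: n; apply: lb => //; right.
by move: h1 h2; rewrite /= ltr_norml; lra.
Unshelve. all: by end_near. Qed.
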